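(* Let $\mathcal V\subset\mathbb R^{n_1+n_2+2}$ be a compact set such that every $h=(X,W,(E_{1,j}),(E_{2,j}))\in\mathcal V$ satisfies $X\in A$, $W\in B$, $E_{i,j}\in C$ for compact sets $A\subset(0,1)$, $B\subset\mathbb R$, $C\subset(0,\kappa(0))$. Then there exists $\delta_0>0$ such that the map $(\delta,h)\mapsto\bar H^\delta(h)$ is $\mathcal C^1$ on $\{(\delta,h):0\le\delta\le\delta_0,\ h\in\mathcal V\}$. Furthermore, for each $T>0$ there exist $K>0$ and $\varepsilon_0>0$ such that for all $\varepsilon\in(0,\varepsilon_0]$, all $\delta\in[0,\delta_0]$ and all initial conditions with $h^\delta_\varepsilon(0)\in\mathcal V$, \[ \sup_{0\le\tau\le T\wedge T^\delta_\varepsilon}\bigl|h^\delta_\varepsilon(\tau/\varepsilon)-\bar h^\delta(\tau)\bigr|\le K\varepsilon . \]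
   Context: Soft core piston system: fix integers $n_1,n_2\ge1$ and masses $m_{1,j},m_{2,j}>0$. Let $\kappa:\mathbb R\to\mathbb R$ be $\mathcal C^2$ with $\kappa(x)=0$ for $x\ge1$ and $\kappa'(x)<0$ for $x<1$; for $\delta>0$ put $\kappa_\delta(x)=\kappa(x/\delta)$, and let $\kappa^{-1}:[0,\kappa(0)]\to[0,1]$ denote the inverse of $\kappa|_{[0,1]}$. A piston (mass $M$, position $X$, velocity $V$), $n_1$ gas particles (positions $x_{1,j}$, velocities $v_{1,j}$) to its left and $n_2$ gas particles (positions $x_{2,j}$, velocities $v_{2,j}$) to its right move on the line under the Hamiltonian $\frac{M V^2}{2}+\sum_{i,j}\frac{m_{i,j}v_{i,j}^2}{2}+\sum_{j=1}^{n_1}[\kappa_\delta(x_{1,j})+\kappa_\delta(X-x_{1,j})]+\sum_{j=1}^{n_2}[\kappa_\delta(x_{2,j}-X)+\kappa_\delta(1-x_{2,j})]$. Set $\varepsilon=M^{-1/2}$, $W=V/\varepsilon$, and define particle energies $E_{1,j}=\frac12m_{1,j}v_{1,j}^2+\kappa_\delta(x_{1,j})+\kappa_\delta(X-x_{1,j})$, $E_{2,j}=\frac12m_{2,j}v_{2,j}^2+\kappa_\delta(x_{2,j}-X)+\kappa_\delta(1-x_{2,j})$. The slow variables are $h=(X,W,(E_{1,j})_j,(E_{2,j})_j)$. For $\delta=0$ the dynamics is by definition the hard core dynamics (piston and gas particles as point particles colliding elastically with each other and with walls at $0$ and $1$; gas particles do not interact among themselves), with $E_{i,j}=m_{i,j}v_{i,j}^2/2$.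 $h^\delta_\varepsilon(t)$ denotes the slow variables at time $t$ for parameters $\varepsilon,\delta$ from a given initial condition. Periods: for $\delta>0$ and $a=\delta\kappa^{-1}(E)$, $T_{1,j}(X,E,\delta)=2\int_a^{X-a}\sqrt{\frac{m_{1,j}/2}{E-\kappa_\delta(s)-\kappa_\delta(X-s)}}\,ds$ and $T_{2,j}(X,E,\delta)=2\int_{X+a}^{1-a}\sqrt{\frac{m_{2,j}/2}{E-\kappa_\delta(s-X)-\kappa_\delta(1-s)}}\,ds$ (periods of the gas particle motions with the piston held fixed); for $\delta=0$, $T_{1,j}(X,E,0)=\sqrt{2m_{1,j}/E}\,X$, $T_{2,j}(X,E,0)=\sqrt{2m_{2,j}/E}\,(1-X)$. Writing $T_{i,j}=T_{i,j}(X,E_{i,j},\delta)$, the averaged vector field $\bar H^\delta$ is \[ \frac{dX}{d\tau}=W,\ \ \frac{dW}{d\tau}=\sum_{j=1}^{n_1}\frac{\sqrt{8m_{1,j}E_{1,j}}}{T_{1,j}}-\sum_{j=1}^{n_2}\frac{\sqrt{8m_{2,j}E_{2,j}}}{T_{2,j}},\ \ \frac{dE_{1,j}}{d\tau}=-W\frac{\sqrt{8m_{1,j}E_{1,j}}}{T_{1,j}},\ \ \frac{dE_{2,j}}{d\tau}=W\frac{\sqrt{8m_{2,j}E_{2,j}}}{T_{2,j}}. \] $\bar h^\delta(\tau)$ is the solution of $d\bar h^\delta/d\tau=\bar H^\delta(\bar h^\delta)$, $\bar h^\delta(0)=h^\delta_\varepsilon(0)$, and $T^\delta_\varepsilon=\inf\{\tau\ge0:\bar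 h^\delta(\tau)\notin\mathcal V\text{ or }h^\delta_\varepsilon(\tau/\varepsilon)\notin\mathcal V\}$. *)

(* Defs.v *)
From HB Require Import structures.
From mathcomp Require Import all_boot all_order all_algebra.
From mathcomp Require Import all_classical all_reals all_analysis.
Set Implicit Arguments. Unset Strict Implicit. Unset Printing Implicit Defensive.
Import Order.TTheory GRing.Theory Num.Theory.
Import numFieldNormedType.Exports.
Local Open Scope classical_set_scope.
Local Open Scope ring_scope.

Section Piston.
Variable R : realType.

Definition kappa_hyp (k : R -> R) : Prop :=
  (forall x, derivable k x 1) /\
  (forall x, derivable (derive1 k) x 1) /\
  continuous (derive1 (derive1 k)) /\
  (forall x, 1 <= x -> k x = 0) /\
  (forall x, x < 1 -> derive1 k x < 0).

Definition kd (k : R -> R) (d : R) (x : R) : R := k (x / d).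

Definition kinv (k : R -> R) (y : R) : R :=
  xget 0 [set x : R | 0 <= x <= 1 /\ k x = y].

(** Full phase-space state: piston (X,V), left gas (x1,v1), right gas (x2,v2). *)
Record pstate (n1 n2 : nat) := PState {
  pX : R; pV : R;
  px1 : 'I_n1 -> R; pv1 : 'I_n1 -> R;
  px2 : 'I_n2 -> R; pv2 : 'I_n2 -> R }.

Variables (n1 n2 : nat) (m1 : 'I_n1 -> R) (m2 : 'I_n2 -> R) (k : R -> R).

Definition mkslow (X W : R) (E1 : 'I_n1 -> R) (E2 : 'I_n2 -> R)
  : 'rV[R]_(2 + n1 + n2) :=
  row_mx (row_mx (\row_(i < 2) (if i == ord0 then X else W)) (\row_j E1 j))
         (\row_j E2 j).

Definition slX (h : 'rV[R]_(2 + n1 + n2)) : R := lsubmx (lsubmx h) ord0 ord0.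
Definition slW (h : 'rV[R]_(2 + n1 + n2)) : R :=
  lsubmx (lsubmx h) ord0 (@Ordinal 2 1 isT).
Definition slE1 (h : 'rV[R]_(2 + n1 + n2)) (j : 'I_n1) : R :=
  rsubmx (lsubmx h) ord0 j.
Definition slE2 (h : 'rV[R]_(2 + n1 + n2)) (j : 'I_n2) : R := rsubmx h ord0 j.

(** Slow variables of a phase-space state, for parameters delta, eps
    (delta = 0 : hard core, energies are kinetic). *)
Definition slow (d eps : R) (z : pstate n1 n2) : 'rV[R]_(2 + n1 + n2) :=
  mkslow (pX z) (pV z / eps)
    (fun j => m1 j * (pv1 z j) ^+ 2 / 2 +
       (if d == 0 then 0 else kd k d (px1 z j) + kd k d (pX z - px1 z j)))
    (fun j => m2 j * (pv2 z j) ^+ 2 / 2 +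
       (if d == 0 then 0 else kd k d (px2 z j - pX z) + kd k d (1 - px2 z j))).

Definition T1 (X E d : R) (j : 'I_n1) : R :=
  if d == 0 then Num.sqrt (2 * m1 j / E) * X
  else let a := d * kinv k E in
    2 * \int[lebesgue_measure]_(s in `[a, X - a]%classic)
          Num.sqrt ((m1 j / 2) / (E - kd k d s - kd k d (X - s))).

Definition T2 (X E d : R) (j : 'I_n2) : R :=
  if d == 0 then Num.sqrt (2 * m2 j / E) * (1 - X)
  else let a := d * kinv k E in
    2 * \int[lebesgue_measure]_(s in `[X + a, 1 - a]%classic)
          Num.sqrt ((m2 j / 2) / (E - kd k d (s - X) - kd k d (1 - s))).

Definition Hbar (d : R) (h : 'rV[R]_(2 + n1 + n2)) : 'rV[R]_(2 + n1 + n2) :=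
  let X := slX h in let W := slW h in
  let f1 j := Num.sqrt (8 * m1 j * slE1 h j) / T1 X (slE1 h j) d j in
  let f2 j := Num.sqrt (8 * m2 j * slE2 h j) / T2 X (slE2 h j) d j in
  mkslow W (\sum_j f1 j - \sum_j f2 j) (fun j => - W * f1 j) (fun j => W * f2 j).

(** Soft core (delta > 0) Hamiltonian dynamics with piston mass M = eps^-2,
    on the time interval [0, tm]. *)
Definition soft_traj (d eps : R) (z : R -> pstate n1 n2) (tm : R) : Prop :=
  let kp := derive1 (kd k d) in
  let I := [set t : R | 0 <= t <= tm] in
  {within I, continuous (fun t => pX (z t))} /\
  {within I, continuous (fun t => pV (z t))} /\
  (forall j, {within I, continuous (fun t => px1 (z t) j)}) /\
  (forall j, {within I, continuous (fun t => pv1 (z t) j)}) /\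
  (forall j, {within I, continuous (fun t => px2 (z t) j)}) /\
  (forall j, {within I, continuous (fun t => pv2 (z t) j)}) /\
  forall t, 0 < t < tm ->
    is_derive t 1 (fun s => pX (z s)) (pV (z t)) /\
        is_derive t 1 (fun s => pV (z s))
          (eps ^+ 2 * (- (\sum_j kp (pX (z t) - px1 (z t) j))
                       + \sum_j kp (px2 (z t) j - pX (z t)))) /\
        (forall j, is_derive t 1 (fun s => px1 (z s) j) (pv1 (z t) j)) /\
        (forall j, is_derive t 1 (fun s => pv1 (z s) j)
           ((kp (pX (z t) - px1 (z t) j) - kp (px1 (z t) j)) / m1 j)) /\
        (forall j, is_derive t 1 (fun s => px2 (z s) j) (pv2 (z t) j)) /\
        (forall j, is_derive t 1 (fun s => pv2 (z s) j)
           ((kp (1 - px2 (z t) j) - kp (px2 (z t) j - pX (z t))) / m2 j)).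

Definition drift (w : pstate n1 n2) (r : R) : pstate n1 n2 :=
  PState (pX w + r * pV w) (pV w)
    (fun j => px1 w j + r * pv1 w j) (pv1 w)
    (fun j => px2 w j + r * pv2 w j) (pv2 w).

(** Elastic collision of masses M (velocity U) and m (velocity u):
    new velocity of the first one. *)
Definition elastic (M m U u : R) : R := ((M - m) * U + 2 * m * u) / (M + m).

(** Collision rule: w is the state just before time t (positions at t,
    incoming velocities), w' the state at t (outgoing velocities).  At most one
    gas particle may touch the piston (otherwise the hard core dynamics is
    not defined); particles at a wall are reflected. *)
Definition collision (M : R) (w w' : pstate n1 n2) : Prop :=
  [/\ pX w' = pX w /\ px1 w' = px1 w /\ px2 w' = px2 w,
      (forall j j', px1 w j = pX w -> px1 w j' = pX w -> j = j'),
      (forall j j', px2 w j = pX w -> px2 w j' = pX w -> j = j'),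
      (forall j j', ~ (px1 w j = pX w /\ px2 w j' = pX w)) &
      [/\ forall j, pv1 w' j =
            if px1 w j == 0 then - pv1 w j
            else if px1 w j == pX w then elastic (m1 j) M (pv1 w j) (pV w)
            else pv1 w j,
          forall j, pv2 w' j =
            if px2 w j == 1 then - pv2 w j
            else if px2 w j == pX w then elastic (m2 j) M (pv2 w j) (pV w)
            else pv2 w j,
          forall j, px1 w j = pX w -> pV w' = elastic M (m1 j) (pV w) (pv1 w j),
          forall j, px2 w j = pX w -> pV w' = elastic M (m2 j) (pV w) (pv2 w j) &
          (forall j, px1 w j <> pX w) -> (forall j, px2 w j <> pX w) ->
            pV w' = pV w]].

(** Hard core (delta = 0) dynamics with piston mass M = eps^-2 on [0, tm]:
    ordered point particles, free motion between collisions (collision times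
    do not accumulate), elastic collisions with the piston and the walls
    at 0 and 1; velocities are right-continuous. *)
Definition hard_traj (eps : R) (z : R -> pstate n1 n2) (tm : R) : Prop :=
  [/\ forall t, 0 <= t <= tm ->
        (forall j, 0 <= px1 (z t) j <= pX (z t)) /\
        (forall j, pX (z t) <= px2 (z t) j <= 1),
      forall t, 0 <= t < tm -> exists2 eta : R, 0 < eta &
        forall s, t <= s < t + eta -> z s = drift (z t) (s - t) &
      forall t, 0 < t <= tm -> exists2 eta : R, 0 < eta &
        exists w : pstate n1 n2,
          (forall s, t - eta < s < t -> z s = drift w (s - t)) /\
          collision (eps ^- 2) w (z t)].

Definition traj (d eps : R) (z : R -> pstate n1 n2) (tm : R) : Prop :=
  if d == 0 then hard_traj eps z tm else soft_traj d eps z tm.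

Definition avg_sol (d : R) (hb : R -> 'rV[R]_(2 + n1 + n2)) (T : R) : Prop :=
  {within [set s : R | 0 <= s <= T], continuous hb} /\
  forall s, 0 < s < T -> is_derive s 1 hb (Hbar d (hb s)).

End Piston.

(** C^1 on an arbitrary (e.g. closed) set S of a normed space: the restriction
    to S of a map which is C^1 (differentiable with continuous derivative,
    i.e. all directional derivatives continuous) on an open neighbourhood of S. *)
Definition C1_on {R : realType} {U V : normedModType R} (f : U -> V) (S : set U)
  : Prop :=
  exists (O : set U) (G : U -> V),
    [/\ open O, S `<=` O,
        (forall p, O p -> differentiable G p),
        (forall (v : U) p, O p -> {for p, continuous (fun q => 'D_v G q)}) &
        (forall p, S p -> G p = f p)].

(* Main.v *)
(** With the piston fixed, a wall passage costs the same phase time at both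
    ends, so the period is [sqrt (2 m) * (2 d g(E) + (L - 2 d) / sqrt E)] with
    [g] independent of [d], and the momentum flux [sqrt (8 m E) / T] equals
    [2 E / (L - 2 d (1 - sqrt E * g E))], which extends to [d = 0].  That [g]
    is C^1 is seen by splitting the phase time [\int ds / sqrt (E - k s)] into
    a part parametrised by the momentum [p = sqrt (E - k s)], regular at the
    turning point because [k' < 0] there, and a part parametrised by position,
    away from the turning point.

    For the averaging, each particle gets a bounded corrector [chi]: its momentum
    exchange with the piston so far minus flux times phase time (for the hard
    core, [- m v x / X]), so that [chi' = F - f + O(eps) (1 + F)], where [F >= 0]
    is the force on the piston and [f] its average; hard core collisions make
    [chi] jump by the impulse.  Then [X], [W - eps sum (+- chi)],
    [E +- eps W chi] satisfy the averaged equations up to errors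
    [O(eps^2) (1 + sum F)].  Since [sum F] is unbounded as [d] tends to 0, time is
    measured by the increasing function [2 sum chi + C t], whose total variation
    controls the integral of [sum F] uniformly in [d]; a Gronwall inequality in this
    clock, with jumps allowed, gives the bound. *)

Require Import Defs.
From HB Require Import structures.
From mathcomp Require Import all_boot all_order all_algebra.
From mathcomp Require Import all_classical all_reals all_analysis.
From mathcomp Require Import measurable_realfun.
From mathcomp Require Import ring lra.
Import Order.TTheory GRing.Theory Num.Theory.
Import numFieldNormedType.Exports.
Local Open Scope classical_set_scope.
Local Open Scope ring_scope.
Set Implicit Arguments.
Unset Strict Implicit.
Unset Printing Implicit Defensive.

(** * Derivatives and parametric primitives *)

(** The order count behind the bound: the corrected differences move by at most [eps^2] per unit of
    the clock, up to a Gronwall term, and since the correctors are bounded the clock advances only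
    by [O(1 / eps)] on a time interval of length [T / eps]; hence [O(eps)]. The clock dominates the
    force because its slope is at least [1 + \sum_j (1 + F j)] once [Cr * eps <= 1 / 2]. Uniformity
    in [d] rests on rescaling: a wall passage depends on [x / d] and the energy only, its constants
    come from an energy window [[El, Eh]] strictly between 0 and [k 0], and the physical phase time
    is of size [d (1 + |x| / d)], which stays bounded. The threshold [d0] keeps the effective length
    [L - 2 d gam(E)] above [r / 2]. The compact set is replaced by an open box with strict margins,
    so that its inequalities persist at nearby times and chain rules apply. The equations hold only
    at interior times: the initial time is reached by letting the starting time tend to 0, the final
    time by continuity for the soft core. For the hard core a collision may occur exactly at the
    final time and is treated as one more jump. *)

Section Calculus.
Context {R : realType}.
Implicit Types (f g df : R -> R) (a b c t x : R).

(** The rules below are composed as terms, which yields a derivative in raw form; this lemma leaves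
    the algebraic identity with the wanted form as a separate goal. *)
Lemma dv_eq f x a b : is_derive x (1 : R) f a -> a = b -> is_derive x (1 : R) f b.
Proof. by move=> ? <-. Qed.

Lemma dv_near f g x a : (\forall s \near x, f s = g s) ->
  is_derive x (1 : R) f a -> is_derive x (1 : R) g a.
Proof. exact: near_eq_is_derive. Qed.

Lemma dv_cst c x : is_derive x (1 : R) (fun=> c) 0.
Proof. exact: is_derive_cst. Qed.

Lemma dv_id x : is_derive x (1 : R) (fun s : R => s) 1.
Proof. exact: is_derive_id. Qed.

Lemma dvD f g x a b : is_derive x (1 : R) f a -> is_derive x (1 : R) g b ->
  is_derive x (1 : R) (fun s => f s + g s) (a + b).
Proof. exact: is_deriveD. Qed.

Lemma dvB f g x a b : is_derive x (1 : R) f a -> is_derive x (1 : R) g b ->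
  is_derive x (1 : R) (fun s => f s - g s) (a - b).
Proof. exact: is_deriveB. Qed.

Lemma dvN f x a : is_derive x (1 : R) f a ->
  is_derive x (1 : R) (fun s => - f s) (- a).
Proof. exact: is_deriveN. Qed.

Lemma dvM f g x a b : is_derive x (1 : R) f a -> is_derive x (1 : R) g b ->
  is_derive x (1 : R) (fun s => f s * g s) (f x * b + g x * a).
Proof. exact: is_deriveM. Qed.

Lemma dvMl c f x a : is_derive x (1 : R) f a ->
  is_derive x (1 : R) (fun s => c * f s) (c * a).
Proof.
by move=> fa; apply: dv_eq (dvM (dv_cst c x) fa) _; rewrite mulr0 addr0.
Qed.

Lemma dvMr c f x a : is_derive x (1 : R) f a ->
  is_derive x (1 : R) (fun s => f s * c) (a * c).
Proof.
by move=> fa; apply: dv_eq (dvM fa (dv_cst c x)) _; rewrite mulr0 add0r mulrC.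
Qed.

Lemma dv_comp f g x a b : is_derive (g x) (1 : R) f a -> is_derive x (1 : R) g b ->
  is_derive x (1 : R) (fun s => f (g s)) (a * b).
Proof. exact: is_derive1_comp. Qed.

Lemma dv_sum (I : finType) (f : I -> R -> R) x (a : I -> R) :
  (forall i, is_derive x (1 : R) (f i) (a i)) ->
  is_derive x (1 : R) (fun s => \sum_i f i s) (\sum_i a i).
Proof.
move=> fa; rewrite (_ : (fun s => _) = fun s => \sum_(i <- enum I) f i s); last first.
  by apply/funext => s; rewrite big_enum.
rewrite -big_enum; elim: (enum I) => [|i r IH].
  rewrite big_nil (_ : (fun s => _) = fun=> 0); first exact: dv_cst.
  by apply/funext => s; rewrite big_nil.
rewrite big_cons (_ : (fun s => _) = fun s => f i s + \sum_(j <- r) f j s).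
  exact: dvD.
by apply/funext => s; rewrite big_cons.
Qed.

Lemma dv_cont f x a : is_derive x (1 : R) f a -> {for x, continuous f}.
Proof. by move=> [d _]; apply/differentiable_continuous/derivable1_diffP. Qed.

Lemma dv_within f df a b : (forall x, a <= x <= b -> is_derive x (1 : R) f (df x)) ->
  {within `[a, b], continuous f}.
Proof.
move=> fd; apply: derivable_within_continuous => x.
by rewrite in_itv/= => /fd[].
Qed.

Lemma mvt_bound f df a b C : a <= b ->
  (forall x, a < x < b -> is_derive x (1 : R) f (df x)) ->
  {within `[a, b], continuous f} ->
  (forall x, a < x < b -> `|df x| <= C) -> `|f b - f a| <= C * (b - a).
Proof.
rewrite le_eqVlt => /predU1P[<-|ab] fd fc dC; first by rewrite !subrr mulr0 normr0.
have [x + ->] : exists2 c, c \in `]a, b[ & f b - f a = df c * (b - a).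
  by apply: MVT => // x; rewrite in_itv/=; exact: fd.
rewrite in_itv/= => /dC dx.
by rewrite normrM [X in _ * X <= _]gtr0_norm ?subr_gt0// ler_pM2r ?subr_gt0.
Qed.

Lemma mvt_bound_sym f df a b C (M := Num.max a b) (m := Num.min a b) :
  (forall x, m <= x <= M -> is_derive x (1 : R) f (df x)) ->
  (forall x, m <= x <= M -> `|df x| <= C) -> `|f b - f a| <= C * `|b - a|.
Proof.
rewrite /M /m; have [ab|ba] := leP a b => fd dC.
  rewrite [X in _ * X]ger0_norm ?subr_ge0//; apply: (@mvt_bound f df) => //.
  - by move=> x /andP[/ltW ax /ltW xb]; apply: fd; rewrite ax xb.
  - exact: dv_within fd.
  - by move=> x /andP[/ltW ax /ltW xb]; apply: dC; rewrite ax xb.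
rewrite distrC [`|b - a|]distrC [X in _ * X]ger0_norm ?subr_ge0 ?(ltW ba)//.
apply: (@mvt_bound f df) => //; first exact: ltW.
- by move=> x /andP[/ltW ax /ltW xb]; apply: fd; rewrite ax xb.
- exact: dv_within fd.
- by move=> x /andP[/ltW ax /ltW xb]; apply: dC; rewrite ax xb.
Qed.

Lemma dv0_eq f a b : a <= b -> (forall x, a < x < b -> is_derive x (1 : R) f 0) ->
  {within `[a, b], continuous f} -> f b = f a.
Proof.
move=> ab fd fc; apply/eqP; rewrite -subr_eq0 -normr_le0.
rewrite -(mul0r (b - a)); apply: (@mvt_bound f (fun=> 0)) => // x _.
by rewrite normr0.
Qed.


(** The integrals started at [- n.+1], normalised to vanish at 0, are primitives on half-lines. Any
    two agree where both are defined, because their difference has zero derivative, so they glue to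
    one primitive on the whole line. *)
Lemma ex_primitive f : continuous f ->
  exists F : R -> R, F 0 = 0 /\ forall x, is_derive x (1 : R) F (f x).
Proof.
move=> fc.
pose G (n : nat) x := \int[lebesgue_measure]_(s in `[- n.+1%:R, x]) f s.
pose H n x := G n x - G n 0.
have Gd n x : - n.+1%:R < x -> is_derive x (1 : R) (G n) (f x).
  move=> nx.
  have fi : (@lebesgue_measure R).-integrable `[- n.+1%:R, x + 1] (EFin \o f).
    apply: continuous_compact_integrable; first exact: segment_compact.
    exact: continuous_subspaceT.
  have [|d <-] := continuous_FTC1_closed _ fi nx (fc x).
    by rewrite ltrDl.
  by rewrite derive1E; apply: derivableP.
have Hd n x : - n.+1%:R < x -> is_derive x (1 : R) (H n) (f x).
  by move=> nx; apply: dv_eq (dvB (Gd _ _ nx) (dv_cst _ _)) _; rewrite subr0.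
have H0 n : H n 0 = 0 by rewrite /H subrr.
have HH n m x : (n <= m)%N -> - n.+1%:R < x -> H n x = H m x.
  move=> nm nx.
  have mx : - m.+1%:R < x by apply: le_lt_trans nx; rewrite lerN2 ler_nat.
  have n0 : - n.+1%:R < 0 :> R by rewrite oppr_lt0 ltr0n.
  have m0 : - m.+1%:R < 0 :> R by rewrite oppr_lt0 ltr0n.
  have D y : Num.min 0 x <= y -> is_derive y (1 : R) (fun s => H n s - H m s) 0.
    move=> y0; apply: dv_eq (dvB (Hd n y _) (Hd m y _)) _; last exact: subrr.
      by apply: lt_le_trans y0; rewrite lt_min n0.
    by apply: lt_le_trans y0; rewrite lt_min m0.
  have : `|(H n x - H m x) - (H n 0 - H m 0)| <= 0 * `|x - 0|.
    apply: (@mvt_bound_sym (fun s => H n s - H m s) (fun=> 0)).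
      by move=> y /andP[+ _]; exact: D.
    by move=> *; rewrite normr0.
  by rewrite mul0r normr_le0 !H0 !subr0 subr_eq0 => /eqP.
pose N x := (Num.truncn `|x|).+1.
have NP x : - (N x).+1%:R < x - 1.
  rewrite ltrNl opprB -natr1 addrC ltrD2r.
  apply: le_lt_trans (truncnS_gt _).
  by rewrite -normrN ler_norm.
exists (fun x => H (N x) x); split; first by rewrite /H subrr.
move=> x; have nx : - (N x).+1%:R < x.
  by apply: lt_trans (NP x) _; rewrite ltrBlDr ltrDl.
apply: dv_near (Hd (N x) x nx).
have : \forall s \near x, - (N x).+1%:R < s by exact: lt_nbhsr.
apply: filterS => s ns.
have sn : - (N s).+1%:R < s.
  by apply: lt_trans (NP s) _; rewrite ltrBlDr ltrDl.
have [le|/ltnW le] := leqP (N x) (N s); first exact: HH.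
by apply/esym; exact: HH.
Qed.

Definition primitive f : R -> R :=
  xget (fun=> 0) [set F | F 0 = 0 /\ forall x, is_derive x (1 : R) F (f x)].

Lemma primitiveP f : continuous f ->
  primitive f 0 = 0 /\ forall x, is_derive x (1 : R) (primitive f) (f x).
Proof.
move=> /ex_primitive[F FP]; rewrite /primitive.
by case: xgetP => [G _ //|/(_ F)].
Qed.

Lemma primitive_cont f : continuous f -> continuous (primitive f).
Proof. by move=> /primitiveP[_ fd] x; exact: dv_cont (fd x). Qed.

(* [pprim B E b] is \int^b A(s) B(E - C(s)) ds, differentiable jointly in [E] and [b]. *)

Section ParamPrimitive.
Variables A C : R -> R.
Hypotheses (Ac : continuous A) (Cc : continuous C).

Definition pprim (B : R -> R) a b := primitive (fun s => A s * B (a - C s)) b.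

Lemma pprim_integrand_cont (B : R -> R) a : continuous B ->
  continuous (fun s => A s * B (a - C s)).
Proof.
move=> Bc x; apply: cvgM; first exact: Ac.
apply: (@continuous_comp _ _ _ (fun s => a - C s) B); last exact: Bc.
by apply: cvgB; [exact: cvg_cst|exact: Cc].
Qed.

Lemma cont_bounded f (M : R) : continuous f ->
  exists2 K, 0 < K & forall s, `|s| <= M -> `|f s| <= K.
Proof.
move=> fc; have [M0|M0] := ltP M 0.
  by exists 1 => // s sM; have := le_lt_trans sM M0; rewrite ltNge normr_ge0.
have [||c _ cM] := @EVT_max R (fun s => `|f s|) (- M) M.
- by rewrite ge0_cp.
- apply: continuous_subspaceT => x; apply: cvg_norm; exact: fc.
exists (`|f c| + 1); first by rewrite ltr_wpDl.
move=> s; rewrite ler_norml => sM.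
by apply: le_trans (cM s _) _; rewrite ?in_itv// lerDl.
Qed.

(** Joint continuity gives the bound for [(s, a')] near each [(x, a)]; compactness of [[- M, M]]
    makes the neighbourhood of [a] independent of [s]. *)
Lemma unif_small (B : R -> R) a M e : continuous B -> 0 < e ->
  \forall a' \near a, forall s, `|s| <= M -> `|B (a' - C s) - B (a - C s)| <= e.
Proof.
move=> Bc e0.
have /compact_near_coveringP cK : compact (`[- M, M] : set R).
  exact: segment_compact.
have : \forall a' \near a, `[- M, M] `<=`
    (fun s => `|B (a' - C s) - B (a - C s)| <= e); last first.
  apply: filterS => a' sub s; rewrite ler_norml => sM.
  by apply: sub; rewrite /= in_itv.
apply: (cK R (nbhs a) (fun a' s => `|B (a' - C s) - B (a - C s)| <= e)) => x _.
have c1 : {for (x, a), continuous (fun p : R * R => B (p.2 - C p.1))}.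
  apply: (@continuous_comp _ _ _ (fun p : R * R => p.2 - C p.1) B); last exact: Bc.
  apply: (@cvgB _ _ _ _ _ snd (fun p : R * R => C p.1)); first exact: cvg_snd.
  by apply: (@continuous_comp _ _ _ fst C); [exact: cvg_fst|exact: Cc].
have c2 : {for (x, a), continuous (fun p : R * R => B (a - C p.1))}.
  apply: (@continuous_comp _ _ _ (fun p : R * R => a - C p.1) B); last exact: Bc.
  apply: (@cvgB _ _ _ _ _ (fun=> a) (fun p : R * R => C p.1)); first exact: cvg_cst.
  by apply: (@continuous_comp _ _ _ fst C); [exact: cvg_fst|exact: Cc].
have /cvgrPdist_le/(_ _ e0) : (fun p : R * R => B (p.2 - C p.1) - B (a - C p.1))
    @ (x, a) --> (0 : R).
  rewrite -(subrr (B (a - C x))); exact: (cvgB c1 c2).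
by apply: filterS => -[s a'] /=; rewrite sub0r normrN.
Qed.

(** One estimate for two uses: [q = 0] gives continuity in the parameter, [q = a' - a] with [D] the
    derivative of [B] gives differentiability. The left side vanishes at [b = 0], so the mean value
    theorem in the endpoint suffices. *)
Lemma pprim_diff_bound (B D : R -> R) (a a' q e M K b : R) :
  continuous B -> continuous D -> (forall s, `|s| <= M -> `|A s| <= K) ->
  (forall s, `|s| <= M -> `|B (a' - C s) - B (a - C s) - q * D (a - C s)| <= e) ->
  `|b| <= M ->
  `|pprim B a' b - pprim B a b - q * pprim D a b| <= K * e * M.
Proof.
move=> Bc Dc AK Be bM.
have M0 : 0 <= M := le_trans (normr_ge0 _) bM.
have K0 : 0 <= K by apply: le_trans (normr_ge0 _) (AK 0 _); rewrite normr0.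
have e0 : 0 <= e by apply: le_trans (normr_ge0 _) (Be 0 _); rewrite normr0.
have [P0 P'] := primitiveP (@pprim_integrand_cont B a' Bc).
have [Q0 Q'] := primitiveP (@pprim_integrand_cont B a Bc).
have [S0 S'] := primitiveP (@pprim_integrand_cont D a Dc).
pose G b := pprim B a' b - pprim B a b - q * pprim D a b.
have G0 : G 0 = 0 by rewrite /G /pprim P0 Q0 S0; ring.
have sM s : Num.min 0 b <= s <= Num.max 0 b -> `|s| <= M.
  move=> /andP[h1 h2]; move: bM; rewrite !ler_norml => /andP[b1 b2].
  apply/andP; split.
    by apply: le_trans h1; rewrite le_min b1 andbT oppr_le0.
  by apply: le_trans h2 _; rewrite ge_max b2 andbT.
rewrite -/(G b) -[G b]subr0 -G0.
apply: (@le_trans _ _ (K * e * `|b - 0|)); last first.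
  by rewrite subr0 ler_wpM2l// mulr_ge0.
apply: (@mvt_bound_sym G (fun s => A s *
   (B (a' - C s) - B (a - C s) - q * D (a - C s)))) => s /sM sM'.
  apply: dv_eq (dvB (dvB (P' s) (Q' s)) (dvMl q (S' s))) _; ring.
by rewrite normrM ler_pM ?normr_ge0 ?AK ?Be.
Qed.

Lemma pprim_cont (B : R -> R) (E b : R -> R) t : continuous B ->
  {for t, continuous E} -> {for t, continuous b} ->
  {for t, continuous (fun s => pprim B (E s) (b s))}.
Proof.
move=> Bc Ec bc; pose M := `|b t| + 1.
have M0 : 0 < M by rewrite ltr_wpDl.
have [K K0 AK] := cont_bounded M Ac.
have -> : (fun s => pprim B (E s) (b s)) =
    (fun s => (pprim B (E s) (b s) - pprim B (E t) (b s)) + pprim B (E t) (b s)).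
  by apply/funext => s; rewrite subrK.
rewrite /prop_for /continuous_at subrr.
apply: cvgD; last first.
  apply: (@continuous_comp _ _ _ b (pprim B (E t))); first exact: bc.
  by apply: primitive_cont; exact: pprim_integrand_cont.
apply/cvgrPdist_le => e e0.
pose e' := e / (K * M).
have e'0 : 0 < e' by rewrite divr_gt0// mulr_gt0.
have ev := Ec _ (unif_small (E t) M Bc e'0).
have bM : \forall s \near t, `|b s| <= M.
  have /cvgrPdist_le/(_ 1 ltr01) := bc.
  apply: filterS => s bs; rewrite /M -lerBlDl.
  by apply: le_trans (lerB_dist _ _) _; rewrite distrC.
near=> s; rewrite sub0r normrN.
have : `|pprim B (E s) (b s) - pprim B (E t) (b s) - 0 * pprim (fun=> 0) (E t) (b s)|
    <= K * e' * M.
  apply: pprim_diff_bound => //; [by move=> ?; exact: cvg_cst| |by near: s].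
  by move=> r rM; rewrite mulr0 subr0; move: r rM; near: s.
suff -> : K * e' * M = e by rewrite mul0r subr0.
by rewrite /e'; field; rewrite !gt_eqF.
Unshelve. all: by end_near. Qed.

(** Leibniz rule along a curve. The increment splits into a change of parameter at the moving
    endpoint and a change of endpoint at the fixed parameter [E t]; each part is written with a
    Carathéodory slope. *)
Lemma pprim_derive (B dB : R -> R) (E b : R -> R) (e' b' t : R) :
  (forall x, is_derive x (1 : R) B (dB x)) -> continuous dB ->
  is_derive t (1 : R) E e' -> is_derive t (1 : R) b b' ->
  is_derive t (1 : R) (fun s => pprim B (E s) (b s))
    (pprim dB (E t) (b t) * e' + A (b t) * B (E t - C (b t)) * b').
Proof.
move=> Bd dBc Ed bd.
have Bc : continuous B by move=> x; exact: dv_cont (Bd x).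
pose M := `|b t| + 1.
have M0 : 0 < M by rewrite ltr_wpDl.
have [K K0 AK] := cont_bounded M Ac.
have [_ P'] := primitiveP (@pprim_integrand_cont B (E t) Bc).
apply/is_derive1_caratheodory.
have /is_derive1_caratheodory[hE [hEe hEc hEt]] := Ed.
have /is_derive1_caratheodory[hb [hbe hbc hbt]] := dv_comp (P' (b t)) bd.
(* The curve [E] may return to the value [E t] at nearby times, where the difference quotient has to
   be given its limit value. *)
pose Q a b := if a == E t then pprim dB (E t) b
              else (pprim B a b - pprim B (E t) b) / (a - E t).
exists (fun s => Q (E s) (b s) * hE s + hb s); split.
- move=> s; rewrite mulrDl -mulrA -hEe -hbe /Q.
  have [->|Est] := eqVneq (E s) (E t); first by rewrite subrr mulr0 add0r.
  by rewrite divfK ?subr_eq0// addrA subrK.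
- apply: cvgD; last exact: hbc.
  apply: cvgM; last exact: hEc.
  rewrite {2}/Q eqxx.
  suff H : (fun s => Q (E s) (b s) - pprim dB (E t) (b s)) @ t --> (0 : R).
    have -> : (fun s => Q (E s) (b s)) =
       (fun s => (Q (E s) (b s) - pprim dB (E t) (b s)) + pprim dB (E t) (b s)).
      by apply/funext => s; rewrite subrK.
    rewrite -[X in _ --> X]add0r; apply: cvgD => //.
    apply: (@continuous_comp _ _ _ b (pprim dB (E t))); first exact: dv_cont bd.
    by apply: primitive_cont; exact: pprim_integrand_cont.
  apply/cvgrPdist_le => e e0.
  pose z := e / (K * M).
  have z0 : 0 < z by rewrite divr_gt0// mulr_gt0.
  have /nbhs_ballP[r /= r0 rz] := unif_small (E t) M dBc z0.
  have Eb : \forall s \near t, ball (E t) r (E s).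
    by apply: (dv_cont Ed); exact: nbhsx_ballx.
  have bM : \forall s \near t, `|b s| <= M.
    have /cvgrPdist_le/(_ 1 ltr01) := dv_cont bd.
    apply: filterS => s bs; rewrite /M -lerBlDl.
    by apply: le_trans (lerB_dist _ _) _; rewrite distrC.
  near=> s; rewrite sub0r normrN /Q.
  have [Est|Est] := eqVneq (E s) (E t); first by rewrite subrr normr0 ltW.
  have Es0 : 0 < `|E s - E t| by rewrite normr_gt0 subr_eq0.
  rewrite -(@ler_pM2r _ `|E s - E t|)// -normrM mulrBl divfK ?subr_eq0//.
  rewrite [X in _ - X]mulrC.
  have -> : e * `|E s - E t| = K * (z * `|E s - E t|) * M.
    by rewrite /z; field; rewrite !gt_eqF.
  apply: pprim_diff_bound => //; last by near: s.
  move=> x xM.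
  (* After subtraction of the linear part, the derivative is an oscillation of [dB], which the
     choice of [r] makes at most [z] uniformly in [x]. *)
  have D y : is_derive y (1 : R) (fun u => B (u - C x) - u * dB (E t - C x))
       (dB (y - C x) - dB (E t - C x)).
    apply: dv_eq (dvB (dv_comp (Bd _) (dvB (dv_id y) (dv_cst (C x) y)))
      (dvMr (dB (E t - C x)) (dv_id y))) _; ring.
  set q := dB (E t - C x) in D *.
  have -> : B (E s - C x) - B (E t - C x) - (E s - E t) * q =
     (B (E s - C x) - E s * q) - (B (E t - C x) - E t * q) by ring.
  apply: (mvt_bound_sym (f := fun u => B (u - C x) - u * q) (fun y _ => D y)).
  move=> y yE; apply: rz xM; rewrite -ball_normE /ball_/=.
  have : ball (E t) r (E s) by near: s.
  rewrite -ball_normE /ball_/=.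
  apply: le_lt_trans.
  move: yE; rewrite /Num.min /Num.max.
  case: ifPn => h /andP[h1 h2].
    by rewrite !ler0_norm ?subr_le0 ?(ltW h)//; lra.
  rewrite -leNgt in h.
  by rewrite !ger0_norm ?subr_ge0//; lra.
- by rewrite /Q eqxx hEt hbt -mulrA; congr (_ + _).
Unshelve. all: by end_near. Qed.

End ParamPrimitive.
End Calculus.

(** * Global C^1 extensions and an improper fundamental theorem of calculus *)

Section Extension.
Context {R : realType}.
Implicit Types (f df : R -> R) (a b c d x : R).

Definition c1 f df := (forall x, is_derive x (1 : R) f (df x)) /\ continuous df.

Definition clamp c d x : R := Num.max c (Num.min d x).

Lemma clamp_id c d x : c <= x <= d -> clamp c d x = x.
Proof. by move=> /andP[cx xd]; rewrite /clamp min_r// max_r. Qed.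

Lemma clamp_itv c d x : c <= d -> c <= clamp c d x <= d.
Proof. by move=> cd; rewrite /clamp le_max lexx ge_max cd ge_min lexx. Qed.

Lemma clamp_cont c d : continuous (clamp c d).
Proof.
by move=> x; apply: continuous_max; [exact: cvg_cst|
  apply: continuous_min; [exact: cvg_cst|exact: cvg_id]].
Qed.

(** The derivative is frozen at its end values outside [[c, d]] and integrated; the result and [f]
    agree at [c] and have the same derivative on [[c, d]]. *)
Lemma c1_extension f df c d : c <= d ->
  (forall x, c <= x <= d -> is_derive x (1 : R) f (df x)) ->
  (forall x, c <= x <= d -> {for x, continuous df}) ->
  exists (F dF : R -> R), c1 F dF /\
    forall x, c <= x <= d -> F x = f x /\ dF x = df x.
Proof.
move=> cd fd dfc.
pose g x := df (clamp c d x).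
have gc : continuous g.
  move=> x; apply: (@continuous_comp _ _ _ (clamp c d) df); first exact: clamp_cont.
  by apply: dfc; exact: clamp_itv.
have [_ gP] := primitiveP gc.
pose F x := primitive g x - primitive g c + f c.
have Fd x : is_derive x (1 : R) F (g x).
  by apply: dv_eq (dvD (dvB (gP x) (dv_cst _ _)) (dv_cst _ _)) _; rewrite subr0 addr0.
exists F, g; split => // x xcd; split; last by rewrite /g clamp_id.
have Fc : F c = f c by rewrite /F subrr add0r.
move: xcd => /andP[cx xd].
have D y : c <= y <= x -> is_derive y (1 : R) (fun y => F y - f y) 0.
  move=> /andP[cy yx]; have yd : c <= y <= d by rewrite cy (le_trans yx).
  by apply: dv_eq (dvB (Fd y) (fd y yd)) _; rewrite /g clamp_id// subrr.
have : F x - f x = F c - f c.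
  apply: (@dv0_eq _ (fun y => F y - f y)) => //; last exact: dv_within D.
  by move=> y /andP[/ltW cy /ltW yx]; apply: D; rewrite cy yx.
by rewrite Fc subrr => /eqP; rewrite subr_eq0 => /eqP.
Qed.

(** The integrand of a period is singular at the turning points. The usual theorem is applied on the
    increasing intervals [[a + e n, b - e n]]; monotone convergence handles the integrals and
    continuity of [F] up to the ends handles the boundary values. *)
Lemma ge0_improper_FTC2 f F a b : a < b ->
  (forall x, 0 <= f x) ->
  (forall x, a < x < b -> {for x, continuous f}) ->
  {within `[a, b], continuous F} ->
  (forall x, a < x < b -> is_derive x (1 : R) F (f x)) ->
  \int[lebesgue_measure]_(x in `[a, b]) f x = F b - F a.
Proof.
move=> ab f0 fc Fc Fd.
have mf : measurable_fun `]a, b[ f.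
  apply: open_continuous_measurable_fun => //.
  by move=> x; rewrite inE/= in_itv/=; exact: fc.
rewrite /Rintegral (@integral_itv_bndoo _ a b); last exact/measurable_EFinP.
suff -> : (\int[lebesgue_measure]_(x in `]a, b[) (f x)%:E)%E = (F b - F a)%:E by [].
pose h := (b - a) / 2.
have h0 : 0 < h by rewrite divr_gt0// subr_gt0.
pose e n := h / n.+2%:R.
have e0 n : 0 < e n by rewrite divr_gt0.
have eh n : e n < h by rewrite ltr_pdivrMr// ltr_pMr// ltr1n.
have enn n m : (n <= m)%N -> e m <= e n.
  by move=> nm; rewrite ler_pM2l// lef_pV2 ?posrE// ler_nat.
have ecv : e @ \oo --> (0 : R).
  rewrite -(mulr0 h); apply: cvgM; first exact: cvg_cst.
  by have := @cvg_harmonic R; rewrite -cvg_shiftS.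
pose S n := `[a + e n, b - e n]%classic.
have hab : a + h = b - h by rewrite /h; field.
have Sab n x : S n x -> a < x < b.
  rewrite /S /= in_itv/= => /andP[h1 h2].
  by have := e0 n; move: h1 h2; lra.
have mS n : measurable_fun (S n) f.
  apply: measurable_funS mf => // x /Sab; by rewrite /= in_itv.
have nS : nondecreasing_seq S.
  move=> n m nm; apply/subsetPset => x; rewrite /S /= !in_itv/= => /andP[h1 h2].
  by have := enn _ _ nm; lra.
have -> : `]a, b[%classic = \bigcup_i S i.
  apply/seteqP; split => x; last by move=> [n _ /Sab]; rewrite /= in_itv.
  rewrite /= in_itv/= => /andP[ax xb].
  have /cvgrPdist_lt/(_ (Num.min (x - a) (b - x))) := ecv.
  rewrite lt_min !subr_gt0 ax xb => /(_ isT) [n _ /(_ n (leqnn n))].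
  rewrite /= sub0r normrN gtr0_norm// lt_min => /andP[h1 h2].
  by exists n => //; rewrite /S /= in_itv/=; lra.
have cv1 : (\int[lebesgue_measure]_(x in S i) (f x)%:E)%E @[i --> \oo] -->
     (\int[lebesgue_measure]_(x in \bigcup_i S i) (f x)%:E)%E.
  apply: ge0_nondecreasing_set_cvg_integral => //.
  - by move=> i; exact: measurable_itv.
  - by move=> i; apply/measurable_EFinP; exact: mS.
  - by move=> i x _; rewrite lee_fin.
have E n : (\int[lebesgue_measure]_(x in S n) (f x)%:E)%E = (F (b - e n) - F (a + e n))%:E.
  have aeb : a + e n < b - e n by have := eh n; move: hab; lra.
  have D x : x \in `[a + e n, b - e n] -> a < x < b.
    by move=> xS; apply: (Sab n).
  rewrite EFinB; apply: continuous_FTC2 => //.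
  - apply: continuous_in_subspaceT => x; rewrite inE => /D; exact: fc.
  - split.
    + by move=> x xS; have [|//] := Fd x _; apply: D; exact: subset_itv_oo_cc.
    + apply: cvg_at_right_filter; apply: (dv_cont (Fd _ _)); apply: D.
      by rewrite in_itv/= lexx ltW.
    + apply: cvg_at_left_filter; apply: (dv_cont (Fd _ _)); apply: D.
      by rewrite in_itv/= lexx ltW.
  - move=> x xS; rewrite derive1E; have [|_ //] := Fd x _.
    by apply: D; exact: subset_itv_oo_cc.
have cv2 : (F (b - e n) - F (a + e n))%:E @[n --> \oo] --> (F b - F a)%:E.
  apply: cvg_EFin; first exact: nearW.
  have /(continuous_within_itvP _ ab)[_ Fa Fb] := Fc.
  apply: cvgB.
  - move/cvg_at_leftP: Fb; apply; split; first by move=> n; rewrite ltrBlDr ltrDl.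
    by rewrite -[X in _ --> X]subr0; apply: cvgB => //; exact: cvg_cst.
  - move/cvg_at_rightP: Fa; apply; split; first by move=> n; rewrite ltrDl.
    by rewrite -[X in _ --> X]addr0; apply: cvgD => //; exact: cvg_cst.
have /funext EE := E.
move: cv1; rewrite EE => cv1.
exact: cvg_unique cv1 cv2.
Qed.
End Extension.

(** * The potential and the phase time of a wall passage *)

Section Kappa.
Context {R : realType}.
Variable k : R -> R.
Hypothesis hk : kappa_hyp k.

Lemma kappa_derive x : is_derive x (1 : R) k ((derive1 k) x).
Proof. by have [+ _] := hk => /(_ x)/derivableP; rewrite derive1E. Qed.

Lemma kappa_derive2 x : is_derive x (1 : R) (derive1 k) ((derive1 (derive1 k)) x).
Proof. by have [_ [+ _]] := hk => /(_ x)/derivableP; rewrite derive1E. Qed.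

Lemma kappa2_cont : continuous (derive1 (derive1 k)).
Proof. by have [_ [_ [+ _]]] := hk. Qed.

Lemma kappa_cont : continuous k.
Proof. by move=> x; exact: dv_cont (kappa_derive x). Qed.

Lemma kappa1_cont : continuous (derive1 k).
Proof. by move=> x; exact: dv_cont (kappa_derive2 x). Qed.

Lemma kappa_ge1 x : 1 <= x -> k x = 0.
Proof. by have [_ [_ [_ [+ _]]]] := hk; apply. Qed.

Lemma kappa1_lt0 x : x < 1 -> (derive1 k) x < 0.
Proof. by have [_ [_ [_ [_ +]]]] := hk; apply. Qed.

Lemma kappa1_gt1 x : 1 < x -> (derive1 k) x = 0.
Proof.
move=> x1; have kx := kappa_derive x.
have : is_derive x (1 : R) k 0.
  apply: dv_near (dv_cst 0 x).
  have : \forall s \near x, 1 < s by exact: lt_nbhsr.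
  by apply: filterS => s s1; rewrite kappa_ge1// ltW.
by case: kx => _ <- -[_ <-].
Qed.

(** At the point 1 itself the value follows from continuity of the derivative from the right. *)
Lemma kappa1_ge1 x : 1 <= x -> (derive1 k) x = 0.
Proof.
rewrite le_eqVlt => /predU1P[<-|]; last exact: kappa1_gt1.
have c : (derive1 k) @ 1^'+ --> (derive1 k) 1 by apply: cvg_at_right_filter; exact: kappa1_cont.
apply/esym; apply: (@cvg_unique _ _ ((derive1 k) @ 1^'+)) => //.
apply: cvg_near_cst; near=> y; apply: kappa1_gt1.
by near: y; exact: nbhs_right_gt.
Unshelve. all: by end_near. Qed.

Lemma kappa1_le0 x : (derive1 k) x <= 0.
Proof. by have [/kappa1_ge1->//|/kappa1_lt0/ltW] := leP 1 x. Qed.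

Lemma kappa_decr x y : x < y -> y <= 1 -> k y < k x.
Proof.
move=> xy y1.
have [c + e] : exists2 c, c \in `]x, y[ & k y - k x = (derive1 k) c * (y - x).
  apply: MVT => //; first by move=> z _; exact: kappa_derive.
  exact/continuous_subspaceT/kappa_cont.
rewrite in_itv/= => /andP[_ cy].
by rewrite -subr_lt0 e nmulr_rlt0 ?kappa1_lt0 ?(lt_le_trans cy)// subr_gt0.
Qed.

Lemma kappa_nincr x y : x <= y -> k y <= k x.
Proof.
rewrite le_eqVlt => /predU1P[->//|xy].
have [y1|/ltW y1] := leP y 1; first exact/ltW/kappa_decr.
rewrite (kappa_ge1 y1); have [/kappa_ge1->//|x1] := leP 1 x.
by rewrite -(@kappa_ge1 1)// ltW// kappa_decr.
Qed.

Lemma kappa_ge0 x : 0 <= k x.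
Proof.
have [/kappa_ge1->//|/ltW x1] := leP 1 x.
by rewrite -(@kappa_ge1 1)// kappa_nincr.
Qed.

Lemma kappa_lt x y : k x < k y -> y < x.
Proof. by apply: contraTT; rewrite -!leNgt; exact: kappa_nincr. Qed.

Lemma kappa_inj x y : x <= 1 -> y <= 1 -> k x = k y -> x = y.
Proof.
move=> x1 y1 kxy; have [xy|xy|//] := ltgtP x y.
  by have := kappa_decr xy y1; rewrite kxy ltxx.
by have := kappa_decr xy x1; rewrite kxy ltxx.
Qed.

Lemma kinvP e : 0 <= e <= k 0 -> 0 <= kinv k e <= 1 /\ k (kinv k e) = e.
Proof.
move=> /andP[e0 ek]; rewrite /kinv; case: xgetP => [x _ //|H]; exfalso.
have [x + kx] : exists2 c, c \in `[0, 1] & k c = e.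
  apply: IVT => //; first exact/continuous_subspaceT/kappa_cont.
  by rewrite (@kappa_ge1 1)// min_r ?max_l ?kappa_ge0// e0.
by rewrite in_itv/= => x01; apply: (H x).
Qed.

Lemma kinvK u : 0 <= u <= 1 -> kinv k (k u) = u.
Proof.
move=> /andP[u0 u1]; have [|/andP[_ h1] h2] := @kinvP (k u).
  by rewrite kappa_ge0 kappa_nincr.
exact: kappa_inj.
Qed.

Lemma kinv_lt e : 0 < e < k 0 -> 0 < kinv k e < 1.
Proof.
move=> /andP[e0 ek]; have [|/andP[u0 u1] ke] := @kinvP e.
  by rewrite !ltW.
rewrite !lt_neqAle u0 u1 !andbT; apply/andP; split; apply/eqP => u.
  by move: ek; rewrite -ke -u ltxx.
by move: e0; rewrite -ke u (@kappa_ge1 1)// ltxx.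
Qed.

Lemma kinv_derive e : 0 < e < k 0 ->
  is_derive e (1 : R) (kinv k) ((derive1 k) (kinv k e))^-1.
Proof.
move=> he; have [|_ ke] := @kinvP e; first by case/andP: he => *; rewrite !ltW.
have /andP[u0 u1] := kinv_lt he.
rewrite -{1}ke; apply: is_derive_inverse; last first.
- by rewrite lt_eqF// kappa1_lt0.
- exact: kappa_derive.
- by near=> z; exact: kappa_cont.
- near=> z; apply: kinvK; apply/andP; split; apply: ltW.
    by near: z; exact: lt_nbhsr.
  by near: z; exact: lt_nbhsl.
Unshelve. all: by end_near. Qed.

End Kappa.

Section WallPhase.
Context {R : realType}.

Lemma dvV (f : R -> R) x a : f x != 0 -> is_derive x (1 : R) f a ->
  is_derive x (1 : R) (fun s => (f s)^-1) (- a / f x ^+ 2).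
Proof.
move=> f0 fa; apply: dv_eq (is_deriveV f0 fa) _.
by rewrite /GRing.scale/= mulNr mulrC mulNr.
Qed.

Lemma dvX2 (f : R -> R) x a : is_derive x (1 : R) f a ->
  is_derive x (1 : R) (fun s => f s ^+ 2) (2 * f x * a).
Proof.
move=> fa; have -> : (fun s => f s ^+ 2) = (fun s => f s * f s).
  by apply/funext => s; rewrite expr2.
by apply: dv_eq (dvM fa fa) _; ring.
Qed.

Lemma pprim0 (A C B : R -> R) a : continuous A -> continuous C -> continuous B ->
  pprim A C B a 0 = 0.
Proof. by move=> Ac Cc Bc; have [] := primitiveP (@pprim_integrand_cont _ _ _ Ac Cc B a Bc). Qed.

Lemma pprim_derive_end (A C B : R -> R) a b : continuous A -> continuous C -> continuous B ->
  is_derive b (1 : R) (pprim A C B a) (A b * B (a - C b)).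
Proof. by move=> Ac Cc Bc; have [] := primitiveP (@pprim_integrand_cont _ _ _ Ac Cc B a Bc). Qed.

Lemma pprim_le (A C B : R -> R) a b0 b K : continuous A -> continuous C -> continuous B ->
  (forall s, Num.min b0 b <= s <= Num.max b0 b -> `|A s * B (a - C s)| <= K) ->
  `|pprim A C B a b - pprim A C B a b0| <= K * `|b - b0|.
Proof.
move=> Ac Cc Bc H; apply: mvt_bound_sym H => s _.
exact: pprim_derive_end.
Qed.

(* Rescaled passage of the potential [k] at energy [E], position [u] and momentum [p]
   ([E = p^2 + k u]): [Sn E u p] is the signed phase time since the turning
   point and [g E] the time needed to reach the end [u = 1] of the potential.
   In [wp_derive], [b] and [c] are the derivatives in [u] and [p], so the last
   identity says that [Sn] grows at unit speed along the motion. *)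
Record wall_phase (k : R -> R) (El Eh : R) (sq dsq g dg : R -> R)
    (Sn : R -> R -> R -> R) (C : R) : Prop := WallPhase {
  wp_C : 0 < C;
  wp_sq : c1 sq dsq;
  wp_sqE : forall E, El <= E <= Eh -> sq E = Num.sqrt E;
  wp_g : c1 g dg;
  wp_out : forall E u p, El <= E <= Eh -> 1 <= u -> E = p ^+ 2 ->
    Sn E u p = Num.sg p * (g E + (u - 1) / Num.sqrt E);
  wp_bound : forall E u p, El <= E <= Eh -> E = p ^+ 2 + k u ->
    `|Sn E u p| <= C * (1 + `|u|);
  wp_turn : forall E u p, El <= E <= Eh -> E = p ^+ 2 + k u -> El / 2 <= k u ->
    `|Sn E u p| <= C * `|p|;
  wp_derive : forall (t : R) (E u p : R -> R) (E' u' p' : R),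
    is_derive t (1 : R) E E' -> is_derive t (1 : R) u u' -> is_derive t (1 : R) p p' ->
    (\forall s \near t, E s = p s ^+ 2 + k (u s)) -> El <= E t <= Eh ->
    exists a b c, [/\ is_derive t (1 : R) (fun s => Sn (E s) (u s) (p s))
                        (a * E' + b * u' + c * p'),
      `|a| <= C * (1 + `|u t|), `|b| <= C, `|c| <= C &
      b * p t - c * (derive1 k (u t) / 2) = 1] }.

Variable k : R -> R.
Hypothesis hk : kappa_hyp k.
Variables El Eh : R.
Hypotheses (El0 : 0 < El) (ElEh : El <= Eh) (Ehk : Eh < k 0).

(* The extensions to the whole line below serve to make every later function
   globally C^1, so that no domain has to be tracked when differentiating. *)
Lemma inv_slope_extension : exists N dN : R -> R, c1 N dN /\
  forall u, u <= 1 -> El / 2 <= k u <= (Eh + k 0) / 2 -> N (k u) = - (derive1 k u)^-1.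
Proof.
(* Both ends lie strictly between 0 and [k 0], so [kinv] takes values in [(0, 1)], where the slope
   does not vanish. The margins below [El] and above [Eh] leave room around every turning point. *)
pose c := El / 2; pose d := (Eh + k 0) / 2.
have c0 : 0 < c by rewrite /c divr_gt0.
have cE : c < El by rewrite /c; move: El0; lra.
have dk : d < k 0 by rewrite /d; move: Ehk; lra.
have Ed : Eh < d by rewrite /d; move: Ehk; lra.
have he e : c <= e <= d -> 0 < e < k 0 by move=> /andP[? ?]; apply/andP; split; lra.
pose phi e := - (derive1 k (kinv k e))^-1.
pose dphi e := derive1 (derive1 k) (kinv k e) / derive1 k (kinv k e) ^+ 3.
have kn0 e : c <= e <= d -> derive1 k (kinv k e) != 0.
  by move=> /he/(kinv_lt hk)/andP[_ /(kappa1_lt0 hk)]; rewrite lt_neqAle => /andP[].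
have [|||N [dN [HN NE]]] := @c1_extension R phi dphi c d.
- by rewrite ltW// (lt_trans cE)// (le_lt_trans ElEh).
- move=> e ce; have D := @dv_comp _ (derive1 k) (kinv k) e _ _ (kappa_derive2 hk _)
    (kinv_derive hk (he _ ce)).
  apply: dv_eq (dvN (@dvV (fun s => derive1 k (kinv k s)) _ _ (kn0 _ ce) D)) _.
  by rewrite /dphi; field; exact: kn0.
- move=> e ce; have kc := dv_cont (kinv_derive hk (he _ ce)).
  apply: cvgM.
    apply: (@continuous_comp _ _ _ (kinv k) (derive1 (derive1 k))) => //.
    exact: kappa2_cont.
  apply: cvgV; first by rewrite expf_neq0// kn0.
  apply: (@continuous_comp _ _ _ (kinv k) (fun x => derive1 k x ^+ 3)) => //.
  apply: (@continuous_comp _ _ _ (derive1 k) (fun x => x ^+ 3)); first exact: kappa1_cont.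
  exact: exprn_continuous.
exists N, dN; split => // u u1 ku.
(* At negative positions the potential exceeds [k 0 > d]. *)
have u0 : 0 <= u.
  rewrite leNgt; apply/negP => u0; have := kappa_decr hk u0 ler01.
  by move: ku dk; rewrite -/d => /andP[_]; lra.
by rewrite (NE _ _).1 // /phi kinvK// u0.
Qed.

Lemma inv_sqrt_extension : exists rho drho : R -> R, c1 rho drho /\
  forall y, El / 2 <= y <= Eh -> rho y = (Num.sqrt y)^-1.
Proof.
have E2 : 0 < El / 2 by rewrite divr_gt0.
have [|||r [dr [Hr rE]]] := @c1_extension R (fun y => (Num.sqrt y)^-1)
    (fun y => - (2 * Num.sqrt y)^-1 / Num.sqrt y ^+ 2) (El / 2) Eh.
- by move: El0 ElEh; lra.
- move=> y /andP[y0 _]; have {}y0 : 0 < y by apply: lt_le_trans y0.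
  apply: dvV; first by rewrite gt_eqF// sqrtr_gt0.
  exact: is_derive1_sqrt.
- move=> y /andP[y0 _]; have {}y0 : 0 < y by apply: lt_le_trans y0.
  have s0 : Num.sqrt y != 0 by rewrite gt_eqF// sqrtr_gt0.
  apply: cvgM.
    apply: cvgN; apply: cvgV; first by rewrite mulf_neq0.
    by apply: cvgM; [exact: cvg_cst|exact: sqrt_continuous].
  apply: cvgV; first by rewrite expf_neq0.
  apply: (@continuous_comp _ _ _ Num.sqrt (fun x => x ^+ 2)); first exact: sqrt_continuous.
  exact: exprn_continuous.
by exists r, dr; split => // y /rE[].
Qed.

Lemma sqrt_extension : exists sq dsq : R -> R, c1 sq dsq /\
  forall y, El <= y <= Eh -> sq y = Num.sqrt y.
Proof.
have [|||r [dr [Hr rE]]] := @c1_extension R Num.sqrt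
    (fun y => (2 * Num.sqrt y)^-1) El Eh.
- exact: ElEh.
- by move=> y /andP[y0 _]; apply: is_derive1_sqrt; apply: lt_le_trans y0.
- move=> y /andP[y0 _]; have {}y0 : 0 < y by apply: lt_le_trans y0.
  have s0 : Num.sqrt y != 0 by rewrite gt_eqF// sqrtr_gt0.
  apply: cvgV; first by rewrite mulf_neq0.
  by apply: cvgM; [exact: cvg_cst|exact: sqrt_continuous].
by exists r, dr; split => // y /rE[].
Qed.

End WallPhase.

Section NearBounds.
Context {R : realType}.

Lemma near_gt (f : R -> R) t c : {for t, continuous f} -> c < f t ->
  \forall s \near t, c < f s.
Proof. by move=> fc cf; apply: (fc [set y | c < y]); exact: lt_nbhsr. Qed.

Lemma near_lt (f : R -> R) t c : {for t, continuous f} -> f t < c ->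
  \forall s \near t, f s < c.
Proof. by move=> fc cf; apply: (fc [set y | y < c]); exact: lt_nbhsl. Qed.

End NearBounds.

Section WallPhaseExists.
Context {R : realType}.
Variable k : R -> R.
Hypothesis hk : kappa_hyp k.
Variables El Eh : R.
Hypotheses (El0 : 0 < El) (ElEh : El <= Eh) (Ehk : Eh < k 0).
Variables (N dN rho drho sq dsq : R -> R).
Hypotheses (HN : c1 N dN) (NE : forall u, u <= 1 ->
  El / 2 <= k u <= (Eh + k 0) / 2 -> N (k u) = - (derive1 k u)^-1).
Hypotheses (Hrho : c1 rho drho)
  (rhoE : forall y, El / 2 <= y <= Eh -> rho y = (Num.sqrt y)^-1).
Hypotheses (Hsq : c1 sq dsq) (sqE : forall y, El <= y <= Eh -> sq y = Num.sqrt y).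

Let u1 := kinv k (El / 2).
Let u3 := kinv k ((Eh + k 0) / 2).
(* As [N (k s) = - 1 / k' s] near the turning point, [r1] vanishes there: the
   substitution [k s = E - q^2] turns the part of [\int ds / sqrt (E - k s)] with
   weight [- k' s * N (k s)] into the [I] term, and [r1] is the rest. *)
Let r1 s := 1 + derive1 k s * N (k s).
Let sqr (s : R) := s ^+ 2.
Let one (s : R) := 1 : R.

Let I E p := pprim one sqr N E p.
Let dI E p := pprim one sqr dN E p.
Let J E u := pprim r1 k rho E u - pprim r1 k rho E u1.
Let dJ E u := pprim r1 k drho E u - pprim r1 k drho E u1.

(** Odd in [p]: negative on the way in, positive on the way out. The jump of the sign at [p = 0] is
    harmless because [J] vanishes identically around the turning point. [delay_fun] is the value at
    [u = 1] with [p] the square root of [E], the moment of leaving the potential. *)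
Definition phase_fun E u p := 2 * I E p + Num.sg p * J E u.
Definition delay_fun E := J E 1 + 2 * I E (sq E).
Definition delay_der E :=
  dJ E 1 + 2 * (dI E (sq E) + N (E - sq E ^+ 2) * dsq E).

Let Nc : continuous N. Proof. by move=> x; exact: dv_cont (HN.1 x). Qed.
Let rhoc : continuous rho. Proof. by move=> x; exact: dv_cont (Hrho.1 x). Qed.
Let sqc : continuous sq. Proof. by move=> x; exact: dv_cont (Hsq.1 x). Qed.
Let sqrc : continuous sqr. Proof. exact: exprn_continuous. Qed.
Let onec : continuous one. Proof. by move=> x; exact: cvg_cst. Qed.
Let kc : continuous k. Proof. exact: kappa_cont. Qed.
Let dNc : continuous dN := HN.2.
Let drhoc : continuous drho := Hrho.2.
Let r1c : continuous r1.
Proof.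
move=> x; apply: cvgD; first exact: cvg_cst.
apply: cvgM; first exact: kappa1_cont.
by apply: (@continuous_comp _ _ _ k N); [exact: kc|exact: Nc].
Qed.

Let he0 : 0 < El / 2 < k 0. Proof. by move: El0 ElEh Ehk => *; apply/andP; split; lra. Qed.
Let he3 : 0 < (Eh + k 0) / 2 < k 0. Proof. by move: El0 ElEh Ehk => *; apply/andP; split; lra. Qed.
Let k0 : 0 < k 0. Proof. by case/andP: he0; exact: lt_trans. Qed.
Let u1_01 : 0 < u1 < 1. Proof. exact: kinv_lt. Qed.
Let u3_01 : 0 < u3 < 1. Proof. exact: kinv_lt. Qed.
Let ku1 : k u1 = El / 2.
Proof. by have [|_] := @kinvP _ _ hk (El / 2); [case/andP: he0 => *; rewrite !ltW|]. Qed.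
Let ku3 : k u3 = (Eh + k 0) / 2.
Proof. by have [|_] := @kinvP _ _ hk ((Eh + k 0) / 2); [case/andP: he3 => *; rewrite !ltW|]. Qed.

Let r1_0 s : u3 <= s <= u1 -> r1 s = 0.
Proof.
move=> /andP[us su]; have s1 : s < 1 by case/andP: u1_01 => _; exact: le_lt_trans.
rewrite /r1 NE; first by rewrite mulrN divff ?subrr// lt_eqF// kappa1_lt0.
  exact: ltW.
by rewrite -ku1 -ku3 !kappa_nincr.
Qed.

Let r1_1 s : 1 <= s -> r1 s = 1.
Proof. by move=> s1; rewrite /r1 kappa1_ge1// mul0r addr0. Qed.

Let JE0 E u : u3 <= u <= u1 -> J E u = 0.
Proof.
move=> /andP[u3u uu1]; apply/eqP; rewrite -normr_le0 /J.
rewrite -(mul0r (`|u - u1|)); apply: pprim_le => // s.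
rewrite (max_l uu1) (min_r uu1) => /andP[us su].
by rewrite r1_0 ?mul0r ?normr0// (le_trans u3u us).
Qed.

Let u3_lt E u p : El <= E <= Eh -> E = p ^+ 2 + k u -> u3 < u.
Proof.
move=> /andP[_ EEh] Ee; apply: (kappa_lt hk); rewrite ku3.
by have := sqr_ge0 p; move: EEh Ee Ehk; lra.
Qed.

Let r1_bound : exists2 K, 0 < K & forall s, 0 <= s -> `|r1 s| <= K.
Proof.
have [K K0 KP] := cont_bounded 1 r1c.
exists (K + 1); first by rewrite addr_gt0.
move=> s s0; have [s1|s1] := leP s 1.
  by apply: le_trans (KP _ _) _; rewrite ?ger0_norm// lerDl.
by rewrite r1_1 ?normr1 ?lerDr ltW.
Qed.

Let pE E u p : El <= E <= Eh -> E = p ^+ 2 + k u -> `|p| <= 1 + Eh.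
Proof.
move=> /andP[_ EEh] Ee.
have p2 : p ^+ 2 <= Eh by have := kappa_ge0 hk u; move: EEh Ee; lra.
rewrite -(@ler_pXn2r _ 2%N) ?nnegrE//; last by move: El0 ElEh; lra.
rewrite real_normK ?num_real// (le_trans p2)//.
by move: El0 ElEh; nra.
Qed.

Let IB : exists2 K, 0 < K & forall E u p, El <= E <= Eh -> E = p ^+ 2 + k u ->
  `|I E p| <= K * `|p| /\ `|dI E p| <= K.
Proof.
pose M := 1 + Eh.
have M0 : 0 < M by rewrite /M; move: El0 ElEh; lra.
have [K1 K10 K1P] := cont_bounded (M + M ^+ 2) Nc.
have [K2 K20 K2P] := cont_bounded (M + M ^+ 2) dNc.
exists (K1 + K2 * M); first by rewrite addr_gt0// mulr_gt0.
move=> E u p EE Ee; have pM := pE EE Ee.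
have B s : Num.min 0 p <= s <= Num.max 0 p -> `|E - sqr s| <= M + M ^+ 2.
  move=> /andP[h1 h2]; have sM : `|s| <= M.
    move: pM; rewrite !ler_norml -/M => /andP[p1 p2].
    apply/andP; split.
      by apply: le_trans h1; rewrite le_min p1 oppr_le0 ltW.
    by apply: le_trans h2 _; rewrite ge_max p2 ltW.
  have s2 : 0 <= s ^+ 2 <= M ^+ 2.
    by rewrite sqr_ge0/= -real_normK ?num_real// lerXn2r// nnegrE ltW.
  move: EE s2 => /andP[E1 E2] /andP[s21 s22].
  by rewrite ler_norml /sqr /M; apply/andP; split; move: E1 E2 s21 s22 El0; rewrite /M; lra.
have I0 : I E 0 = 0 by exact: pprim0.
have dI0 : dI E 0 = 0 by exact: pprim0.
split.
  rewrite -[I E p]subr0 -I0.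
  apply: le_trans (pprim_le (K := K1) _ _ _ _) _ => //.
    by move=> s sp; rewrite mul1r K1P// B.
  by rewrite subr0 ler_wpM2r// lerDl mulr_ge0 ?ltW.
rewrite -[dI E p]subr0 -dI0.
apply: le_trans (pprim_le (K := K2) _ _ _ _) _ => //.
  by move=> s sp; rewrite mul1r K2P// B.
by rewrite subr0 (@le_trans _ _ (K2 * M))// ?ler_wpM2l ?lerDr// ltW.
Qed.

Let JB : exists2 K, 0 < K & forall E u, El <= E <= Eh -> u3 < u ->
  [/\ `|J E u| <= K * (1 + `|u|), `|dJ E u| <= K * (1 + `|u|) &
      `|r1 u * rho (E - k u)| <= K].
Proof.
have [Kr Kr0 KrP] := r1_bound.
pose M := Eh + k 0.
have M0 : 0 < M by rewrite /M; move: El0 ElEh k0; lra.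
have [K1 K10 K1P] := cont_bounded M rhoc.
have [K2 K20 K2P] := cont_bounded M drhoc.
pose K := Kr * (K1 + K2).
have K0 : 0 < K by rewrite mulr_gt0// addr_gt0.
exists K => // E u EE u3u.
have B s : 0 <= s -> `|E - k s| <= M.
  move=> s0; have := kappa_ge0 hk s; have := kappa_nincr hk s0.
  move: EE => /andP[E1 E2]; rewrite ler_norml /M => h1 h2.
  by apply/andP; split; move: El0 k0; lra.
have [u30 u31] : 0 < u3 /\ u3 < 1 by apply/andP.
have [u10 u11] : 0 < u1 /\ u1 < 1 by apply/andP.
have uu : `|u - u1| <= 1 + `|u|.
  apply: le_trans (ler_normB _ _) _; rewrite addrC lerD2r gtr0_norm//.
  exact: ltW.
have smin s : Num.min u1 u <= s <= Num.max u1 u -> 0 <= s.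
  move=> /andP[+ _]; apply: le_trans; rewrite le_min !ltW//.
  exact: lt_trans u3u.
split.
- apply: le_trans (pprim_le (K := K) _ _ _ _) _ => //.
    move=> s /smin s0; rewrite normrM ler_pM ?KrP//.
    by rewrite (le_trans (K1P _ (B _ s0)))// lerDl ltW.
  by rewrite ler_wpM2l// ltW.
- apply: le_trans (pprim_le (K := K) _ _ _ _) _ => //.
    move=> s /smin s0; rewrite normrM ler_pM ?KrP//.
    by rewrite (le_trans (K2P _ (B _ s0)))// lerDr ltW.
  by rewrite ler_wpM2l// ltW.
- have s0 : 0 <= u by rewrite ltW// (lt_trans u30).
  by rewrite normrM ler_pM ?KrP// (le_trans (K1P _ (B _ s0)))// lerDl ltW.
Qed.

(** The integrand depends on the momentum through its square only. *)
Let I_odd E p : I E (- p) = - I E p.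
Proof.
have D x : is_derive x (1 : R) (fun x => I E (- x) + I E x) 0.
  have d := pprim_derive_end E (- x) onec sqrc Nc.
  have d' := pprim_derive_end E x onec sqrc Nc.
  apply: dv_eq (dvD (dv_comp d (dvN (dv_id x))) d') _.
  by rewrite /one /sqr sqrrN; ring.
have := is_derive_0_is_cst p 0 D; rewrite oppr0 /I !pprim0// addr0.
by move/eqP; rewrite addr_eq0 => /eqP.
Qed.

Let J_out E u : El <= E <= Eh -> 1 <= u -> J E u = J E 1 + (u - 1) / Num.sqrt E.
Proof.
move=> EE ul.
pose G x := J E x - x / Num.sqrt E.
have D x : 1 <= x <= u -> is_derive x (1 : R) G 0.
  move=> /andP[x1 _]; have d := pprim_derive_end E x r1c kc rhoc.
  apply: dv_eq (dvB (dvB d (dv_cst _ x)) (dvMr (Num.sqrt E)^-1 (dv_id x))) _.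
  rewrite r1_1// (kappa_ge1 hk x1) !subr0 !mul1r rhoE ?subrr//.
  by move: EE => /andP[? ?]; apply/andP; split; move: El0; lra.
have : G u = G 1.
  apply: (@dv0_eq _ G) => //; last exact: dv_within D.
  by move=> x /andP[/ltW x1 /ltW xu]; apply: D; rewrite x1 xu.
rewrite /G => /eqP; rewrite subr_eq => /eqP ->; ring.
Qed.

Lemma delay_c1 : c1 delay_fun delay_der.
Proof.
split=> [E|E].
  have d1 := pprim_derive r1c kc Hrho.1 drhoc (dv_id E) (dv_cst 1 E).
  have d2 := pprim_derive r1c kc Hrho.1 drhoc (dv_id E) (dv_cst u1 E).
  have d3 := pprim_derive onec sqrc HN.1 dNc (dv_id E) (Hsq.1 E).
  apply: dv_eq (dvD (dvB d1 d2) (dvMl 2 d3)) _.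
  by rewrite /delay_der /dJ /dI /one /sqr; ring.
apply: cvgD.
  by apply: cvgB; [apply: (@pprim_cont _ _ _ r1c kc drho id (fun=> 1))|
    apply: (@pprim_cont _ _ _ r1c kc drho id (fun=> u1))] => //;
    try exact: cvg_id; exact: cvg_cst.
apply: cvgM; first exact: cvg_cst.
apply: cvgD.
  by apply: (@pprim_cont _ _ _ onec sqrc dN id sq) => //; try exact: cvg_id; exact: sqc.
apply: cvgM; last exact: Hsq.2.
apply: (@continuous_comp _ _ _ (fun E => E - sq E ^+ 2) N); last exact: Nc.
apply: cvgB; first exact: cvg_id.
by apply: (@continuous_comp _ _ _ sq sqr); [exact: sqc|exact: sqrc].
Qed.

Let sgM (p : R) : Num.sg p * `|p| = p. Proof. by rewrite -numEsg. Qed.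

Lemma phase_out E u p : El <= E <= Eh -> 1 <= u -> E = p ^+ 2 ->
  phase_fun E u p = Num.sg p * (delay_fun E + (u - 1) / Num.sqrt E).
Proof.
move=> EE ul Ep; rewrite /phase_fun /delay_fun J_out// sqE// Ep sqrtr_sqr.
have -> : I (p ^+ 2) p = Num.sg p * I (p ^+ 2) `|p|; last by ring.
have [p0|p0|->] := ltgtP p 0.
- by rewrite ltr0_norm// ltr0_sg// I_odd mulN1r opprK.
- by rewrite gtr0_norm// gtr0_sg// mul1r.
- by rewrite sgr0 mul0r /I pprim0.
Qed.

(** Along the motion the [J] part grows at rate [r1] and the [I] part at rate [1 - r1], which adds
    up to unit speed. All bounds come from compactness of the energy window and from [r1 = 1] beyond
    the potential. *)
Lemma phase_wall : exists C, wall_phase k El Eh sq dsq delay_fun delay_der phase_fun C.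
Proof.
have [K1 K10 K1P] := IB.
have [K2 K20 K2P] := JB.
have [K3 K30 K3P] := cont_bounded Eh Nc.
pose M := 1 + Eh.
have M0 : 0 < M by rewrite /M; move: El0 ElEh; lra.
pose C := 2 * K1 * M + 2 * K1 + K2 + 2 * K3.
have K1M : 0 < K1 * M by rewrite mulr_gt0.
have C0 : 0 < C by rewrite /C; move: K10 K20 K30 K1M; lra.
have sg1 (p : R) : `|Num.sg p| <= 1 by rewrite normr_sg lern1 leq_b1.
exists C; split => //.
- exact: delay_c1.
- exact: phase_out.
- move=> E u p EE Ee.
  have [h1 _] := K1P _ _ _ EE Ee; have [h2 _ _] := K2P _ _ EE (u3_lt EE Ee).
  have pM := pE EE Ee.
  apply: le_trans (ler_normD _ _) _; rewrite !normrM.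
  rewrite (ger0_norm (ler0n _ 2)).
  have h3 : `|Num.sg p| * `|J E u| <= 1 * (K2 * (1 + `|u|)) by rewrite ler_pM.
  have h4 : K1 * `|p| <= K1 * M by rewrite ler_wpM2l// ltW.
  have u0 := normr_ge0 u.
  by rewrite /C; nra.
- move=> E u p EE Ee ku.
  have [h1 _] := K1P _ _ _ EE Ee.
  rewrite /phase_fun JE0 ?mulr0 ?addr0.
    by rewrite normrM (ger0_norm (ler0n _ 2)); have := normr_ge0 p; rewrite /C; nra.
  rewrite ltW ?(u3_lt EE Ee)//= leNgt; apply/negP => u1u.
  have [ul|ul] := leP u 1.
    by have := kappa_decr hk u1u ul; rewrite ku1; move: ku; lra.
  by move: ku; rewrite (kappa_ge1 hk (ltW ul)); move: El0; lra.
move=> t E u p E' u' p' Ed ud pd nE EE.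
have Et : E t = p t ^+ 2 + k (u t) by exact: nbhs_singleton nE.
have u3t := u3_lt EE Et.
have [hI hdI] := K1P _ _ _ EE Et.
have [hJ hdJ hr] := K2P _ _ EE u3t.
have dId := pprim_derive onec sqrc HN.1 dNc Ed pd.
have N_le : `|N (E t - sqr (p t))| <= K3.
  apply: K3P; rewrite /sqr Et addrAC subrr add0r ger0_norm ?kappa_ge0//.
  by case/andP: EE => _; rewrite Et; have := sqr_ge0 (p t); lra.
have NEk : E t - sqr (p t) = k (u t) by rewrite Et /sqr; ring.
have c_le : `|2 * N (E t - sqr (p t))| <= C.
  by rewrite normrM (ger0_norm (ler0n _ 2)) /C; nra.
have u0 := normr_ge0 (u t).
have a1_le : `|2 * dI (E t) (p t)| <= 2 * K1.
  by rewrite normrM (ger0_norm (ler0n _ 2)) ler_pM2l.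
(* At a turning point the potential is at least [El], so the position is below [u1] at all nearby
   times and only the [I] part, which is smooth in [p], remains. *)
have [p0|p0] := eqVneq (p t) 0.
  have kul : El <= k (u t).
    by case/andP: EE => + _; rewrite Et p0 expr0n add0r.
  have utl : u t < u1 by apply: (kappa_lt hk); rewrite ku1; move: El0; lra.
  have ut1 : u t < 1 by case/andP: u1_01 => _; exact: lt_trans.
  exists (2 * dI (E t) (p t)), 0, (2 * N (E t - sqr (p t))); split => //.
  - apply: (dv_near (f := fun s => 2 * I (E s) (p s))).
      have n1 : \forall s \near t, u3 < u s.
        by apply: near_gt (dv_cont ud) _.
      have n2 : \forall s \near t, u s < u1.
        by apply: near_lt (dv_cont ud) _.
      near=> s; rewrite /phase_fun JE0 ?mulr0 ?addr0//.
      by apply/andP; split; apply: ltW; near: s.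
    apply: dv_eq (dvMl 2 dId) _; rewrite /one /dI; ring.
  - by rewrite /C; nra.
  - by rewrite normr0 ltW.
  rewrite mul0r NEk NE.
  - by field; rewrite lt_eqF// kappa1_lt0.
  - exact: ltW.
  - move: EE => /andP[_ +]; rewrite Et p0 expr0n add0r => h.
    by apply/andP; split; move: El0 Ehk; lra.
have sgt : \forall s \near t, Num.sg (p s) = Num.sg (p t).
  have [pl|pl|/eqP] := ltgtP (p t) 0; last by rewrite (negPf p0).
    have : \forall s \near t, p s < 0 by apply: near_lt (dv_cont pd) _.
    by apply: filterS => s ps; rewrite !ltr0_sg.
  have : \forall s \near t, 0 < p s by apply: near_gt (dv_cont pd) _.
  by apply: filterS => s ps; rewrite !gtr0_sg.
have d1 := pprim_derive r1c kc Hrho.1 drhoc Ed ud.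
have d2 := pprim_derive r1c kc Hrho.1 drhoc Ed (dv_cst u1 t).
exists (2 * dI (E t) (p t) + Num.sg (p t) * dJ (E t) (u t)),
  (Num.sg (p t) * (r1 (u t) * rho (E t - k (u t)))), (2 * N (E t - sqr (p t))).
split => //.
- apply: (dv_near (f := fun s => 2 * I (E s) (p s) + Num.sg (p t) * J (E s) (u s))).
    by apply: filterS sgt => s ss; rewrite /phase_fun ss.
  apply: dv_eq (dvD (dvMl 2 dId) (dvMl (Num.sg (p t)) (dvB d1 d2))) _.
  by rewrite /one /dI /dJ; ring.
- apply: le_trans (ler_normD _ _) _; rewrite [in X in _ + X]normrM.
  have h3 : `|Num.sg (p t)| * `|dJ (E t) (u t)| <= 1 * (K2 * (1 + `|u t|)).
    by rewrite ler_pM.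
  by rewrite /C; nra.
- rewrite normrM; apply: (@le_trans _ _ (1 * K2)); first by rewrite ler_pM.
  by rewrite /C; nra.
rewrite NEk.
(* Either [r1] vanishes, or the potential is below [El / 2]; then [rho] is evaluated at [p ^+ 2]
   inside its range and equals [1 / |p|]. *)
suff -> : Num.sg (p t) * (r1 (u t) * rho (E t - k (u t))) * p t = r1 (u t).
  by rewrite /r1; field.
have [uu1|u1u] := leP (u t) u1.
  by rewrite r1_0 ?mul0r ?mulr0 ?mul0r// ltW.
have kul : k (u t) < El / 2.
  have [ul|ul] := leP (u t) 1; first by rewrite -ku1 kappa_decr.
  by rewrite (kappa_ge1 hk (ltW ul)); move: El0; lra.
have -> : E t - k (u t) = p t ^+ 2 by rewrite Et addrK.
rewrite rhoE; last first.
  have := kappa_ge0 hk (u t); move: EE; rewrite Et => /andP[? ?] ?.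
  by apply/andP; split; lra.
rewrite sqrtr_sqr.
have sgsg : Num.sg (p t) * Num.sg (p t) = 1 by rewrite -expr2 sqr_sg p0.
have np : `|p t| != 0 by rewrite normr_eq0.
transitivity (Num.sg (p t) * (r1 (u t) * `|p t|^-1) * (Num.sg (p t) * `|p t|)).
  by rewrite sgM.
transitivity (Num.sg (p t) * Num.sg (p t) * r1 (u t) * (`|p t|^-1 * `|p t|)).
  by ring.
by rewrite sgsg mulVf// mul1r mulr1.
Unshelve. all: by end_near. Qed.

End WallPhaseExists.

Lemma ex_wall_phase {R : realType} (k : R -> R) El Eh : kappa_hyp k ->
  0 < El -> El <= Eh -> Eh < k 0 ->
  exists sq dsq g dg Sn C, wall_phase k El Eh sq dsq g dg Sn C.
Proof.
move=> hk El0 ElEh Ehk.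
have [N [dN [HN NE]]] := inv_slope_extension hk El0 ElEh Ehk.
have [rho [drho [Hr rE]]] := inv_sqrt_extension El0 ElEh.
have [sq [dsq [Hs sE]]] := sqrt_extension El0 ElEh.
by have [C HC] := phase_wall hk El0 ElEh Ehk HN NE Hr rE Hs sE; eexists _, _, _, _, _, _; exact: HC.
Qed.

(** * Periods and momentum fluxes with the piston held fixed *)

Section Period.
Context {R : realType}.
Variable k : R -> R.
Hypothesis hk : kappa_hyp k.
Variables (El Eh : R) (sq dsq g dg : R -> R) (Sn : R -> R -> R -> R) (C : R).
Hypotheses (El0 : 0 < El) (Ehk : Eh < k 0).
Hypothesis WP : wall_phase k El Eh sq dsq g dg Sn C.

Section Energy.
Variable E : R.
Hypothesis EE : El <= E <= Eh.

Let u0 := kinv k E.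
(** Phase at position [u] on the outgoing branch. Positions before the turning point [u0] are
    clamped to it, which makes the function continuous on the whole line. *)
Let Phi u := Sn E (Num.max u0 u) (Num.sqrt (E - k (Num.max u0 u))).

Let E0 : 0 < E < k 0.
Proof.
by move: EE El0 Ehk => /andP[h1 h2] h3 h4; rewrite (lt_le_trans h3 h1) (le_lt_trans h2 h4).
Qed.
Let ku0 : k u0 = E.
Proof. by have [|_] := @kinvP _ _ hk E; [case/andP: E0 => *; rewrite !ltW|]. Qed.
Let u01 : 0 < u0 < 1. Proof. exact: kinv_lt. Qed.

Let kuE u : u0 <= u -> k u <= E. Proof. by move=> uu; rewrite -ku0 kappa_nincr. Qed.
Let kuE_lt u : u0 < u -> k u < E.
Proof.
move=> uu; rewrite -ku0; have [u1|u1] := leP u 1; first exact: kappa_decr.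
by rewrite (kappa_ge1 hk (ltW u1)) ku0; case/andP: E0.
Qed.

Let sqE u : u0 <= u -> E = Num.sqrt (E - k u) ^+ 2 + k u.
Proof. by move=> uu; rewrite sqr_sqrtr ?subr_ge0 ?kuE// subrK. Qed.

Let Phi_der u : u0 < u -> is_derive u (1 : R) Phi (Num.sqrt (E - k u))^-1.
Proof.
move=> uu.
have p0 : 0 < E - k u by rewrite subr_gt0 kuE_lt.
have s0 : 0 < Num.sqrt (E - k u) by rewrite sqrtr_gt0.
have pd := @dv_comp _ Num.sqrt (fun s => E - k s) u _ _ (is_derive1_sqrt p0) (dvB (dv_cst E u) (kappa_derive hk u)).
have nu : \forall s \near u, u0 < s by exact: lt_nbhsr.
have nE : \forall s \near u, E = Num.sqrt (E - k s) ^+ 2 + k s.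
  by apply: filterS nu => s /ltW; exact: sqE.
have [a [b [c [D _ _ _ e]]]] := wp_derive WP (dv_cst E u) (dv_id u) pd nE EE.
apply: (dv_near (f := fun s => Sn E s (Num.sqrt (E - k s)))).
  by apply: filterS nu => s /ltW us; rewrite /Phi max_r.
apply: dv_eq D _; rewrite mulr0 add0r mulr1 sub0r.
apply: (mulIf (lt0r_neq0 s0)); rewrite mulVf ?lt0r_neq0// -[RHS]e.
by field; rewrite lt0r_neq0.
Qed.

Let Phi_u0 : Phi u0 = 0.
Proof.
apply/eqP; rewrite -normr_le0 /Phi max_l// ku0 subrr sqrtr0.
have := @wp_turn _ _ _ _ _ _ _ _ _ _ WP E u0 0 EE.
rewrite normr0 mulr0 ku0 expr0n add0r; apply => //.
by case/andP: EE => h _; move: El0; lra.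
Qed.

(** Continuity at [u0] comes from the estimate of the phase by the momentum near a turning point:
    the momentum tends to 0 there. *)
Let Phi_cont : continuous Phi.
Proof.
move=> u; have [uu|uu|<-] := ltgtP u0 u.
- exact: dv_cont (Phi_der uu).
- have : \forall s \near u, s < u0 by exact: lt_nbhsl.
  move=> n; rewrite /prop_for /continuous_at {2}/Phi (max_l (ltW uu)).
  apply: cvg_near_cst; apply: filterS n => s su.
  by rewrite /Phi (max_l (ltW su)).
have cm : {for u0, continuous (fun u => Num.max u0 u)}.
  by apply: continuous_max; [exact: cvg_cst|exact: cvg_id].
have ck : {for u0, continuous (fun u => k (Num.max u0 u))}.
  by apply: (@continuous_comp _ _ _ (Num.max u0) k) => //; exact: kappa_cont.
have cs : (fun u => C * `|Num.sqrt (E - k (Num.max u0 u))|) @ u0 --> (0 : R).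
  have -> : 0 = C * `|Num.sqrt (E - k (Num.max u0 u0))|.
    by rewrite max_l// ku0 subrr sqrtr0 normr0 mulr0.
  apply: cvgM; first exact: cvg_cst.
  apply: cvg_norm.
  apply: (@continuous_comp _ _ _ (fun u => E - k (Num.max u0 u)) Num.sqrt).
    by apply: cvgB => //; exact: cvg_cst.
  exact: sqrt_continuous.
rewrite /prop_for /continuous_at Phi_u0.
apply/norm_cvg0P.
apply: (@squeeze_cvgr _ _ _ _ (fun=> 0) (fun u => C * `|Num.sqrt (E - k (Num.max u0 u))|)) cs.
  have : \forall s \near u0, El / 2 < k (Num.max u0 s).
    apply: near_gt => //; rewrite max_l// ku0; case/andP: EE => h _; move: El0; lra.
  apply: filterS => s ks; rewrite normr_ge0/=.
  apply: (wp_turn WP) => //; last exact: ltW.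
  by apply: sqE; rewrite le_max lexx.
exact: cvg_cst.
Qed.

Let Phi_out u : 1 <= u -> Phi u = g E + (u - 1) / Num.sqrt E.
Proof.
move=> u1; rewrite /Phi max_r; last by rewrite (le_trans _ u1)// ltW//; case/andP: u01.
case/andP: E0 => e0 _.
rewrite (kappa_ge1 hk u1) subr0 (wp_out WP)//; last by rewrite sqr_sqrtr// ltW.
by rewrite gtr0_sg ?mul1r// sqrtr_gt0.
Qed.

(** As [2 d < q - p], at each point at most one of the two potentials is nonzero. A primitive is
    therefore the sum of the phase times counted from the two ends, with one free flight term
    subtracted. *)
Lemma half_period (m d p q : R) : 0 < m -> 0 < d -> 2 * d < q - p ->
  \int[lebesgue_measure]_(s in `[p + d * kinv k E, q - d * kinv k E])
     Num.sqrt ((m / 2) / (E - kd k d (s - p) - kd k d (q - s))) =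
  Num.sqrt (m / 2) * (2 * d * g E + (q - p - 2 * d) / Num.sqrt E).
Proof.
move=> m0 d0 dL; rewrite -/u0.
have /andP[u00 u0l1] := u01.
have du : 0 < d * u0 < d by rewrite mulr_gt0//= -[ltRHS]mulr1 ltr_pM2l.
case/andP: (E0) => e0 _.
have sE : 0 < Num.sqrt E by rewrite sqrtr_gt0.
pose c := Num.sqrt (m / 2).
(* Of the two phase derivatives one equals the inverse square root of [E], since the corresponding
   potential is 0; the last term cancels exactly this one. *)
pose G s := c * (d * Phi ((s - p) / d) - d * Phi ((q - s) / d) - s / Num.sqrt E).
have kz x : d <= x -> kd k d x = 0.
  by move=> dx; apply: (kappa_ge1 hk); rewrite ler_pdivlMr// mul1r.
have kE x : d * u0 < x -> kd k d x < E.
  by move=> dx; apply: kuE_lt; rewrite ltr_pdivlMr// mulrC.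
have pos s : p + d * u0 < s < q - d * u0 -> 0 < E - kd k d (s - p) - kd k d (q - s).
  move=> /andP[s1 s2]; have k1 := kE (s - p); have k2 := kE (q - s).
  have [h|h] := leP d (s - p); first by rewrite kz// subr0 subr_gt0 k2//; lra.
  by rewrite (kz (q - s)) ?subr0 ?subr_gt0 ?k1//; lra.
transitivity (G (q - d * u0) - G (p + d * u0)); last first.
  rewrite /G.
  have -> : (p + d * u0 - p) / d = u0 by field; rewrite gt_eqF.
  have -> : (q - (q - d * u0)) / d = u0 by field; rewrite gt_eqF.
  have -> : q - (p + d * u0) = q - d * u0 - p by ring.
  rewrite Phi_u0 Phi_out; last first.
    by rewrite ler_pdivlMr// mul1r; move: du dL => /andP[]; lra.
  by rewrite -/c; field; rewrite !gt_eqF.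
apply: ge0_improper_FTC2.
- by move: du dL => /andP[]; lra.
- by move=> s; exact: sqrtr_ge0.
- move=> s /pos ps.
  apply: (@continuous_comp _ _ _ (fun s => (m / 2) / (E - kd k d (s - p) - kd k d (q - s))) Num.sqrt); last exact: sqrt_continuous.
  apply: cvgM; first exact: cvg_cst.
  apply: cvgV; first by rewrite gt_eqF.
  have kc (f : R -> R) : {for s, continuous f} -> {for s, continuous (fun s => kd k d (f s))}.
    move=> fc; apply: (@continuous_comp _ _ _ (fun s => f s / d) k).
      by apply: cvgM => //; exact: cvg_cst.
    exact: kappa_cont.
  apply: cvgB.
    apply: cvgB; first exact: cvg_cst.
    by apply: (kc (fun s => s - p)); apply: cvgB; [exact: cvg_id|exact: cvg_cst].
  by apply: (kc (fun s => q - s)); apply: cvgB; [exact: cvg_cst|exact: cvg_id].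
- apply: continuous_subspaceT => s.
  have Pc (f : R -> R) : {for s, continuous f} -> {for s, continuous (fun s => d * Phi (f s / d))}.
    move=> fc; apply: cvgM; first exact: cvg_cst.
    apply: (@continuous_comp _ _ _ (fun s => f s / d) Phi); last exact: Phi_cont.
    by apply: cvgM => //; exact: cvg_cst.
  apply: cvgM; first exact: cvg_cst.
  apply: cvgB; last by apply: cvgM; [exact: cvg_id|exact: cvg_cst].
  apply: cvgB.
    by apply: (Pc (fun s => s - p)); apply: cvgB; [exact: cvg_id|exact: cvg_cst].
  by apply: (Pc (fun s => q - s)); apply: cvgB; [exact: cvg_cst|exact: cvg_id].
move=> s spq; have ps := pos s spq.
have [s1 s2] := andP spq.
have h1 : u0 < (s - p) / d by rewrite ltr_pdivlMr// mulrC; lra.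
have h2 : u0 < (q - s) / d by rewrite ltr_pdivlMr// mulrC; lra.
have D1 := @dv_comp _ Phi (fun s => (s - p) / d) s _ _ (Phi_der h1)
  (dvMr d^-1 (dvB (dv_id s) (dv_cst p s))).
have D2 := @dv_comp _ Phi (fun s => (q - s) / d) s _ _ (Phi_der h2)
  (dvMr d^-1 (dvB (dv_cst q s) (dv_id s))).
apply: dv_eq (dvMl c (dvB (dvB (dvMl d D1) (dvMl d D2)) (dvMr _ (dv_id s)))) _.
rewrite -/(kd k d (s - p)) -/(kd k d (q - s)).
rewrite sqrtrM ?divr_ge0 ?ltW// sqrtrV ?ltW// -/c; congr (_ * _).
have d00 : d != 0 by rewrite gt_eqF.
have [h|h] := leP d (s - p).
  rewrite (kz (s - p))// !subr0.
  have : Num.sqrt (E - kd k d (q - s)) != 0 by rewrite gt_eqF// sqrtr_gt0 subr_gt0 kE//; lra.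
  by move=> nz; field; rewrite ?nz ?d00 ?(gt_eqF sE).
rewrite (kz (q - s)) ?subr0; last by lra.
have : Num.sqrt (E - kd k d (s - p)) != 0 by rewrite gt_eqF// sqrtr_gt0 subr_gt0 kE//; lra.
by move=> nz; field; rewrite ?nz ?d00 ?(gt_eqF sE).
Qed.

End Energy.

(* [2 d gam E] is the amount by which the interval available to the particle
   is effectively shortened by the soft core. *)
Definition gam E := 1 - sq E * g E.

Lemma period_flux (m d p q E : R) : 0 < m -> 0 < d -> 2 * d < q - p -> El <= E <= Eh ->
  Num.sqrt (8 * m * E) / (2 *
    \int[lebesgue_measure]_(s in `[p + d * kinv k E, q - d * kinv k E])
     Num.sqrt ((m / 2) / (E - kd k d (s - p) - kd k d (q - s)))) =
  2 * E / (q - p - 2 * d * gam E).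
Proof.
move=> m0 d0 dL EE; rewrite half_period//.
have e0 : 0 < E by case/andP: EE => + _; exact: lt_le_trans.
rewrite /gam (wp_sqE WP)//.
have -> : 8 * m * E = (m / 2) * (E * 4 ^+ 2) by field.
rewrite (@sqrtrM _ (m / 2)) ?divr_ge0 ?ltW// (@sqrtrM _ E) ?ltW// sqrtr_sqr (ger0_norm (ler0n _ 4)).
have m2 : Num.sqrt (m / 2) != 0 by rewrite gt_eqF// sqrtr_gt0 divr_gt0.
have s0 : Num.sqrt E != 0 by rewrite gt_eqF// sqrtr_gt0.
have -> : 2 * E = 2 * Num.sqrt E ^+ 2 by rewrite sqr_sqrtr// ltW.
set s := Num.sqrt E in s0 *.
have -> : 2 * d * g E + (q - p - 2 * d) / s = (q - p - 2 * d * (1 - s * g E)) / s by field.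
(* For a vanishing effective length both sides are 0, by the convention for division by 0. *)
have [->|z] := eqVneq (q - p - 2 * d * (1 - s * g E)) 0.
  by rewrite mul0r mulr0 mulr0 invr0 !mulr0.
by field; rewrite z m2 s0.
Qed.

End Period.

Section Flux.
Context {R : realType}.
Variables (El Eh : R) (sq dsq g dg : R -> R).
Hypotheses (Hsq : c1 sq dsq) (Hg : c1 g dg).
Variables (r d0 : R) (iv div : R -> R).
Hypotheses (El0 : 0 < El) (r0 : 0 < r).
Hypothesis Hiv : c1 iv div.
Hypothesis ivE : forall y, r / 2 <= y <= 2 -> iv y = y^-1.
Hypothesis d0r : forall d E, 0 <= d <= d0 -> El <= E <= Eh ->
  `|2 * d * gam sq g E| <= r / 2.

Definition dgam E := - (dsq E * g E + sq E * dg E).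

Lemma gam_c1 : c1 (gam sq g) dgam.
Proof.
split=> [E|E].
  apply: dv_eq (dvB (dv_cst 1 E) (dvM (Hsq.1 E) (Hg.1 E))) _.
  by rewrite /dgam; ring.
have sc := dv_cont (Hsq.1 E); have gc := dv_cont (Hg.1 E).
apply: cvgN; apply: cvgD; apply: cvgM => //; [exact: Hsq.2|exact: Hg.2].
Qed.

(** Twice the energy over the effective length, with the inverse replaced by its extension [iv]. The
    result is C^1 in all arguments, and at [d = 0] it gives the hard core value [2 E / L]. *)
Definition flux d L E := 2 * E * iv (L - 2 * d * gam sq g E).
Definition flux_der d L E L' E' := 2 * E' * iv (L - 2 * d * gam sq g E) +
  2 * E * (div (L - 2 * d * gam sq g E) * (L' - 2 * d * (dgam E * E'))).

Lemma flux_derive d (L E : R -> R) L' E' t :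
  is_derive t (1 : R) L L' -> is_derive t (1 : R) E E' ->
  is_derive t (1 : R) (fun s => flux d (L s) (E s)) (flux_der d (L t) (E t) L' E').
Proof.
move=> Ld Ed; have D1 := @dv_comp _ (gam sq g) E t _ _ (gam_c1.1 _) Ed.
have D2 := @dv_comp _ iv (fun s => L s - 2 * d * gam sq g (E s)) t _ _ (Hiv.1 _)
  (dvB Ld (dvMl (2 * d) D1)).
apply: dv_eq (dvM (dvMl 2 Ed) D2) _; rewrite /flux_der; ring.
Qed.

Lemma fluxE d L E : 0 <= d <= d0 -> El <= E <= Eh -> r <= L <= 1 ->
  flux d L E = 2 * E / (L - 2 * d * gam sq g E).
Proof.
move=> hd hE /andP[rL L1]; rewrite /flux ivE//.
have := d0r hd hE; rewrite ler_norml => /andP[h1 h2].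
by apply/andP; split; lra.
Qed.

(** One constant serves all admissible [d], since the argument of [iv] stays within [1 + r / 2]. *)
Lemma flux_bounds : exists2 C, 0 < C & forall d L E, 0 <= d <= d0 -> El <= E <= Eh ->
  r <= L <= 1 -> `|flux d L E| <= C /\
    forall L' E', `|flux_der d L E L' E'| <= C * (`|L'| + `|E'|).
Proof.
have ivc : continuous iv by move=> x; exact: dv_cont (Hiv.1 x).
have [K1 K10 K1P] := cont_bounded (1 + r / 2) ivc.
have [K2 K20 K2P] := cont_bounded (1 + r / 2) Hiv.2.
have [K3 K30 K3P] := cont_bounded Eh gam_c1.2.
pose M := 2 * `|Eh|.
have M0 : 0 <= M by rewrite mulr_ge0.
pose C := M * K1 + 2 * K1 + M * K2 * (1 + 2 * `|d0| * K3) + 1.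
have q0 : 0 <= M * K1 by rewrite mulr_ge0// ltW.
have q1 : 0 <= M * K2 by rewrite mulr_ge0// ltW.
have q2 : 0 <= 2 * `|d0| * K3 by rewrite !mulr_ge0// ltW.
have q3 : 0 <= M * K2 * (1 + 2 * `|d0| * K3) by rewrite mulr_ge0// addr_ge0.
have C0 : 0 < C by rewrite /C; lra.
exists C => // d L E hd hE /andP[rL L1].
have yM : `|L - 2 * d * gam sq g E| <= 1 + r / 2.
  apply: le_trans (ler_normB _ _) _; apply: lerD; last exact: d0r.
  by rewrite ger0_norm// (le_trans _ rL)// ltW.
have EM : `|2 * E| <= M.
  case/andP: hE => E1 E2; rewrite normrM (ger0_norm (ler0n _ 2)) ler_pM2l//.
  by rewrite !ger0_norm//; move: El0; lra.
have h1 := K1P _ yM; have h2 := K2P _ yM.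
have h3 : `|dgam E| <= K3.
  by apply: K3P; case/andP: hE => E1 E2; rewrite ger0_norm//; move: El0; lra.
have hd' : `|2 * d| <= 2 * `|d0|.
  by case/andP: hd => ? ?; rewrite normrM (ger0_norm (ler0n _ 2)) ler_pM2l// !ger0_norm//; lra.
split.
  rewrite normrM; apply: (@le_trans _ _ (M * K1)); first exact: ler_pM.
  by rewrite /C; lra.
move=> L' E'; apply: le_trans (ler_normD _ _) _.
have a1 : `|2 * E' * iv (L - 2 * d * gam sq g E)| <= 2 * K1 * `|E'|.
  rewrite !normrM (ger0_norm (ler0n _ 2)) mulrAC; apply: ler_wpM2r => //.
  by rewrite ler_pM2l.
have a2 : `|L' - 2 * d * (dgam E * E')| <= `|L'| + 2 * `|d0| * K3 * `|E'|.
  apply: le_trans (ler_normB _ _) _; rewrite lerD2l normrM (normrM (dgam E)) mulrA.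
  by apply: ler_wpM2r => //; exact: ler_pM.
have a3 : `|2 * E * (div (L - 2 * d * gam sq g E) * (L' - 2 * d * (dgam E * E')))| <=
   M * K2 * (`|L'| + 2 * `|d0| * K3 * `|E'|).
  by rewrite normrM -(mulrA M); apply: ler_pM => //; rewrite normrM; apply: ler_pM.
apply: (@le_trans _ _ (2 * K1 * `|E'| + M * K2 * (`|L'| + 2 * `|d0| * K3 * `|E'|))).
  exact: lerD.
have n1 := normr_ge0 L'; have n2 := normr_ge0 E'.
have b1 : 0 <= M * K1 * (`|L'| + `|E'|) by rewrite mulr_ge0// addr_ge0.
have b2 : 0 <= K1 * `|L'| by rewrite mulr_ge0// ltW.
have b3 : 0 <= M * K2 * (2 * `|d0| * K3 * `|L'| + `|E'|).
  by rewrite mulr_ge0// addr_ge0// mulr_ge0.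
rewrite -subr_ge0.
have -> : C * (`|L'| + `|E'|) - (2 * K1 * `|E'| + M * K2 * (`|L'| + 2 * `|d0| * K3 * `|E'|))
  = M * K1 * (`|L'| + `|E'|) + 2 * (K1 * `|L'|) +
    M * K2 * (2 * `|d0| * K3 * `|L'| + `|E'|) + (`|L'| + `|E'|).
  by rewrite /C; ring.
by lra.
Qed.

(** The admissible [(L, E)] form a box, hence the derivative bound can be integrated along the
    segment between the two points. *)
Lemma flux_lipschitz : exists2 C, 0 < C & forall d L E L1 E1, 0 <= d <= d0 ->
  El <= E <= Eh -> r <= L <= 1 -> El <= E1 <= Eh -> r <= L1 <= 1 ->
  `|flux d L1 E1 - flux d L E| <= C * (`|L1 - L| + `|E1 - E|).
Proof.
have [C C0 CP] := flux_bounds; exists C => // d L E L1 E1 hd hE hL hE1 hL1.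
pose l s := L + s * (L1 - L); pose e s := E + s * (E1 - E).
have ld s : is_derive s (1 : R) l (L1 - L).
  by apply: dv_eq (dvD (dv_cst L s) (dvMr (L1 - L) (dv_id s))) _; ring.
have ed s : is_derive s (1 : R) e (E1 - E).
  by apply: dv_eq (dvD (dv_cst E s) (dvMr (E1 - E) (dv_id s))) _; ring.
have := @mvt_bound _ (fun s => flux d (l s) (e s)) _ 0 1 (C * (`|L1 - L| + `|E1 - E|))
  ler01 (fun s _ => flux_derive d (ld s) (ed s)).
rewrite /l /e !mul0r !mul1r !addr0 subr0 mulr1 ![_ + (_ - _)]addrC !subrK; apply.
  apply/continuous_subspaceT => s; exact: dv_cont (flux_derive d (ld s) (ed s)).
have conv (a b u w s : R) : u <= a <= w -> u <= b <= w -> 0 < s < 1 ->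
    u <= a + s * (b - a) <= w.
  by move=> /andP[? ?] /andP[? ?] /andP[? ?]; apply/andP; split; nra.
by move=> s hs; apply: (CP _ _ _ hd _ _).2; exact: conv.
Qed.

End Flux.

(** * The corrector of a soft core particle *)

Section SoftCorrector.
Context {R : realType}.
Variable k : R -> R.
Hypothesis hk : kappa_hyp k.
Variables (El Eh : R) (sq dsq g dg : R -> R) (Sn : R -> R -> R -> R) (CS : R).
Hypotheses (El0 : 0 < El) (Ehk : Eh < k 0).
Hypothesis WP : wall_phase k El Eh sq dsq g dg Sn CS.
Variables (r d0 : R) (iv div : R -> R).
Hypotheses (r0 : 0 < r) (r1 : r <= 1).
Hypothesis Hiv : c1 iv div.
Hypothesis ivE : forall y, r / 2 <= y <= 2 -> iv y = y^-1.
Hypothesis d0r : forall d E, 0 <= d <= d0 -> El <= E <= Eh ->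
  `|2 * d * gam sq g E| <= r / 2.
Hypothesis d0_1 : d0 <= r / 4.
Variable m : R.
Hypothesis m0 : 0 < m.

Local Notation f := (flux sq g iv).
(** With [p = c v] and [u = x / d] the energy near the wall becomes [p^2 + k u], and physical time
    is [d c] times the rescaled phase time. *)
Let c := Num.sqrt (m / 2).
Let c0 : 0 < c. Proof. by rewrite sqrtr_gt0 divr_gt0. Qed.
Let c2 : c ^+ 2 = m / 2. Proof. by rewrite sqr_sqrtr// divr_ge0// ltW. Qed.

Lemma kd_derive d y : d != 0 -> is_derive y (1 : R) (kd k d) (derive1 k (y / d) / d).
Proof.
move=> d00; apply: dv_eq (@dv_comp _ k (fun y => y / d) y _ _ (kappa_derive hk _)
  (dvMr d^-1 (dv_id y))) _.
by rewrite mul1r.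
Qed.

Lemma kd_derive1 d y : d != 0 -> derive1 (kd k d) y = derive1 k (y / d) / d.
Proof. by move=> /(kd_derive y)[_ <-]; rewrite derive1E. Qed.

Definition particle_energy d X x v :=
  m * v ^+ 2 / 2 + (kd k d x + kd k d (X - x)).

(* Phase time is counted from the last turning point: the one at the wall for [x <= X / 2],
   the one at the piston beyond, where the momentum received since is added.
   The two expressions agree on the free flight by the period formula. *)
Definition chi_left d X x v E := - (f d X E * (d * (c * Sn E (x / d) (c * v)))).
Definition chi_right d X x v E :=
  - (m * v) - f d X E * (d * (c * Sn E ((X - x) / d) (- (c * v)))).
Definition chi d X x v :=
  let E := particle_energy d X x v in
  if x <= X / 2 then chi_left d X x v E else chi_right d X x v E.

Let kd_out d y : 0 < d -> d <= y -> kd k d y = 0.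
Proof. by move=> dp dy; apply: (kappa_ge1 hk); rewrite ler_pdivlMr// mul1r. Qed.

Let kd1_out d y : 0 < d -> d <= y -> derive1 (kd k d) y = 0.
Proof.
move=> dp dy; rewrite kd_derive1 ?gt_eqF//.
by rewrite kappa1_ge1 ?mul0r// ler_pdivlMr// mul1r.
Qed.

Let kd_ge0 d y : 0 <= kd k d y. Proof. exact: (kappa_ge0 hk). Qed.

Let mv2 v : m * v ^+ 2 / 2 = (c * v) ^+ 2.
Proof. by rewrite exprMn c2; field. Qed.

Lemma chi_overlap d X x v E : 0 < d <= d0 -> r <= X <= 1 -> El <= E <= Eh ->
  d <= x <= X - d -> E = m * v ^+ 2 / 2 ->
  chi_left d X x v E = chi_right d X x v E.
Proof.
move=> /andP[dp dd0] hX hE /andP[dx xd] Ee.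
have Ep : E = (c * v) ^+ 2 by rewrite Ee mv2.
have e0 : 0 < E by case/andP: hE => + _; exact: lt_le_trans.
have s0 : Num.sqrt E != 0 by rewrite gt_eqF// sqrtr_gt0.
rewrite /chi_left /chi_right (wp_out WP hE)//; last by rewrite ler_pdivlMr// mul1r.
rewrite (wp_out WP hE) ?sqrrN//; last by rewrite ler_pdivlMr// mul1r; lra.
have hd' : 0 <= d <= d0 by rewrite (ltW dp).
rewrite sgrN (fluxE ivE d0r hd' hE hX).
have d00 : d != 0 by rewrite gt_eqF.
set z := X - 2 * d * gam sq g E.
have z0 : 0 < z.
  have := d0r hd' hE; by rewrite ler_norml => /andP[_]; case/andP: hX; rewrite /z; move: r0; lra.
have sE : Num.sqrt E = Num.sg (c * v) * (c * v) by rewrite Ep sqrtr_sqr normrEsg.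
have cv0 : c * v != 0.
  by apply/eqP => cv; move: e0; rewrite Ep cv expr0n ltxx.
have sg2 : Num.sg (c * v) ^+ 2 = 1 by rewrite sqr_sg cv0.
have zE : z = X - 2 * d + 2 * d * (Num.sqrt E * g E).
  by rewrite /z /gam (wp_sqE WP)//; ring.
have mE : m * v = Num.sg (c * v) * (2 * c * Num.sqrt E).
  rewrite sE; transitivity (Num.sg (c * v) ^+ 2 * (2 * c ^+ 2 * v)); last by ring.
  by rewrite sg2 c2; field.
rewrite mE -[2 * E]/(2 * E).
have -> : 2 * E = 2 * Num.sqrt E ^+ 2 by rewrite sqr_sqrtr// ltW.
set s := Num.sqrt E in s0 zE *.
(* The difference of the two expressions is a multiple of [z] minus the right side of [zE]. *)
apply/eqP; rewrite -subr_eq0; apply/eqP.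
transitivity (Num.sg (c * v) * c * 2 * s / z * (z - (X - 2 * d + 2 * d * (s * g E)))).
  by field; rewrite s0 d00 gt_eqF.
by rewrite -zE subrr mulr0.
Qed.

(** With the piston at rest, energy and flux are constant and the phase time grows at unit speed,
    which gives [F - f]. Motion of the piston adds only terms linear in [V]: the energy changes at
    rate [- V F], and the distance to the piston carries an extra [V]. Both are bounded by
    [|V| (1 + F)], uniformly in [d]. *)
Lemma corrector_derive : exists2 C, 0 < C &
  forall (d : R) (X x v : R -> R) (V t : R),
  0 < d <= d0 ->
  is_derive t (1 : R) X V -> is_derive t (1 : R) x (v t) ->
  is_derive t (1 : R) v ((derive1 (kd k d) (X t - x t) - derive1 (kd k d) (x t)) / m) ->
  r < X t < 1 -> El < particle_energy d (X t) (x t) (v t) < Eh ->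
  let F := - derive1 (kd k d) (X t - x t) in
  [/\ 0 <= F,
    is_derive t (1 : R) (fun s => particle_energy d (X s) (x s) (v s)) (- V * F),
    `|chi d (X t) (x t) (v t)| <= C &
    exists2 rho, `|rho| <= C * `|V| * (1 + F) &
      is_derive t (1 : R) (fun s => chi d (X s) (x s) (v s))
        (F - f d (X t) (particle_energy d (X t) (x t) (v t)) + rho)].
Proof.
have [Cf Cf0 CfP] := flux_bounds (wp_sq WP) (wp_g WP) El0 r0 Hiv d0r.
have CS0 := wp_C WP.
pose K := 2 * (c * CS).
have K0 : 0 < K by rewrite !mulr_gt0.
have m1 : 0 <= 2 * `|Eh| / m by rewrite !mulr_ge0// invr_ge0 ltW.
pose C := 2 * (Cf * K) + m * (1 + 2 * `|Eh| / m).
have CfK : 0 < Cf * K by rewrite mulr_gt0.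
have mm : 0 <= m * (1 + 2 * `|Eh| / m) by rewrite mulr_ge0 ?addr_ge0// ltW.
have C0 : 0 < C by rewrite /C; lra.
exists C; first exact: C0.
move=> d X x v V t hd Xd xd vd hX hE F.
have [dp dd0] := andP hd.
have d00 : d != 0 by rewrite gt_eqF.
pose E s := particle_energy d (X s) (x s) (v s).
have [rX X1] := andP hX; have [ElE EEh] := andP hE.
have hX' : r <= X t <= 1 by rewrite !ltW.
have hE' : El <= E t <= Eh by rewrite /E !ltW.
have hd' : 0 <= d <= d0 by rewrite ltW.
have F0 : 0 <= F.
  by rewrite /F kd_derive1// -mulNr divr_ge0 ?oppr_ge0 ?kappa1_le0// ltW.
have Xxd := dvB Xd xd.
have Ed : is_derive t (1 : R) E (- V * F).
  have D1 := @dv_comp _ (kd k d) x t _ _ (kd_derive (x t) d00) xd.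
  have D2 := @dv_comp _ (kd k d) (fun s => X s - x s) t _ _ (kd_derive (X t - x t) d00) Xxd.
  apply: dv_eq (dvD (dvMr 2^-1 (dvMl m (dvX2 vd))) (dvD D1 D2)) _.
  by rewrite /F -!kd_derive1//; field; rewrite gt_eqF.
have ke : kd k d (x t) <= E t /\ kd k d (X t - x t) <= E t.
  have h1 := kd_ge0 d (x t); have h2 := kd_ge0 d (X t - x t).
  have h3 : 0 <= m * v t ^+ 2 / 2 by rewrite mv2 sqr_ge0.
  by rewrite /E /particle_energy; split; lra.
(* A particle of energy below [k 0] can reach neither the wall nor, in the next step, the piston,
   where the potential would be [k 0]. *)
have x0 : 0 < x t.
  have : 0 < x t / d by apply: (kappa_lt hk); exact: le_lt_trans ke.1 (lt_trans EEh Ehk).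
  by rewrite pmulr_lgt0// invr_gt0.
have xX : 0 < X t - x t.
  have : 0 < (X t - x t) / d by apply: (kappa_lt hk); exact: le_lt_trans ke.2 (lt_trans EEh Ehk).
  by rewrite pmulr_lgt0// invr_gt0.
have vle : `|v t| <= 1 + 2 * `|Eh| / m.
  have h1 : 0 <= 2 * `|Eh| / m by [].
  have h2 : v t ^+ 2 <= 2 * `|Eh| / m.
    rewrite ler_pdivlMr//.
    have h1' := kd_ge0 d (x t); have h2' := kd_ge0 d (X t - x t).
    move: EEh; rewrite /particle_energy; have := ler_norm Eh.
    by move: h1' h2'; lra.
  rewrite -(@ler_pXn2r _ 2%N) ?nnegrE ?addr_ge0// real_normK ?num_real//.
  by apply: le_trans h2 _; nra.
have near_X : \forall s \near t, r < X s < 1.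
  have n1 := near_gt (dv_cont Xd) rX; have n2 := near_lt (dv_cont Xd) X1.
  by apply: filterS2 n1 n2 => s -> ->.
have near_E : \forall s \near t, El <= E s <= Eh.
  have n1 := near_gt (dv_cont Ed) ElE; have n2 := near_lt (dv_cont Ed) EEh.
  by apply: filterS2 n1 n2 => s /ltW-> /ltW->.
have [fC fdC] := CfP _ _ _ hd' hE' hX'.
have fd := flux_derive (wp_sq WP) (wp_g WP) Hiv d Xd Ed.
have f'_le : `|flux_der sq dsq g dg iv div d (X t) (E t) V (- V * F)| <= Cf * (`|V| * (1 + F)).
  apply: le_trans (fdC _ _) _; rewrite ler_pM2l// normrM normrN (ger0_norm F0).
  by rewrite mulrDr mulr1.
(* The factor [d] compensates the growth of the rescaled bound: [d (1 + u / d) = d + u <= 2], so [K]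
   is free of [d]. *)
have dle (a u : R) : 0 <= u <= 1 -> `|a| <= CS * (1 + `|u / d|) -> `|d * (c * a)| <= K.
  move=> /andP[u0 u1] ha; rewrite !normrM (gtr0_norm dp) (gtr0_norm c0).
  apply: (@le_trans _ _ (d * (c * (CS * (1 + `|u / d|))))).
    by rewrite !ler_pM2l.
  rewrite ger0_norm ?divr_ge0 ?(ltW dp)//.
  have -> : d * (c * (CS * (1 + u / d))) = c * CS * (d + u) by field.
  by rewrite /K [leRHS]mulrC ler_pM2l ?mulr_gt0//; move: d0_1 r1; lra.
have x01 : 0 <= x t <= 1 by rewrite ltW//=; lra.
have y01 : 0 <= X t - x t <= 1 by rewrite ltW//=; lra.
have dX s : r < X s -> d < X s / 2 by move: d0_1; lra.
have [xl|xl] := leP (x t) (X t / 2).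
  have xXd : d < X t - x t by have := dX _ rX; lra.
  have n1 : \forall s \near t, d < X s - x s := near_gt (dv_cont Xxd) xXd.
  have F00 : F = 0 by rewrite /F kd1_out ?oppr0// ltW.
  (* If [x = X / 2] at time [t], nearby times may use the other formula; there the particle is in
     free flight and both formulas agree. *)
  have nchi : \forall s \near t, chi_left d (X s) (x s) (v s) (E s) =
      chi d (X s) (x s) (v s).
    near=> s; rewrite /chi -/(E s); case: ifPn => //; rewrite -ltNge => xs.
    have hXs : r < X s < 1 by near: s.
    have [rXs Xs1] := andP hXs; have := dX _ rXs => dXs.
    have xds : d < X s - x s by near: s.
    apply: chi_overlap => //.
    - by rewrite !ltW.
    - by near: s.
    - by apply/andP; split; lra.
    - rewrite /E /particle_energy (kd_out dp (ltW xds)) kd_out ?addr0//.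
      by lra.
  have pd := dvMl c vd.
  have nE : \forall s \near t, E s = (c * v s) ^+ 2 + k (x s / d).
    apply: filterS n1 => s /ltW xs.
    by rewrite /E /particle_energy (kd_out dp xs) addr0 mv2.
  have [a [b [e [D al bl el abe]]]] := wp_derive WP Ed (dvMr d^-1 xd) pd nE hE'.
  have Et := nbhs_singleton nE.
  have Snle : `|d * (c * Sn (E t) (x t / d) (c * v t))| <= K.
    by apply: (dle _ (x t)) => //; exact: (wp_bound WP).
  split => //.
    rewrite -(nbhs_singleton nchi) /chi_left normrN normrM.
    apply: (@le_trans _ _ (Cf * K)); first exact: ler_pM.
    by rewrite /C; lra.
  exists (- (flux_der sq dsq g dg iv div d (X t) (E t) V (- V * F) *
      (d * (c * Sn (E t) (x t / d) (c * v t))))).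
    rewrite normrN normrM; apply: (@le_trans _ _ (Cf * (`|V| * (1 + F)) * K)).
      exact: ler_pM.
    have -> : Cf * (`|V| * (1 + F)) * K = (Cf * K) * (`|V| * (1 + F)) by ring.
    rewrite -[leRHS]mulrA; apply: ler_wpM2r; first by rewrite mulr_ge0// addr_ge0.
    by rewrite /C; lra.
  apply: dv_near nchi _.
  apply: dv_eq (dvN (dvM fd (dvMl d (dvMl c D)))) _.
  rewrite F00 mulr0 mulr0 add0r.
  rewrite kd_derive1// in vd *; move: abe.
  have -> : derive1 k ((X t - x t) / d) / d = 0 by rewrite -kd_derive1// kd1_out// ltW.
  rewrite kd_derive1//.
  move=> abe.
  (* This is the unit growth [abe] of the phase, translated back to physical time. *)
  have key : d * (c * (b * (v t * d^-1) + e * (c * ((0 - derive1 k (x t / d) / d) / m)))) = 1.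
    rewrite -abe.
    transitivity (b * (c * v t) - e * (c ^+ 2 * derive1 k (x t / d)) / m).
      by field; rewrite d00 gt_eqF.
    by rewrite c2; field; rewrite gt_eqF.
  rewrite key; ring.
have xdt : d < x t by have := dX _ rX; lra.
have n1 : \forall s \near t, d < x s := near_gt (dv_cont xd) xdt.
have nchi : \forall s \near t, chi_right d (X s) (x s) (v s) (E s) =
    chi d (X s) (x s) (v s).
  have n2 : \forall s \near t, 0 < x s - X s / 2.
    by apply: near_gt (dv_cont (dvB xd (dvMr 2^-1 Xd))) _; rewrite subr_gt0.
  apply: filterS n2 => s; rewrite subr_gt0 => xs.
  by rewrite /chi -/(E s) leNgt xs.
have pd := dvN (dvMl c vd).
have nE : \forall s \near t, E s = (- (c * v s)) ^+ 2 + k ((X s - x s) / d).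
  apply: filterS n1 => s /ltW xs.
  by rewrite /E /particle_energy (kd_out dp xs) add0r mv2 sqrrN.
have [a [b [e [D al bl el abe]]]] := wp_derive WP Ed (dvMr d^-1 Xxd) pd nE hE'.
have Et := nbhs_singleton nE.
have Snle : `|d * (c * Sn (E t) ((X t - x t) / d) (- (c * v t)))| <= K.
  by apply: (dle _ (X t - x t)) => //; exact: (wp_bound WP).
have ale : `|d * (c * a)| <= K by apply: (dle _ (X t - x t)).
have ble : `|c * b| <= K.
  rewrite normrM (gtr0_norm c0) /K mulrCA ler_pM2l//.
  by apply: le_trans bl _; rewrite ler_peMl ?ler1n// ltW.
have f0 := normr_ge0 (f d (X t) (E t)).
split => //.
  rewrite -(nbhs_singleton nchi) /chi_right.
  apply: le_trans (ler_normB _ _) _; rewrite normrN !normrM (gtr0_norm m0).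
  have h1 : m * `|v t| <= m * (1 + 2 * `|Eh| / m) by rewrite ler_pM2l.
  have h2 : `|f d (X t) (E t)| * `|d * (c * Sn (E t) ((X t - x t) / d) (- (c * v t)))| <= Cf * K.
    exact: ler_pM.
  rewrite !normrM in h2.
  by rewrite /C; move: CfK h1 h2; lra.
(* The error collects the change of the flux, the change of the phase with the energy, and the
   piston's own contribution to the rescaled distance. *)
exists (- (flux_der sq dsq g dg iv div d (X t) (E t) V (- V * F) *
      (d * (c * Sn (E t) ((X t - x t) / d) (- (c * v t)))))
   - f d (X t) (E t) * (d * (c * a) * (- V * F) + c * b * V)).
  apply: le_trans (ler_normB _ _) _; rewrite normrN.
  have h1 : `|flux_der sq dsq g dg iv div d (X t) (E t) V (- V * F) *
      (d * (c * Sn (E t) ((X t - x t) / d) (- (c * v t))))| <= Cf * (`|V| * (1 + F)) * K.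
    by rewrite normrM; apply: ler_pM.
  have h2 : `|f d (X t) (E t) * (d * (c * a) * (- V * F) + c * b * V)| <=
     Cf * (K * (`|V| * F) + K * `|V|).
    rewrite normrM; apply: ler_pM => //; apply: le_trans (ler_normD _ _) _.
    apply: lerD; last by rewrite normrM; apply: ler_wpM2r.
    rewrite normrM (normrM (- V)) normrN (ger0_norm F0).
    by apply: ler_wpM2r => //; rewrite mulr_ge0.
  apply: le_trans (lerD h1 h2) _.
  have -> : Cf * (`|V| * (1 + F)) * K + Cf * (K * (`|V| * F) + K * `|V|) =
     (2 * (Cf * K)) * (`|V| * (1 + F)) by ring.
  rewrite -[leRHS]mulrA; apply: ler_wpM2r; first by rewrite mulr_ge0// addr_ge0.
  by rewrite /C; lra.
apply: dv_near nchi _.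
apply: dv_eq (dvB (dvN (dvMl m vd)) (dvM fd (dvMl d (dvMl c D)))) _.
have kx0 : derive1 (kd k d) (x t) = 0 by rewrite kd1_out// ltW.
have Fk : derive1 (kd k d) (X t - x t) = - F by rewrite /F opprK.
have FE : F = - (derive1 k ((X t - x t) / d) / d) by rewrite /F kd_derive1.
rewrite kx0 Fk subr0.
have key : d * (c * (a * (- V * F) + b * ((V - v t) * d^-1) + e * - (c * (- F / m)))) =
   d * (c * a) * (- V * F) + c * b * V + 1.
  rewrite -[X in _ = _ + X]abe FE.
  transitivity (d * (c * a) * (- V * - (derive1 k ((X t - x t) / d) / d)) + c * b * V
     - b * (c * v t) - e * (c ^+ 2 * derive1 k ((X t - x t) / d)) / m).
    by field; rewrite d00 gt_eqF.
  by rewrite c2; field; rewrite d00 gt_eqF.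
rewrite key -/(E t); field; exact: lt0r_neq0.
Unshelve. all: by end_near. Qed.

End SoftCorrector.

(** * Calculus of C^1 maps on a normed space *)

Section C1Maps.
Context {R : realType} {U : normedModType R}.
Implicit Types (f g : U -> R).

Definition C1_fun f := (forall p, differentiable f p) /\
  forall v, continuous (fun q => 'D_v f q).

Lemma C1_ext f g : f =1 g -> C1_fun f -> C1_fun g.
Proof. by move=> /funext ->. Qed.

Lemma C1_linear f : linear f -> continuous f -> C1_fun f.
Proof.
move=> lf cf; pose L : {linear U -> R} := HB.pack f (GRing.isLinear.Build _ _ _ _ _ lf).
have df p : differentiable f p by apply: (@linear_differentiable _ _ _ L); exact: cf.
split=> // v; have -> : (fun q => 'D_v f q) = fun=> f v.
  apply/funext => q; rewrite deriveE//.
  by rewrite (@diff_lin _ _ _ L)//; exact: cf.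
by move=> q; exact: cvg_cst.
Qed.

Lemma C1_cst c : C1_fun (fun=> c).
Proof.
split=> [p|v]; first exact: differentiable_cst.
have -> : (fun q => 'D_v (fun=> c) q) = fun=> (0 : R).
  by apply/funext => q; exact: derive_cst.
by move=> q; exact: cvg_cst.
Qed.

Lemma C1_add f g : C1_fun f -> C1_fun g -> C1_fun (fun q => f q + g q).
Proof.
move=> [df cf] [dg cg]; split=> [p|v]; first exact: differentiableD.
have -> : (fun q => 'D_v (fun q => f q + g q) q) = fun q => 'D_v f q + 'D_v g q.
  by apply/funext => q; apply: deriveD; exact: diff_derivable.
by move=> q; apply: cvgD; [exact: cf|exact: cg].
Qed.

Lemma C1_mul f g : C1_fun f -> C1_fun g -> C1_fun (fun q => f q * g q).
Proof.
move=> [df cf] [dg cg]; split=> [p|v]; first exact: differentiableM.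
have -> : (fun q => 'D_v (fun q => f q * g q) q) =
    fun q => f q * 'D_v g q + g q * 'D_v f q.
  by apply/funext => q; apply: deriveM; exact: diff_derivable.
move=> q; apply: cvgD; apply: cvgM.
- exact/differentiable_continuous.
- exact: cg.
- exact/differentiable_continuous.
- exact: cf.
Qed.

Lemma C1_opp f : C1_fun f -> C1_fun (fun q => - f q).
Proof.
move=> hf; apply: C1_ext (C1_mul (C1_cst (-1)) hf) => q.
by rewrite mulN1r.
Qed.

Lemma C1_sub f g : C1_fun f -> C1_fun g -> C1_fun (fun q => f q - g q).
Proof. by move=> hf hg; exact: C1_add hf (C1_opp hg). Qed.

Lemma C1_sum (I : finType) (f : I -> U -> R) : (forall i, C1_fun (f i)) ->
  C1_fun (fun q => \sum_i f i q).
Proof.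
move=> hf; apply: (@C1_ext (fun q => \sum_(i <- enum I) f i q)).
  by move=> q; rewrite big_enum.
elim: (enum I) => [|i r IH].
  by apply: C1_ext (C1_cst 0) => q; rewrite big_nil.
by apply: C1_ext (C1_add (hf i) IH) => q; rewrite big_cons.
Qed.

Lemma C1_comp (F dF : R -> R) f : c1 F dF -> C1_fun f -> C1_fun (fun q => F (f q)).
Proof.
move=> [dF' cF] [df cf].
have DF x : differentiable F x by apply/derivable1_diffP; case: (dF' x).
split=> [p|v]; first exact: differentiable_comp.
have -> : (fun q => 'D_v (fun q => F (f q)) q) = fun q => dF (f q) * 'D_v f q.
  apply/funext => q; rewrite deriveE; last exact: differentiable_comp.
  rewrite (@diff_comp _ _ _ _ f F)// deriveE// /=.
  rewrite diff1E// /GRing.scale/= mulrC; congr (_ * _).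
  by case: (dF' (f q)) => _ <-; rewrite derive1E.
move=> q; apply: cvgM; last exact: cf.
apply: (@continuous_comp _ _ _ f dF); first exact/differentiable_continuous.
exact: cF.
Qed.

Lemma C1_row n (G : U -> 'rV[R]_n) : (forall i, C1_fun (fun q => G q ord0 i)) ->
  (forall p, differentiable G p) /\ forall v, continuous (fun q => 'D_v G q).
Proof.
move=> hG.
have dG p : differentiable G p.
  have -> : G = \sum_(i < n) (fun q => G q ord0 i *: (delta_mx 0 i : 'rV[R]_n)).
    by apply/funext => q; rewrite {1}(row_sum_delta (G q)) fct_sumE.
  by apply: differentiable_sum => i; apply: differentiableZl; case: (hG i).
split=> // v.
have -> : (fun q => 'D_v G q) =
    fun q => \sum_(i < n) 'D_v (fun q => G q ord0 i) q *: (delta_mx 0 i : 'rV[R]_n).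
  apply/funext => q; rewrite derive_mx; last exact: diff_derivable.
  rewrite [LHS]row_sum_delta; apply: eq_bigr => i _; by rewrite mxE.
elim: (index_enum 'I_n) => [|i r IH].
  rewrite (_ : (fun q => _) = fun=> 0); first by move=> q; exact: cvg_cst.
  by apply/funext => q; rewrite big_nil.
rewrite (_ : (fun q => _) = fun q => 'D_v (fun q => G q ord0 i) q *: (delta_mx 0 i : 'rV[R]_n) +
    \sum_(j <- r) 'D_v (fun q => G q ord0 j) q *: (delta_mx 0 j : 'rV[R]_n)).
  move=> q; apply: cvgD; last exact: IH.
  by apply: cvgZ; [case: (hG i) => _; exact|exact: cvg_cst].
by apply/funext => q; rewrite big_cons.
Qed.

End C1Maps.

(** * A Gronwall inequality with jumps and the averaging argument *)

Section Gronwall.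
Context {R : realType}.

(** The supremum of the times up to which [P] has held satisfies [P] by the closing hypothesis, and
    the right-hand hypothesis would move it further unless it is [t1]. *)
Lemma real_induction (t0 t1 : R) (P : R -> Prop) : t0 <= t1 -> P t0 ->
  (forall t, t0 <= t < t1 -> P t ->
    exists2 eta : R, 0 < eta & forall s, t < s < t + eta -> P s) ->
  (forall t, t0 < t <= t1 -> (forall s, t0 <= s < t -> P s) -> P t) ->
  P t1.
Proof.
move=> t01 P0 PR PL.
pose S := [set t | t0 <= t <= t1 /\ forall s, t0 <= s <= t -> P s].
have S0 : S t0.
  split; first by rewrite lexx.
  by move=> s; rewrite -eq_le => /eqP <-.
have Sub : has_sup S.
  split; first by exists t0.
  by exists t1 => t [/andP[]].
pose c := sup S.
have c0 : t0 <= c by apply: ub_le_sup => //; exact: Sub.2.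
have c1 : c <= t1 by apply: ge_sup; [exists t0|move=> t [/andP[]]].
have Pl s : t0 <= s < c -> P s.
  move=> /andP[s0 sc]; have [t [_ tP] st] := sup_adherent (ltac:(by rewrite subr_gt0) : 0 < c - s) Sub.
  apply: tP; rewrite s0/= ltW//; move: st; rewrite -/c; lra.
have Pc : P c.
  move: c0; rewrite le_eqVlt => /predU1P[<-//|c0]; apply: PL => //.
  by rewrite c0.
move: c1; rewrite le_eqVlt => /predU1P[<-//|c1].
have [|eta eta0 Pe] := PR c _ Pc; first by rewrite c0.
pose u := c + Num.min (eta / 2) (t1 - c).
have m0 : 0 < Num.min (eta / 2) (t1 - c) by rewrite lt_min divr_gt0// subr_gt0.
have m1 : Num.min (eta / 2) (t1 - c) <= eta / 2 by rewrite ge_min lexx.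
have m2 : Num.min (eta / 2) (t1 - c) <= t1 - c by rewrite ge_min lexx orbT.
have : u <= c.
  apply: ub_le_sup; first exact: Sub.2.
  split; first by rewrite /u; apply/andP; split; lra.
  move=> s /andP[s0 su]; have [sc|cs|->//] := ltgtP s c.
    by apply: Pl; rewrite s0.
  by apply: Pe; rewrite cs/=; move: su; rewrite /u; lra.
by rewrite /u; lra.
Qed.

Lemma dv_incr (f : R -> R) (t a z : R) : is_derive t (1 : R) f a -> 0 < z ->
  \forall s \near t, `|f s - f t - a * (s - t)| <= z * `|s - t|.
Proof.
move=> /is_derive1_caratheodory[h [he hc <-]] z0.
have /cvgrPdist_le/(_ _ z0) := hc.
apply: filterS => s hs; rewrite he -mulrBl normrM.
by apply: ler_wpM2r => //; rewrite distrC.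
Qed.

Let expR_ge1 (x : R) : 0 <= x -> 1 <= expR x.
Proof. by move=> x0; rewrite -expR0 ler_expR. Qed.

(** The increasing function [P] serves as a clock: it pays for the unbounded part of the derivatives
    and for the jumps, while [a] is an ordinary Gronwall rate. [Dh] and [Ph] agree with [D] and [P]
    on [[t, t + eta)] only, so that right-continuous functions are allowed. The slack [h0], in the
    constant and in the rate, absorbs first-order remainders in the passage to the right of [t]. *)
Lemma gronwall_jumps (I : finType) (D : I -> R -> R) (P : R -> R)
    (a b c0 t0 t1 h0 : R) : t0 <= t1 -> 0 <= a -> 0 <= b -> 0 < h0 ->
  (forall i, `|D i t0| <= c0) -> 0 <= c0 ->
  (forall t, t0 <= t < t1 -> exists (Dh : I -> R -> R) (Ph : R -> R) (dD : I -> R) (p : R),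
    [/\ exists2 eta, 0 < eta & forall s, t <= s < t + eta ->
          (forall i, D i s = Dh i s) /\ P s = Ph s,
        forall i, is_derive t (1 : R) (Dh i) (dD i), is_derive t (1 : R) Ph p, 0 < p &
        forall B, (forall i, `|D i t| <= B) -> forall i, `|dD i| <= a * B + b * p]) ->
  (forall t, t0 < t <= t1 -> exists (Dm : I -> R) (Pm : R),
    [/\ forall i, D i x @[x --> t^'-] --> Dm i, P x @[x --> t^'-] --> Pm, Pm <= P t &
        forall i, `|D i t - Dm i| <= b * (P t - Pm)]) ->
  P t0 <= P t1 /\ forall i, `|D i t1| <=
    (c0 + h0 + b * (P t1 - P t0)) * expR ((a + h0) * (t1 - t0)).
Proof.
move=> t01 a0 b0 h00 D0 c00 HR HL.
pose al := a + h0.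
have al0 : 0 < al by rewrite ltr_wpDl.
pose Q t := c0 + h0 + b * (P t - P t0).
apply: (@real_induction t0 t1 (fun t => P t0 <= P t /\
  forall i, `|D i t| <= Q t * expR (al * (t - t0)))) => //.
- split=> // i; rewrite /Q !subrr !mulr0 addr0 expR0 mulr1.
  by rewrite (le_trans (D0 i))// lerDl ltW.
- move=> t tt [Pt Dt]; have [Dh [Ph [dD [p [[eta eta0 germ] Dd Pd p0 dB]]]]] := HR t tt.
  pose B := Q t * expR (al * (t - t0)).
  have Qh : h0 <= Q t.
    by rewrite /Q addrAC lerDr addr_ge0// mulr_ge0// subr_ge0.
  have e1 : 1 <= expR (al * (t - t0)).
    by rewrite expR_ge1// mulr_ge0 ?(ltW al0)// subr_ge0; case/andP: tt.
  have Bh : h0 <= B by rewrite /B -[leLHS]mulr1 ler_pM ?ler01// ltW.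
  have dBt := dB B Dt.
  (* The bound [z <= p] keeps [P] from decreasing just after [t]; the bound [(b + 1) z <= h0 B],
     which uses [h0 <= B], lets the extra rate [h0] cover the remainders of both [D] and [P]. *)
  pose z := Num.min p (h0 ^+ 2 / (b + 1)).
  have b1 : 0 < b + 1 by rewrite ltr_wpDl.
  have z0 : 0 < z by rewrite lt_min p0 divr_gt0// exprn_gt0.
  have zp : z <= p by rewrite ge_min lexx.
  have zb : (b + 1) * z <= h0 * B.
    apply: (@le_trans _ _ (h0 ^+ 2)); last by rewrite expr2 ler_pM2l.
    by rewrite mulrC -ler_pdivlMr// ge_min lexx orbT.
  have nP := dv_incr Pd z0.
  have nD : \forall s \near t, forall i, `|Dh i s - Dh i t - dD i * (s - t)| <= z * `|s - t|.
    by apply: (@filter_forall _ _ (fun i s => `|Dh i s - Dh i t - dD i * (s - t)| <= z * `|s - t|) (nbhs t)) => i; exact: (dv_incr (Dd i) z0).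
  have /nbhs_ballP[e /= e0 He] : \forall s \near t,
    `|Ph s - Ph t - p * (s - t)| <= z * `|s - t| /\
    forall i, `|Dh i s - Dh i t - dD i * (s - t)| <= z * `|s - t|.
    by apply: filterS2 nP nD.
  exists (Num.min eta e); first by rewrite lt_min eta0.
  move=> s /andP[ts]; rewrite -ltrBlDl lt_min => /andP[s1 s2].
  have hs : 0 < s - t by rewrite subr_gt0.
  have [|nPs nDs] := He s; first by rewrite /= -ball_normE /= distrC gtr0_norm.
  rewrite (gtr0_norm hs) in nPs nDs.
  have [Det Pet] : (forall i, D i t = Dh i t) /\ P t = Ph t.
    by apply: germ; rewrite lexx ltrDl.
  have [Des Pes] : (forall i, D i s = Dh i s) /\ P s = Ph s.
    by apply: germ; rewrite ltW//=; move: s1; rewrite ltrBlDl.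
  have dP : (p - z) * (s - t) <= P s - P t.
    rewrite Pes Pet; move: nPs; rewrite ler_norml => /andP[+ _].
    by rewrite mulrBl; lra.
  have dP0 : 0 <= P s - P t by apply: le_trans dP; rewrite mulr_ge0 ?subr_ge0// ltW.
  split; first by move: dP0 Pt; lra.
  move=> i.
  have h1 : `|D i s| <= B + (a * B + b * p + z) * (s - t).
    have := nDs i; rewrite -Des -Det => h.
    have -> : D i s = D i t + dD i * (s - t) + (D i s - D i t - dD i * (s - t)) by ring.
    apply: le_trans (ler_normD _ _) _.
    have := ler_normD (D i t) (dD i * (s - t)).
    have : `|dD i * (s - t)| <= (a * B + b * p) * (s - t).
      by rewrite normrM (gtr0_norm hs); apply: ler_wpM2r; [exact: ltW|].
    have := Dt i; rewrite -/B mulrDl; move: h; lra.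
  apply: le_trans h1 _.
  have e2 : 1 + al * (s - t) <= expR (al * (s - t)) by exact: expR_ge1Dx.
  have Qs : Q s = Q t + b * (P s - P t) by rewrite /Q; ring.
  have -> : expR (al * (s - t0)) = expR (al * (t - t0)) * expR (al * (s - t)).
    by rewrite -expRD; congr expR; ring.
  have bdP : 0 <= b * (P s - P t) by rewrite mulr_ge0.
  have e3 : 1 <= expR (al * (s - t)) by rewrite expR_ge1// mulr_ge0// ltW.
  have h2 : B * (1 + al * (s - t)) + b * (P s - P t) <=
      Q s * (expR (al * (t - t0)) * expR (al * (s - t))).
    have -> : Q s * (expR (al * (t - t0)) * expR (al * (s - t))) = B * expR (al * (s - t)) +
        b * (P s - P t) * (expR (al * (t - t0)) * expR (al * (s - t))).
      by rewrite Qs /B; ring.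
    apply: lerD.
      by apply: ler_wpM2l => //; apply: le_trans Bh; exact: ltW.
    by rewrite ler_peMr// -[1]mulr1 ler_pM.
  apply: le_trans h2.
  have h3 : b * ((p - z) * (s - t)) <= b * (P s - P t) by exact: ler_wpM2l.
  have h4 : (b + 1) * z * (s - t) <= h0 * B * (s - t) by apply: ler_wpM2r => //; exact: ltW.
  rewrite -subr_ge0.
  have -> : B * (1 + al * (s - t)) + b * (P s - P t) - (B + (a * B + b * p + z) * (s - t))
     = (b * (P s - P t) - b * ((p - z) * (s - t))) + (h0 * B * (s - t) - (b + 1) * z * (s - t)).
    by rewrite /al; ring.
  by rewrite addr_ge0// subr_ge0.
move=> t tt H; have [Dm [Pm [Dc Pc PmP Dj]]] := HL t tt.
have near_l : \forall s \near t^'-, t0 <= s < t.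
  near=> s; apply/andP; split; last by near: s; exact: nbhs_left_lt.
  by near: s; apply: nbhs_left_ge; case/andP: tt.
have P0m : P t0 <= Pm.
  apply: (cvgr_to_ge Pc).
  by apply: filterS near_l => s /H[].
split; first exact: le_trans PmP.
move=> i.
have Dm_le : `|Dm i| <= (c0 + h0 + b * (Pm - P t0)) * expR (al * (t - t0)).
  apply: (ler_cvg_to (f := fun s => `|D i s|)
     (g := fun s => Q s * expR (al * (s - t0))) (a := t^'-)).
  - by apply: cvg_norm; exact: Dc.
  - apply: cvgM.
      apply: cvgD; first exact: cvg_cst.
      apply: cvgM; first exact: cvg_cst.
      by apply: cvgB; [exact: Pc|exact: cvg_cst].
    apply: (@cvg_at_left_filter _ _ (fun s => expR (al * (s - t0)))).
    apply: (@continuous_comp _ _ _ (fun s => al * (s - t0)) expR); last exact: continuous_expR.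
    apply: cvgM; first exact: cvg_cst.
    by apply: cvgB; [exact: cvg_id|exact: cvg_cst].
  - by apply: filterS near_l => s /H[_]; apply.
have -> : D i t = Dm i + (D i t - Dm i) by ring.
apply: le_trans (ler_normD _ _) _.
apply: le_trans (lerD Dm_le (Dj i)) _.
have e1 : 1 <= expR (al * (t - t0)).
  by rewrite expR_ge1// mulr_ge0 ?(ltW al0)// subr_ge0 ltW//; case/andP: tt.
have -> : Q t = (c0 + h0 + b * (Pm - P t0)) + b * (P t - Pm) by rewrite /Q; ring.
by rewrite [leRHS]mulrDl lerD2l ler_peMr// mulr_ge0// subr_ge0.
Unshelve. all: by end_near. Qed.

End Gronwall.

Lemma cvg_fsum {R : realType} (I : finType) (F : set_system R) {FF : Filter F}
    (f : I -> R -> R) (l : I -> R) : (forall i, f i x @[x --> F] --> l i) ->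
  (\sum_i f i x) @[x --> F] --> \sum_i l i.
Proof.
move=> fl; apply: cvg_big; first exact: add_continuous.
by move=> i _; exact: fl.
Qed.

(** Written out to show that it depends only on a priori bounds, not on [eps], [d] or the
    trajectory. Here [c1] bounds the corrections divided by [eps], [C'] is the linear slope in the
    clock, [a1] the Gronwall rate in slow time and [b1] the coefficient of the clock. *)
Definition averaging_K {R : realType} (n Wm fm Lf cm Cr Im T : R) : R :=
  let c1 := n * cm + Wm * cm in
  let C' := 2 * n * fm + 2 * n + 1 in
  let a1 := 1 + 2 * n * Lf + fm + 2 * Wm * Lf in
  let b1 := a1 * c1 + (Cr + Wm * Cr + cm + Im) in
  expR ((a1 + 1) * T) * (1 + (c1 + 1 + b1 * (4 * n * cm + C' * T))) + c1.

(** Ensures [eps <= 1] and [Cr * eps <= 1 / 2]. *)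
Definition averaging_eps {R : realType} (Cr : R) : R := Num.min 1 (1 / (2 * (Cr + 1))).

Section Averaging.
Context {R : realType} (J : finType).
Variables (sg : J -> R) (f : J -> R -> R -> R).
Hypothesis sg1 : forall j, `|sg j| <= 1.
Variables (Wm fm Lf cm Cr Im T : R).
Hypotheses (Wm0 : 0 <= Wm) (fm0 : 0 <= fm) (Lf0 : 0 <= Lf) (cm0 : 0 <= cm)
  (Cr0 : 0 <= Cr) (Im0 : 0 <= Im) (T0 : 0 <= T).

(* [rho] may be as large as the unbounded force [F], but only with the small factor [eps]. *)
Record smooth_at (eps t : R) (X W : R -> R) (E chi : J -> R -> R) (F rho : J -> R) : Prop := {
  sm_X : is_derive t (1 : R) X (eps * W t);
  sm_W : is_derive t (1 : R) W (eps * \sum_j sg j * F j);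
  sm_E : forall j, is_derive t (1 : R) (E j) (- (eps * sg j * W t * F j));
  sm_chi : forall j, is_derive t (1 : R) (chi j) (F j - f j (X t) (E j t) + rho j);
  sm_F : forall j, 0 <= F j;
  sm_rho : forall j, `|rho j| <= Cr * eps * (1 + F j) }.

(** Left limits and jumps at a collision with impulses [I]. The energy lost by a particle is exactly
    its impulse times the mean of the piston velocities before and after. At a time without
    collision all impulses are 0. *)
Record jump_at (eps t : R) (X W : R -> R) (E chi : J -> R -> R)
    (Xl Wl : R) (El cl I : J -> R) : Prop := {
  jp_X : X x @[x --> t^'-] --> Xl;
  jp_W : W x @[x --> t^'-] --> Wl;
  jp_E : forall j, E j x @[x --> t^'-] --> El j;
  jp_chi : forall j, chi j x @[x --> t^'-] --> cl j;
  jp_dX : X t = Xl;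
  jp_dW : W t = Wl + eps * \sum_j sg j * I j;
  jp_dE : forall j, E j t = El j - eps * sg j * I j * (Wl + W t) / 2;
  jp_dchi : forall j, chi j t = cl j + I j;
  jp_I : forall j, 0 <= I j <= Im;
  jp_cl : forall j, `|cl j| <= cm }.

(** Conditions on fluxes and on the averaged solution stop short of [t1], where the solutions may
    leave the domain; at [t1] only left limits are used, besides the bounds on [W] and [chi].
    Smoothness is required of functions that agree with the trajectory to the right of each time. *)
Record averaging_data (eps t0 t1 : R) (X W : R -> R) (E chi : J -> R -> R)
    (Xb Wb : R -> R) (Eb : J -> R -> R) : Prop := {
  av_W : forall t, t0 <= t <= t1 -> `|W t| <= Wm;
  av_chi : forall t j, t0 <= t <= t1 -> `|chi j t| <= cm;
  av_Wb : forall t, t0 <= t < t1 -> `|Wb t| <= Wm;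
  av_f : forall t j, t0 <= t < t1 -> `|f j (X t) (E j t)| <= fm;
  av_lip : forall t j, t0 <= t < t1 -> `|f j (X t) (E j t) - f j (Xb t) (Eb j t)| <=
    Lf * (`|X t - Xb t| + `|E j t - Eb j t|);
  av_Xb' : forall t, t0 <= t < t1 -> is_derive t (1 : R) Xb (eps * Wb t);
  av_Wb' : forall t, t0 <= t < t1 ->
    is_derive t (1 : R) Wb (eps * \sum_j sg j * f j (Xb t) (Eb j t));
  av_Eb' : forall t j, t0 <= t < t1 ->
    is_derive t (1 : R) (Eb j) (- (eps * sg j * Wb t * f j (Xb t) (Eb j t)));
  av_right : forall t, t0 <= t < t1 -> exists (Xh Wh : R -> R) (Eh ch : J -> R -> R)
    (F rho : J -> R), smooth_at eps t Xh Wh Eh ch F rho /\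
    exists2 eta, 0 < eta & forall s, t <= s < t + eta ->
      [/\ X s = Xh s, W s = Wh s, forall j, E j s = Eh j s & forall j, chi j s = ch j s];
  av_left : forall t, t0 < t <= t1 -> exists (Xl Wl : R) (El cl I : J -> R),
    jump_at eps t X W E chi Xl Wl El cl I;
  av_Xbl : forall t, t0 < t <= t1 -> Xb x @[x --> t^'-] --> Xb t;
  av_Wbl : forall t, t0 < t <= t1 -> Wb x @[x --> t^'-] --> Wb t;
  av_Ebl : forall t j, t0 < t <= t1 -> Eb j x @[x --> t^'-] --> Eb j t }.

Let n : R := #|J|%:R.
Let n0 : 0 <= n. Proof. exact: ler0n. Qed.

Let sum_le (F G : J -> R) : (forall j, `|F j| <= G j) -> `|\sum_j sg j * F j| <= \sum_j G j.
Proof.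
move=> FG; apply: le_trans (ler_norm_sum _ _ _) _; apply: ler_sum => j _.
by rewrite normrM -[leRHS]mul1r ler_pM.
Qed.

Let sum_cst (c : R) : \sum_(j : J) c = n * c.
Proof. by rewrite sumr_const -mulr_natl /n; congr (_%:R * _); exact: eq_card. Qed.

Let le_sum1 (F : J -> R) j : (forall j, 0 <= F j) -> F j <= \sum_j F j.
Proof. by move=> F0; rewrite (bigD1 j)//= lerDl sumr_ge0. Qed.

Let c1 := n * cm + Wm * cm.
Let C' := 2 * n * fm + 2 * n + 1.
Let a1 := 1 + 2 * n * Lf + fm + 2 * Wm * Lf.
Let b1 := a1 * c1 + (Cr + Wm * Cr + cm + Im).
Let K1 := c1 + 1 + b1 * (4 * n * cm + C' * T).

Let c10 : 0 <= c1. Proof. by rewrite addr_ge0// mulr_ge0. Qed.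
Let C'0 : 0 <= C'. Proof. by rewrite !addr_ge0// !mulr_ge0. Qed.
Let a10 : 0 <= a1. Proof. by rewrite !addr_ge0// !mulr_ge0. Qed.
Let b10 : 0 <= b1. Proof. by rewrite !addr_ge0// mulr_ge0. Qed.
Let K10 : 0 <= K1.
Proof. by rewrite addr_ge0 ?addr_ge0// mulr_ge0// addr_ge0// !mulr_ge0. Qed.

Section Bound.
Variables (eps t0 t1 : R) (X W : R -> R) (E chi : J -> R -> R)
    (Xb Wb : R -> R) (Eb : J -> R -> R).
Hypotheses (eps0 : 0 < eps) (eps1 : eps <= 1) (epsC : Cr * eps <= 1 / 2).
Hypothesis A : averaging_data eps t0 t1 X W E chi Xb Wb Eb.
Hypotheses (t00 : 0 <= t0) (t01 : t0 <= t1) (t1T : t1 <= T / eps).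

(* [None] stands for [X], [Some None] for [W], [Some (Some j)] for [E j]. *)
Let DD (i : option (option J)) : (R -> R) -> (R -> R) -> (J -> R -> R) -> (J -> R -> R)
    -> R -> R := fun X W E chi t =>
  match i with
  | None => X t - Xb t
  | Some None => W t - eps * (\sum_j sg j * chi j t) - Wb t
  | Some (Some j) => E j t + eps * sg j * (W t * chi j t) - Eb j t
  end.
(* The increasing clock dominating the impulse transferred to the piston. *)
Let PP (chi : J -> R -> R) t := 2 * (\sum_j chi j t) + C' * t.

Let sgchi_le (c : J -> R) : (forall j, `|c j| <= cm) -> `|\sum_j sg j * c j| <= n * cm.
Proof. by move=> h; rewrite -sum_cst; apply: sum_le. Qed.

(** Removing the corrections costs at most [eps * c1], since [W] and the correctors are bounded. *)
Let undo t B : t0 <= t <= t1 -> (forall i, `|DD i X W E chi t| <= B) ->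
  [/\ `|X t - Xb t| <= B, `|W t - Wb t| <= B + eps * c1 &
    forall j, `|E j t - Eb j t| <= B + eps * c1].
Proof.
move=> tt DB; split; first exact: (DB None).
  have := DB (Some None); rewrite /DD => h.
  have -> : W t - Wb t = (W t - eps * (\sum_j sg j * chi j t) - Wb t) +
     eps * (\sum_j sg j * chi j t) by ring.
  apply: le_trans (ler_normD _ _) _; apply: lerD => //.
  rewrite normrM (gtr0_norm eps0) ler_pM2l//.
  apply: (@le_trans _ _ (n * cm)); last by rewrite lerDl mulr_ge0.
  by apply: sgchi_le => j; exact: (av_chi A).
move=> j; have := DB (Some (Some j)); rewrite /DD => h.
have -> : E j t - Eb j t = (E j t + eps * sg j * (W t * chi j t) - Eb j t) +
  - (eps * (sg j * (W t * chi j t))) by ring.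
apply: le_trans (ler_normD _ _) _; apply: lerD => //.
rewrite normrN normrM (gtr0_norm eps0) ler_pM2l//.
apply: (@le_trans _ _ (Wm * cm)); last by rewrite lerDr mulr_ge0.
rewrite normrM -[leRHS]mul1r ler_pM//.
by rewrite normrM ler_pM// ?(av_W A)// ?(av_chi A).
Qed.

(** The unbounded [F] cancels at order [eps] against the derivative of the corrector. What remains
    is a difference of fluxes, which is Lipschitz, and terms of size [eps^2 (1 + F)]. The latter are
    paid by the slope [p] of the clock: as [|rho j| <= (1 + F j) / 2], the choice of [C'] gives
    [S + 1 <= p]. *)
Let smooth_bound t (F rho : J -> R) B :
  t0 <= t < t1 -> (forall j, 0 <= F j) -> (forall j, `|rho j| <= Cr * eps * (1 + F j)) ->
  (forall i, `|DD i X W E chi t| <= B) ->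
  let f0 j := f j (X t) (E j t) in let fb j := f j (Xb t) (Eb j t) in
  let p := 2 * (\sum_j (F j - f0 j + rho j)) + C' in
  0 < p /\ let q := eps * a1 * B + eps ^+ 2 * b1 * p in
  [/\ `|eps * W t - eps * Wb t| <= q,
    `|eps * (\sum_j sg j * F j) - eps * (\sum_j sg j * (F j - f0 j + rho j)) -
       eps * (\sum_j sg j * fb j)| <= q &
    forall j, `| - (eps * sg j * W t * F j) + eps * sg j *
        (W t * (F j - f0 j + rho j) + chi j t * (eps * \sum_j sg j * F j))
        - - (eps * sg j * Wb t * fb j)| <= q].
Proof.
move=> tt F0 rhoF DB f0 fb p.
have tt' : t0 <= t <= t1 by case/andP: tt => -> /ltW.
have [uX uW uE] := undo tt' DB.
pose S := \sum_j (1 + F j).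
have S0 : 0 <= S by apply: sumr_ge0 => j _; rewrite addr_ge0.
have B0 : 0 <= B by apply: le_trans (DB None).
pose B' := B + eps * c1.
have ec : 0 <= eps * c1 by rewrite mulr_ge0// ltW.
have B'0 : 0 <= B' by rewrite /B' addr_ge0.
have BB' : B <= B' by rewrite /B' lerDl.
have pS : S + 1 <= p.
  have : \sum_j ((1 + F j) / 2 - (fm + 1)) <= \sum_j (F j - f0 j + rho j).
    apply: ler_sum => j _.
    have h1 := av_f A j tt; rewrite -/(f0 j) in h1.
    have h2 : `|rho j| <= (1 + F j) / 2.
      apply: le_trans (rhoF j) _; rewrite mulrC ler_wpM2l ?addr_ge0//.
      by move: epsC; rewrite div1r.
    move: h1 h2; rewrite !ler_norml => /andP[_ h1] /andP[h2 _].
    by move: (F0 j) h1 h2; lra.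
  rewrite sumrB sum_cst -mulr_suml -/S /p /C'; lra.
have p1 : 1 <= p by move: pS S0; lra.
have Sp : S <= p by move: pS; lra.
have p0 : 0 < p by apply: lt_le_trans p1.
split => // q.
have df j : `|f0 j - fb j| <= Lf * (2 * B').
  apply: le_trans (av_lip A j tt) _; rewrite ler_wpM2l//.
  by have := uE j; rewrite -/B'; move: uX BB'; lra.
have Fj j : 0 <= 1 + F j <= S.
  by rewrite addr_ge0//=; apply: (@le_sum1 (fun j => 1 + F j)) => i; rewrite addr_ge0.
have e2 : 0 <= eps ^+ 2 by rewrite sqr_ge0.
have e2p : 0 <= eps ^+ 2 * p by rewrite mulr_ge0// ltW.
(* Common majorant of the three bounds. Replacing [B] by [B' = B + eps c1] costs [eps^2 a1 c1],
   which [1 <= p] moves into the clock term. *)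
have key : eps * a1 * B' + eps ^+ 2 * ((Cr + Wm * Cr + cm) * S) <= q.
  have h1 : (Cr + Wm * Cr + cm) * S <= (Cr + Wm * Cr + cm + Im) * p.
    by rewrite ler_pM ?addr_ge0 ?mulr_ge0// lerDl.
  have h2 : eps ^+ 2 * ((Cr + Wm * Cr + cm) * S) <= eps ^+ 2 * ((Cr + Wm * Cr + cm + Im) * p).
    exact: ler_wpM2l.
  have h3 : eps ^+ 2 * (a1 * c1) * 1 <= eps ^+ 2 * (a1 * c1) * p.
    by rewrite ler_wpM2l// mulr_ge0// mulr_ge0.
  have -> : q = eps * a1 * B + eps ^+ 2 * (a1 * c1) * p + eps ^+ 2 * ((Cr + Wm * Cr + cm + Im) * p).
    by rewrite /q /b1; ring.
  have -> : eps * a1 * B' = eps * a1 * B + eps ^+ 2 * (a1 * c1) * 1 by rewrite /B'; ring.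
  by apply: lerD; [rewrite lerD2l; exact: h3|exact: h2].
have eS0 : 0 <= eps ^+ 2 * ((Cr + Wm * Cr + cm) * S).
  by rewrite mulr_ge0// mulr_ge0// ?addr_ge0// mulr_ge0.
have nB : 0 <= eps * B' by rewrite mulr_ge0// ltW.
split.
- rewrite -mulrBr normrM (gtr0_norm eps0).
  apply: (@le_trans _ _ (eps * B')); first by rewrite ler_pM2l.
  apply: le_trans key.
  have : eps * B' * 1 <= eps * B' * a1.
    rewrite ler_wpM2l// /a1 -addrA -addrA lerDl.
    by rewrite !addr_ge0// !mulr_ge0.
  by move: eS0; lra.
- have -> : eps * (\sum_j sg j * F j) - eps * (\sum_j sg j * (F j - f0 j + rho j)) -
       eps * (\sum_j sg j * fb j) = eps * (\sum_j sg j * ((f0 j - fb j) - rho j)).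
    rewrite -!mulrBr -!sumrB; congr (_ * _); apply: eq_bigr => j _; ring.
  rewrite normrM (gtr0_norm eps0).
  have h : `|\sum_j sg j * (f0 j - fb j - rho j)| <= \sum_j (Lf * (2 * B') + Cr * eps * (1 + F j)).
    apply: sum_le => j; apply: le_trans (ler_normB _ _) _; exact: lerD.
  rewrite big_split /= sum_cst -mulr_sumr -/S in h.
  apply: le_trans (ler_wpM2l (ltW eps0) h) _; apply: le_trans key.
  have g1 : 0 <= eps * B' * (1 + fm + 2 * Wm * Lf).
    by rewrite mulr_ge0// !addr_ge0// !mulr_ge0.
  have g2 : 0 <= eps ^+ 2 * ((Wm * Cr + cm) * S).
    by rewrite mulr_ge0// mulr_ge0// addr_ge0// mulr_ge0.
  rewrite -subr_ge0.
  have -> : eps * a1 * B' + eps ^+ 2 * ((Cr + Wm * Cr + cm) * S) -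
     eps * (n * (Lf * (2 * B')) + Cr * eps * S) =
     eps * B' * (1 + fm + 2 * Wm * Lf) + eps ^+ 2 * ((Wm * Cr + cm) * S).
    by rewrite /a1; ring.
  exact: addr_ge0.
move=> j.
have -> : - (eps * sg j * W t * F j) + eps * sg j *
        (W t * (F j - f0 j + rho j) + chi j t * (eps * \sum_j sg j * F j))
        - - (eps * sg j * Wb t * fb j) =
   eps * (sg j * ((Wb t - W t) * f0 j + Wb t * (fb j - f0 j) + W t * rho j
     + eps * (chi j t * \sum_j sg j * F j))) by ring.
rewrite normrM (gtr0_norm eps0).
have sF : `|\sum_j sg j * F j| <= S.
  by apply: sum_le => i; rewrite ger0_norm// lerDr.
have h : `|sg j * ((Wb t - W t) * f0 j + Wb t * (fb j - f0 j) + W t * rho j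
     + eps * (chi j t * \sum_j sg j * F j))| <=
   B' * fm + Wm * (Lf * (2 * B')) + Wm * (Cr * eps * S) + eps * (cm * S).
  rewrite normrM -[leRHS]mul1r ler_pM//.
  apply: le_trans (ler_normD _ _) _; apply: lerD; last first.
    rewrite normrM (gtr0_norm eps0) ler_pM2l// normrM ler_pM//.
    exact: (av_chi A).
  apply: le_trans (ler_normD _ _) _; apply: lerD; last first.
    rewrite normrM ler_pM//; first exact: (av_W A).
    apply: le_trans (rhoF j) _; apply: ler_wpM2l; last by case/andP: (Fj j).
    by rewrite mulr_ge0// ltW.
  apply: le_trans (ler_normD _ _) _; apply: lerD.
    by rewrite normrM ler_pM// ?(av_f A)// distrC.
  by rewrite normrM ler_pM// ?(av_Wb A)// distrC.
apply: le_trans (ler_wpM2l (ltW eps0) h) _; apply: le_trans key.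
have g1 : 0 <= eps * B' * (1 + 2 * n * Lf) by rewrite mulr_ge0// addr_ge0// !mulr_ge0.
have g2 : 0 <= eps ^+ 2 * (Cr * S) by rewrite mulr_ge0// mulr_ge0.
rewrite -subr_ge0.
have -> : eps * a1 * B' + eps ^+ 2 * ((Cr + Wm * Cr + cm) * S) -
   eps * (B' * fm + Wm * (Lf * (2 * B')) + Wm * (Cr * eps * S) + eps * (cm * S)) =
   eps * B' * (1 + 2 * n * Lf) + eps ^+ 2 * (Cr * S) by rewrite /a1; ring.
exact: addr_ge0.
Qed.

(** Gronwall is applied to the corrected differences with rate [eps a1], clock coefficient
    [eps^2 b1], initial error [del + eps c1] and slack [eps]. *)
Lemma averaging_bound (del : R) : 0 <= del ->
  `|X t0 - Xb t0| <= del -> `|W t0 - Wb t0| <= del -> (forall j, `|E j t0 - Eb j t0| <= del) ->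
  let K := expR ((a1 + 1) * T) * (1 + K1) + c1 in
  [/\ `|X t1 - Xb t1| <= K * (del + eps), `|W t1 - Wb t1| <= K * (del + eps) &
    forall j, `|E j t1 - Eb j t1| <= K * (del + eps)].
Proof.
move=> del0 dX dW dE K.
have tt0 : t0 <= t0 <= t1 by rewrite lexx.
have tt1 : t0 <= t1 <= t1 by rewrite lexx andbT.
have e0 := ltW eps0.
have ec1 : 0 <= eps * c1 by rewrite mulr_ge0.
have D0 i : `|DD i X W E chi t0| <= del + eps * c1.
  case: i => [[j|]|] /=.
  - rewrite addrAC; apply: le_trans (ler_normD _ _) _; apply: lerD => //.
    rewrite -mulrA normrM (gtr0_norm eps0) ler_pM2l//.
    apply: (@le_trans _ _ (Wm * cm)); last by rewrite lerDr mulr_ge0.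
    rewrite normrM -[leRHS]mul1r ler_pM//.
    by rewrite normrM ler_pM// ?(av_W A)// ?(av_chi A).
  - rewrite addrAC; apply: le_trans (ler_normB _ _) _; apply: lerD => //.
    rewrite normrM (gtr0_norm eps0) ler_pM2l//.
    apply: (@le_trans _ _ (n * cm)); last by rewrite lerDl mulr_ge0.
    by apply: sgchi_le => j; exact: (av_chi A).
  - by apply: le_trans dX _; rewrite lerDl.
have a0 : 0 <= eps * a1 by rewrite mulr_ge0.
have b0 : 0 <= eps ^+ 2 * b1 by rewrite mulr_ge0// sqr_ge0.
have c00 : 0 <= del + eps * c1 by rewrite addr_ge0.
have [] := @gronwall_jumps R _ (fun i => DD i X W E chi) (PP chi) _ _ _ _ _ _
  t01 a0 b0 eps0 D0 c00.
- move=> t tt; have [Xh [Wh [Eh [ch [F [rho [sm [eta eta0 germ]]]]]]]] := av_right A tt.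
  have [eX eW eE ec] : [/\ X t = Xh t, W t = Wh t, forall j, E j t = Eh j t &
      forall j, chi j t = ch j t] by apply: germ; rewrite lexx ltrDl.
  exists (fun i => DD i Xh Wh Eh ch), (PP ch), (fun i => match i with
    | None => eps * W t - eps * Wb t
    | Some None => eps * (\sum_j sg j * F j) - eps * (\sum_j sg j * (F j - f j (X t) (E j t) + rho j)) -
       eps * (\sum_j sg j * f j (Xb t) (Eb j t))
    | Some (Some j) => - (eps * sg j * W t * F j) + eps * sg j *
        (W t * (F j - f j (X t) (E j t) + rho j) + chi j t * (eps * \sum_j sg j * F j))
        - - (eps * sg j * Wb t * f j (Xb t) (Eb j t)) end),
    (2 * (\sum_j (F j - f j (X t) (E j t) + rho j)) + C').
  have cd j : is_derive t (1 : R) (ch j) (F j - f j (X t) (E j t) + rho j).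
    by rewrite eX eE; exact: (sm_chi sm).
  split.
  + exists eta => // s /germ[gX gW gE gc]; split; last first.
      by rewrite /PP; under eq_bigr do rewrite gc.
    move=> [[j|]|] /=; rewrite ?gX ?gW ?gE ?gc//.
    by under eq_bigr do rewrite gc.
  + move=> [[j|]|] /=.
    * have Wd := sm_W sm; have Ed := sm_E sm j; rewrite -eW in Ed.
      apply: dv_eq (dvB (dvD Ed (dvMl (eps * sg j) (dvM Wd (cd j)))) (av_Eb' A j tt)) _.
      by rewrite -eW -ec.
    * apply: dv_eq (dvB (dvB (sm_W sm) (dvMl eps (dv_sum (fun j => dvMl (sg j) (cd j)))))
        (av_Wb' A tt)) _.
      by [].
    * by apply: dv_eq (dvB (sm_X sm) (av_Xb' A tt)) _; rewrite -eW.
  + apply: dv_eq (dvD (dvMl 2 (dv_sum cd)) (dvMl C' (dv_id t))) _.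
    by rewrite mulr1.
  (* Positivity of the clock slope is part of a statement about some bound [B]; the sum of the
     finitely many absolute values serves. *)
  + have [B HB] : exists B, forall i, `|DD i X W E chi t| <= B.
      exists (\sum_i `|DD i X W E chi t|) => i.
      by rewrite (bigD1 i)//= lerDl sumr_ge0.
    by have [] := smooth_bound tt (sm_F sm) (sm_rho sm) HB.
  + move=> B HB; have [_ [h1 h2 h3]] := smooth_bound tt (sm_F sm) (sm_rho sm) HB.
    by move=> [[j|]|]; [exact: h3|exact: h2|exact: h1].
- move=> t tt; have [Xl [Wl [El [cl [I jp]]]]] := av_left A tt.
  have tt' : t0 <= t <= t1 by case/andP: tt => /ltW -> ->.
  exists (fun i => match i with
    | None => Xl - Xb t
    | Some None => Wl - eps * (\sum_j sg j * cl j) - Wb t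
    | Some (Some j) => El j + eps * sg j * (Wl * cl j) - Eb j t end),
    (2 * (\sum_j cl j) + C' * t).
  have sumcvg (a : J -> R) : (fun x => \sum_j a j * chi j x) x @[x --> t^'-] -->
      \sum_j a j * cl j.
    apply: cvg_fsum => j; apply: cvgM; first exact: cvg_cst.
    exact: (jp_chi jp).
  have sI : 0 <= \sum_j I j by apply: sumr_ge0 => j _; case/andP: (jp_I jp j).
  have dP : PP chi t - (2 * (\sum_j cl j) + C' * t) = 2 * \sum_j I j.
    rewrite /PP; under eq_bigr do rewrite (jp_dchi jp).
    by rewrite big_split /=; ring.
  split.
  + move=> [[j|]|] /=.
    * apply: cvgB; last exact: (av_Ebl A).
      apply: cvgD; first exact: (jp_E jp).
      apply: cvgM; first exact: cvg_cst.
      by apply: cvgM; [exact: (jp_W jp)|exact: (jp_chi jp)].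
    * apply: cvgB; last exact: (av_Wbl A).
      apply: cvgB; first exact: (jp_W jp).
      by apply: cvgM; [exact: cvg_cst|exact: sumcvg].
    * by apply: cvgB; [exact: (jp_X jp)|exact: (av_Xbl A)].
  + apply: cvgD.
      apply: cvgM; first exact: cvg_cst.
      by apply: cvg_fsum => j; exact: (jp_chi jp).
    apply: cvgM; first exact: cvg_cst.
    by apply: cvg_at_left_filter; exact: cvg_id.
  + by rewrite -subr_ge0 dP mulr_ge0.
  rewrite dP => -[[j|]|] /=.
  (* The jump of the energy and that of its correction cancel at order [eps]; the rest carries the
     jump of [W], itself of order [eps]. In the two remaining cases the corrected quantity does not
     jump at all. *)
  + have -> : E j t + eps * sg j * (W t * chi j t) - Eb j t -
        (El j + eps * sg j * (Wl * cl j) - Eb j t) =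
        eps * (sg j * ((W t - Wl) * (I j / 2 + cl j))).
      by rewrite (jp_dE jp) (jp_dchi jp); field.
    rewrite (jp_dW jp) addrAC subrr add0r.
    rewrite normrM (gtr0_norm eps0).
    apply: (@le_trans _ _ (eps * (eps * (\sum_j I j) * (Im + cm)))).
      rewrite ler_pM2l// normrM -[leRHS]mul1r ler_pM//.
      rewrite normrM; apply: ler_pM => //.
        rewrite normrM (gtr0_norm eps0) ler_pM2l//.
        by apply: sum_le => i; rewrite ger0_norm//; case/andP: (jp_I jp i).
      apply: le_trans (ler_normD _ _) _; apply: lerD; last exact: (jp_cl jp).
      case/andP: (jp_I jp j) => i0 i1; rewrite ger0_norm ?divr_ge0//.
      by move: i0 i1; lra.
    have -> : eps * (eps * (\sum_j I j) * (Im + cm)) = eps ^+ 2 * ((Im + cm) * \sum_j I j) by ring.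
    rewrite -mulrA ler_wpM2l ?sqr_ge0// ler_pM//; first by rewrite addr_ge0.
      rewrite /b1; have h1 : 0 <= a1 * c1 by rewrite mulr_ge0.
      have h2 : 0 <= Wm * Cr by rewrite mulr_ge0.
      by move: Cr0 h1 h2; lra.
    by move: sI; lra.
  + have -> : W t - eps * (\sum_j sg j * chi j t) - Wb t -
       (Wl - eps * (\sum_j sg j * cl j) - Wb t) = 0.
      rewrite (jp_dW jp).
      have -> : \sum_j sg j * chi j t = (\sum_j sg j * cl j) + \sum_j sg j * I j.
        by rewrite -big_split /=; apply: eq_bigr => j _; rewrite (jp_dchi jp); ring.
      by ring.
    by rewrite normr0 !mulr_ge0.
  + have -> : X t - Xb t - (Xl - Xb t) = 0 by rewrite (jp_dX jp); ring.
    by rewrite normr0 !mulr_ge0.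
move=> P01 HD.
(* Bounded correctors leave only the linear part of the clock to grow, so it advances by
   [O(1 / eps)] whatever the forces were. *)
have PPb : PP chi t1 - PP chi t0 <= 4 * n * cm + C' * (T / eps).
  have s1 : `|\sum_j chi j t1| <= n * cm.
    rewrite -sum_cst; apply: le_trans (ler_norm_sum _ _ _) _; apply: ler_sum => j _.
    exact: (av_chi A).
  have s2 : `|\sum_j chi j t0| <= n * cm.
    rewrite -sum_cst; apply: le_trans (ler_norm_sum _ _ _) _; apply: ler_sum => j _.
    exact: (av_chi A).
  have s3 : C' * (t1 - t0) <= C' * (T / eps).
    by apply: ler_wpM2l => //; apply: le_trans t1T; rewrite gerBl.
  move: s1 s2; rewrite !ler_norml => /andP[_ s1] /andP[s2 _].
  by rewrite /PP; move: s1 s2 s3; lra.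
have HB i : `|DD i X W E chi t1| <= expR ((a1 + 1) * T) * ((1 + K1) * (del + eps)).
  apply: le_trans (HD i) _; rewrite mulrC ler_pM ?expR_ge0//.
  - rewrite addr_ge0// ?addr_ge0// mulr_ge0// subr_ge0//.
  - rewrite ler_expR.
    have -> : eps * a1 + eps = (a1 + 1) * eps by ring.
    rewrite -[X in X <= _]mulrA; apply: ler_wpM2l; first by rewrite addr_ge0.
    apply: (@le_trans _ _ (eps * (T / eps))).
      by rewrite ler_pM2l//; apply: le_trans t1T; rewrite gerBl.
    by rewrite mulrC divfK ?gt_eqF.
  have h1 : eps ^+ 2 * b1 * (PP chi t1 - PP chi t0) <= eps ^+ 2 * b1 * (4 * n * cm + C' * (T / eps)).
    exact: ler_wpM2l.
  have h2 : eps ^+ 2 * b1 * (4 * n * cm + C' * (T / eps)) =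
     eps * b1 * (eps * (4 * n * cm) + C' * T).
    by field; rewrite gt_eqF.
  have h3 : eps * b1 * (eps * (4 * n * cm) + C' * T) <= eps * b1 * (4 * n * cm + C' * T).
    apply: ler_wpM2l; first by rewrite mulr_ge0.
    by rewrite lerD2r ler_piMl// !mulr_ge0.
  rewrite h2 in h1.
  have h4 : 0 <= K1 * del by rewrite mulr_ge0.
  have -> : (1 + K1) * (del + eps) = del + K1 * del + eps + eps * c1 + eps +
     eps * b1 * (4 * n * cm + C' * T) by rewrite /K1; ring.
  by move: h1 h3 h4 e0; lra.
have [hX hW hE] := undo tt1 HB.
have le1 : expR ((a1 + 1) * T) * ((1 + K1) * (del + eps)) + eps * c1 <= K * (del + eps).
  have -> : K * (del + eps) = expR ((a1 + 1) * T) * ((1 + K1) * (del + eps)) + c1 * (del + eps).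
    by rewrite /K; ring.
  by rewrite lerD2l mulrC ler_wpM2l// lerDr.
split; last by move=> j; exact: le_trans (hE j) le1.
  by apply: le_trans hX _; apply: le_trans le1; rewrite lerDl.
exact: le_trans hW le1.
Qed.

End Bound.

Lemma averaging (eps t0 t1 : R) (X W : R -> R) (E chi : J -> R -> R)
    (Xb Wb : R -> R) (Eb : J -> R -> R) (del : R) :
  0 < eps <= averaging_eps Cr -> averaging_data eps t0 t1 X W E chi Xb Wb Eb ->
  0 <= t0 <= t1 -> t1 <= T / eps -> 0 <= del ->
  `|X t0 - Xb t0| <= del -> `|W t0 - Wb t0| <= del -> (forall j, `|E j t0 - Eb j t0| <= del) ->
  let K := averaging_K n Wm fm Lf cm Cr Im T in
  [/\ `|X t1 - Xb t1| <= K * (del + eps), `|W t1 - Wb t1| <= K * (del + eps) &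
    forall j, `|E j t1 - Eb j t1| <= K * (del + eps)].
Proof.
move=> /andP[eps0]; rewrite le_min => /andP[eps1 epsC].
move=> AD /andP[t00 t01] t1T del0 dX dW dE.
have Cr1 : 0 < Cr + 1 by rewrite ltr_wpDl.
apply: (averaging_bound eps0 eps1 _ AD) => //.
move: epsC; rewrite ler_pdivlMr ?mulr_gt0// => h.
have := mulr_ge0 Cr0 (ltW eps0); move: h (ltW eps0); lra.
Qed.

End Averaging.

Lemma averaging_K_gt0 {R : realType} (n Wm fm Lf cm Cr Im T : R) :
  0 <= n -> 0 <= Wm -> 0 <= fm -> 0 <= Lf -> 0 <= cm -> 0 <= Cr -> 0 <= Im -> 0 <= T ->
  0 < averaging_K n Wm fm Lf cm Cr Im T.
Proof.
move=> n0 W0 f0 L0 c0 C0 I0 T0; rewrite /averaging_K.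
rewrite ltr_wpDr ?addr_ge0 ?mulr_ge0// mulr_gt0 ?expR_gt0// ltr_wpDr//.
by rewrite !addr_ge0// !mulr_ge0// !addr_ge0// !mulr_ge0// !addr_ge0// !mulr_ge0.
Qed.

Lemma averaging_eps_gt0 {R : realType} (Cr : R) : 0 <= Cr -> 0 < averaging_eps Cr.
Proof.
by move=> C0; rewrite lt_min ltr01 divr_gt0// mulr_gt0// ltr_wpDl.
Qed.

(** * The averaged vector field *)

Section SlowComponents.
Context {R : realType} {n1 n2 : nat}.
Implicit Types (X W : R) (h : 'rV[R]_(2 + n1 + n2)).

Lemma slX_mkslow X W (E1 : 'I_n1 -> R) (E2 : 'I_n2 -> R) : slX (mkslow X W E1 E2) = X.
Proof. by rewrite /slX /mkslow !row_mxKl mxE. Qed.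

Lemma slW_mkslow X W (E1 : 'I_n1 -> R) (E2 : 'I_n2 -> R) : slW (mkslow X W E1 E2) = W.
Proof. by rewrite /slW /mkslow !row_mxKl mxE. Qed.

Lemma slE1_mkslow X W (E1 : 'I_n1 -> R) (E2 : 'I_n2 -> R) j : slE1 (mkslow X W E1 E2) j = E1 j.
Proof. by rewrite /slE1 /mkslow row_mxKl row_mxKr mxE. Qed.

Lemma slE2_mkslow X W (E1 : 'I_n1 -> R) (E2 : 'I_n2 -> R) j : slE2 (mkslow X W E1 E2) j = E2 j.
Proof. by rewrite /slE2 /mkslow row_mxKr mxE. Qed.

Lemma mkslow_eta h : mkslow (slX h) (slW h) (slE1 h) (slE2 h) = h.
Proof.
rewrite -[RHS](hsubmxK h) -[lsubmx h](hsubmxK (lsubmx h)) /mkslow; congr row_mx.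
  congr row_mx; apply/rowP => i; rewrite !mxE.
    rewrite /slX /slW !mxE; case: ifPn => [/eqP ->//|i0].
    by congr (h _ _); do 2! congr lshift; apply/val_inj => /=; move: i i0 => [[|[|[]]]].
  by rewrite /slE1 !mxE.
by apply/rowP => i; rewrite !mxE /slE2 !mxE.
Qed.

Lemma slow_coordinates_linear : [/\ linear (@slX R n1 n2), linear (@slW R n1 n2),
  forall j, linear (fun h => @slE1 R n1 n2 h j) & forall j, linear (fun h => @slE2 R n1 n2 h j)].
Proof. by split=> [a x y|a x y|j a x y|j a x y]; rewrite /slX /slW /slE1 /slE2 !mxE. Qed.

Lemma slow_coordinates_cont : [/\ continuous (@slX R n1 n2), continuous (@slW R n1 n2),
  forall j, continuous (fun h => @slE1 R n1 n2 h j) &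
  forall j, continuous (fun h => @slE2 R n1 n2 h j)].
Proof.
have c i : continuous (fun h => h ord0 i).
  by move=> h; exact: coord_continuous.
split=> [|  |j|j].
- by rewrite (_ : @slX R n1 n2 = fun h => h ord0 (lshift n2 (lshift n1 ord0)))//;
  apply/funext => h; rewrite /slX !mxE.
- by rewrite (_ : @slW R n1 n2 = fun h => h ord0 (lshift n2 (lshift n1 (@Ordinal 2 1 isT))))//;
  apply/funext => h; rewrite /slW !mxE.
- by rewrite (_ : (fun h => _) = fun h => h ord0 (lshift n2 (rshift 2 j)))//;
  apply/funext => h; rewrite /slE1 !mxE.
- by rewrite (_ : (fun h => _) = fun h => h ord0 (rshift (2 + n1) j))//;
  apply/funext => h; rewrite /slE2 !mxE.
Qed.

Lemma slow_norm_le h h' B : 0 <= B -> `|slX h - slX h'| <= B -> `|slW h - slW h'| <= B ->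
  (forall j, `|slE1 h j - slE1 h' j| <= B) -> (forall j, `|slE2 h j - slE2 h' j| <= B) ->
  `|h - h'| <= B.
Proof.
move=> B0 hX hW h1 h2; rewrite [leLHS]/Num.Def.normr/= mx_normrE.
apply: bigmax_le => // -[i j] _ /=; rewrite ord1 mxE [X in _ + X]mxE.
rewrite -(mkslow_eta h) -(mkslow_eta h') /mkslow.
case: (splitP j) => [j'|j'] jj.
  have -> : j = lshift n2 j' by exact: val_inj.
  rewrite !row_mxEl; case: (splitP j') => [j2|j2] jj2.
    have -> : j' = lshift n1 j2 by exact: val_inj.
    by rewrite !row_mxEl !mxE; case: ifP.
  have -> : j' = rshift 2 j2 by exact: val_inj.
  by rewrite !row_mxEr !mxE.
have -> : j = rshift (2 + n1) j' by exact: val_inj.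
by rewrite !row_mxEr !mxE.
Qed.

Lemma is_derive_linear_coord (l : 'rV[R]_(2 + n1 + n2) -> R) (h : R -> 'rV[R]_(2 + n1 + n2)) s dh :
  linear l -> continuous l -> is_derive s (1 : R) h dh ->
  is_derive s (1 : R) (fun x => l (h x)) (l dh).
Proof.
move=> ll lc [dh' <-].
pose L : {linear 'rV[R]_(2 + n1 + n2) -> R} := HB.pack l (GRing.isLinear.Build _ _ _ _ _ ll).
have dl p : differentiable l p by apply: (@linear_differentiable _ _ _ L); exact: lc.
have hd : differentiable h s by apply/derivable1_diffP.
apply: DeriveDef; first by apply: diff_derivable; exact: differentiable_comp.
rewrite deriveE; last exact: differentiable_comp.
rewrite (@diff_comp _ _ _ _ h l)// deriveE//= (@diff_lin _ _ _ L)//; exact: lc.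
Qed.

End SlowComponents.

Section AveragedField.
Context {R : realType} (n1 n2 : nat).
Variables (m1 : 'I_n1 -> R) (m2 : 'I_n2 -> R) (k : R -> R).
Hypotheses (m10 : forall j, 0 < m1 j) (m20 : forall j, 0 < m2 j).
Hypothesis hk : kappa_hyp k.
Variables (El Eh : R) (sq dsq g dg : R -> R) (Sn : R -> R -> R -> R) (CS : R).
Hypotheses (El0 : 0 < El) (Ehk : Eh < k 0).
Hypothesis WP : wall_phase k El Eh sq dsq g dg Sn CS.
Variables (r d0 : R) (iv div : R -> R).
Hypothesis r0 : 0 < r.
Hypothesis Hiv : c1 iv div.
Hypothesis ivE : forall y, r / 2 <= y <= 2 -> iv y = y^-1.
Hypothesis d0r : forall d E, 0 <= d <= d0 -> El <= E <= Eh ->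
  `|2 * d * gam sq g E| <= r / 2.
Hypothesis d0_1 : d0 <= r / 4.

Local Notation f := (flux sq g iv).

Lemma flux0 L E : 0 <= d0 -> El <= E <= Eh -> r <= L <= 1 -> f 0 L E = 2 * E / L.
Proof.
move=> d00 hE hL; rewrite (fluxE ivE d0r _ hE hL) ?lexx//.
by rewrite mulr0 mul0r subr0.
Qed.

Let hard_flux (m L E : R) : 0 < m -> 0 < E -> 0 < L ->
  Num.sqrt (8 * m * E) / (Num.sqrt (2 * m / E) * L) = 2 * E / L.
Proof.
move=> m0 E0 L0.
have -> : 8 * m * E = (2 * m / E) * (2 * E) ^+ 2 by field; rewrite gt_eqF.
rewrite sqrtrM ?divr_ge0 ?mulr_ge0 ?ltW// sqrtr_sqr ger0_norm ?mulr_ge0 ?ltW//.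
have s0 : Num.sqrt (2 * m / E) != 0 by rewrite gt_eqF// sqrtr_gt0 divr_gt0// mulr_gt0.
by field; rewrite s0 gt_eqF.
Qed.

Lemma flux1E X E d j : 0 <= d <= d0 -> El <= E <= Eh -> r <= X <= 1 ->
  Num.sqrt (8 * m1 j * E) / T1 m1 k X E d j = f d X E.
Proof.
move=> hd hE hX; have [dp dd0] := andP hd; have [rX X1] := andP hX.
have E0 : 0 < E by case/andP: hE => + _; exact: lt_le_trans.
have X0 : 0 < X by exact: lt_le_trans rX.
rewrite /T1; case: eqP => [d_0|/eqP d_0].
  by rewrite hard_flux// d_0 flux0// (le_trans dp).
have {}dp : 0 < d by rewrite lt_neqAle eq_sym d_0.
rewrite (fluxE ivE d0r hd hE hX).
have := @period_flux _ _ hk _ _ _ _ _ _ _ _ El0 Ehk WP (m1 j) d 0 X E (m10 j) dp _ hE.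
rewrite subr0 add0r => <-; last by move: d0_1 r0; lra.
by congr (_ / (2 * _)); congr Rintegral; apply/funext => s; rewrite subr0.
Qed.

Lemma flux2E X E d j : 0 <= d <= d0 -> El <= E <= Eh -> r <= 1 - X <= 1 ->
  Num.sqrt (8 * m2 j * E) / T2 m2 k X E d j = f d (1 - X) E.
Proof.
move=> hd hE hX; have [dp dd0] := andP hd; have [rX X1] := andP hX.
have E0 : 0 < E by case/andP: hE => + _; exact: lt_le_trans.
have X0 : 0 < 1 - X by exact: lt_le_trans rX.
rewrite /T2; case: eqP => [d_0|/eqP d_0].
  by rewrite hard_flux// d_0 flux0// (le_trans dp).
have {}dp : 0 < d by rewrite lt_neqAle eq_sym d_0.
rewrite (fluxE ivE d0r hd hE hX).
have := @period_flux _ _ hk _ _ _ _ _ _ _ _ El0 Ehk WP (m2 j) d X 1 E (m20 j) dp _ hE.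
by move=> <- //; move: d0_1 r0; lra.
Qed.

(** The averaged field with each quotient by a period replaced by the globally C^1 flux; it is
    defined on the whole space and does not distinguish the hard core from the soft core. *)
Definition Hbar_ext d (h : 'rV[R]_(2 + n1 + n2)) : 'rV[R]_(2 + n1 + n2) :=
  mkslow (slW h)
    (\sum_j f d (slX h) (slE1 h j) - \sum_j f d (1 - slX h) (slE2 h j))
    (fun j => - slW h * f d (slX h) (slE1 h j))
    (fun j => slW h * f d (1 - slX h) (slE2 h j)).

Lemma HbarE d (h : 'rV[R]_(2 + n1 + n2)) : 0 <= d <= d0 -> r <= slX h <= 1 - r ->
  (forall j, El <= slE1 h j <= Eh) -> (forall j, El <= slE2 h j <= Eh) ->
  Hbar m1 m2 k d h = Hbar_ext d h.
Proof.
move=> hd /andP[h1 h2] hE1 hE2; rewrite /Hbar /Hbar_ext /=.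
have e1 j : Num.sqrt (8 * m1 j * slE1 h j) / T1 m1 k (slX h) (slE1 h j) d j =
    f d (slX h) (slE1 h j).
  by apply: flux1E => //; rewrite h1/=; move: h2 r0; lra.
have e2 j : Num.sqrt (8 * m2 j * slE2 h j) / T2 m2 k (slX h) (slE2 h j) d j =
    f d (1 - slX h) (slE2 h j).
  by apply: flux2E => //; apply/andP; split; move: h1 h2 r0; lra.
congr mkslow.
- by congr (_ - _); apply: eq_bigr => j _.
- by apply/funext => j; rewrite e1.
- by apply/funext => j; rewrite e2.
Qed.

Lemma C1_Hbar_ext :
  (forall p, differentiable (fun p : R * 'rV[R]_(2 + n1 + n2) => Hbar_ext p.1 p.2) p) /\
  forall v, continuous (fun q =>
    'D_v (fun p : R * 'rV[R]_(2 + n1 + n2) => Hbar_ext p.1 p.2) q).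
Proof.
have [lX lW l1 l2] := @slow_coordinates_linear R n1 n2.
have [cX cW cE1 cE2] := @slow_coordinates_cont R n1 n2.
pose U : normedModType R := (R * 'rV[R]_(2 + n1 + n2))%type.
have cfst : C1_fun (fun p : U => p.1).
  by apply: C1_linear => // p; exact: cvg_fst.
have csnd (l : 'rV[R]_(2 + n1 + n2) -> R) : linear l -> continuous l ->
    C1_fun (fun p : U => l p.2).
  move=> ll lc; apply: C1_linear; first by move=> a x y /=; rewrite ll.
  by move=> p; apply: (@continuous_comp _ _ _ snd l); [exact: cvg_snd|exact: lc].
have cf (L E : U -> R) : C1_fun L -> C1_fun E -> C1_fun (fun p : U => f p.1 (L p) (E p)).
  move=> hL hE; rewrite /flux.
  apply: C1_mul; first exact: C1_mul (C1_cst 2) hE.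
  apply: (C1_comp Hiv); apply: C1_sub => //.
  apply: C1_mul; first exact: C1_mul (C1_cst 2) cfst.
  exact: (C1_comp (gam_c1 (wp_sq WP) (wp_g WP))).
have c1E j : C1_fun (fun p : U => f p.1 (slX p.2) (slE1 p.2 j)).
  by apply: cf; [exact: csnd|exact: (csnd (fun h => slE1 h j))].
have c2E j : C1_fun (fun p : U => f p.1 (1 - slX p.2) (slE2 p.2 j)).
  apply: cf; last exact: (csnd (fun h => slE2 h j)).
  by apply: C1_sub; [exact: C1_cst|exact: csnd].
have cWf : C1_fun (fun p : U => slW p.2) by exact: csnd.
apply: (@C1_row R U) => i; rewrite /Hbar_ext /mkslow.
case: (splitP i) => [i'|i'] ii.
  have -> : i = lshift n2 i' by exact: val_inj.
  under eq_fun do rewrite row_mxEl.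
  case: (splitP i') => [i2|i2] ii2.
    have -> : i' = lshift n1 i2 by exact: val_inj.
    under eq_fun do rewrite row_mxEl mxE.
    case: (i2 == ord0) => //.
    exact: C1_sub (C1_sum c1E) (C1_sum c2E).
  have -> : i' = rshift 2 i2 by exact: val_inj.
  under eq_fun do rewrite row_mxEr mxE.
  by apply: C1_mul => //; exact: C1_opp.
have -> : i = rshift (2 + n1) i' by exact: val_inj.
under eq_fun do rewrite row_mxEr mxE.
exact: C1_mul.
Qed.

End AveragedField.

(** * One-sided limits, slow coordinates and the averaged solution in fast time *)

Section OneSidedLimits.
Context {R : realType}.

Lemma within_one_sided (f : R -> R) (T : R) : 0 < T ->
  {within [set s : R | 0 <= s <= T], continuous f} ->
  f x @[x --> 0^'+] --> f 0 /\ f x @[x --> T^'-] --> f T.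
Proof.
move=> T0; have -> : [set s : R | 0 <= s <= T] = `[0, T]%classic.
  by apply/seteqP; split => s; rewrite /= in_itv.
by move=> /(continuous_within_itvP _ T0)[].
Qed.

Lemma cvg_right_scale (f : R -> R) (c l : R) : 0 < c ->
  f x @[x --> 0^'+] --> l -> f (c * x) @[x --> 0^'+] --> l.
Proof.
move=> c0 /cvg_at_rightP H; apply/cvg_at_rightP => u [u0 uc].
apply: (H (fun n => c * u n)); split; first by move=> n; rewrite mulr_gt0.
by rewrite -(mulr0 c); apply: cvgM => //; exact: cvg_cst.
Qed.

Lemma cvg_left_scale (f : R -> R) (c t l : R) : 0 < c ->
  f x @[x --> (c * t)^'-] --> l -> f (c * x) @[x --> t^'-] --> l.
Proof.
move=> c0 /cvg_at_leftP H; apply/cvg_at_leftP => u [u0 uc].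
apply: (H (fun n => c * u n)); split; first by move=> n; rewrite ltr_pM2l.
by apply: cvgM => //; exact: cvg_cst.
Qed.

(* Trajectories solve their equations only for positive times: averaging is run from
   [t0 > 0] and [t0] is sent to 0. *)
Lemma vanishing_initial_error (I : finType) (a : I -> R -> R) (t1 K eps : R) : 0 < t1 ->
  (forall i, a i x @[x --> 0^'+] --> (0 : R)) ->
  (forall t0 i, 0 < t0 < t1 -> `|a i t1| <= K * (\sum_l `|a l t0| + eps)) ->
  forall i, `|a i t1| <= K * eps.
Proof.
move=> t10 a0 H i.
have s0 : (\sum_l `|a l x|) @[x --> 0^'+] --> \sum_(l : I) (0 : R).
  apply: cvg_fsum => l.
  by have := cvg_norm (a0 l); rewrite normr0; apply.
rewrite big1// in s0.
have c : (K * (\sum_l `|a l x| + eps)) @[x --> 0^'+] --> K * (0 + eps).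
  apply: cvgM; first exact: cvg_cst.
  by apply: cvgD; [exact: s0|exact: cvg_cst].
rewrite add0r in c.
apply: (cvgr_to_ge c); near=> t; apply: H; apply/andP; split.
  by near: t; exact: nbhs_right_gt.
by near: t; exact: nbhs_right_lt.
Unshelve. all: by end_near. Qed.

End OneSidedLimits.

Section Coordinates.
Context {R : realType} (n1 n2 : nat).
Local Notation J := ('I_n1 + 'I_n2)%type.
Local Notation slowT := 'rV[R]_(2 + n1 + n2).

Definition side (j : J) : R := if j is inl _ then 1 else -1.

Definition slE (h : slowT) (j : J) : R :=
  match j with inl i => slE1 h i | inr i => slE2 h i end.

Definition slow_coord (i : option (option J)) (h : slowT) : R :=
  match i with None => slX h | Some None => slW h | Some (Some j) => slE h j end.

Lemma coord_linear i : linear (slow_coord i).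
Proof.
have [lX lW l1 l2] := @slow_coordinates_linear R n1 n2.
by case: i => [[[j|j]|]|] //=; [exact: l1|exact: l2].
Qed.

Lemma coord_cont i : continuous (slow_coord i).
Proof.
have [cX cW c1 c2] := @slow_coordinates_cont R n1 n2.
by case: i => [[[j|j]|]|] //=; [exact: c1|exact: c2].
Qed.

Lemma coord_norm_le h h' B : 0 <= B -> (forall i, `|slow_coord i h - slow_coord i h'| <= B) ->
  `|h - h'| <= B.
Proof.
move=> B0 H; apply: slow_norm_le => //; first exact: (H None).
- exact: (H (Some None)).
- by move=> j; exact: (H (Some (Some (inl j)))).
- by move=> j; exact: (H (Some (Some (inr j)))).
Qed.

Lemma side_le1 j : `|side j| <= 1.
Proof. by case: j => j /=; rewrite ?normrN normr1. Qed.

(** A box around the given compact set. The strict inequalities for position and energies persist at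
    nearby times, as differentiation of the correctors requires. *)
Definition in_domain (El Eh r W0 : R) (h : slowT) : Prop :=
  [/\ r < slX h < 1 - r, `|slW h| <= W0 & forall j, El < slE h j < Eh].

Lemma sum_side (F : J -> R) :
  \sum_j side j * F j = \sum_i F (inl i) - \sum_i F (inr i).
Proof.
rewrite big_sumType/= -sumrN; congr (_ + _); apply: eq_bigr => i _.
  by rewrite mul1r.
by rewrite mulN1r.
Qed.

Definition side_flux (sq g iv : R -> R) d (j : J) X E :=
  flux sq g iv d (if j is inl _ then X else 1 - X) E.

End Coordinates.

Section AveragedSolution.
Context {R : realType} (n1 n2 : nat).
Variables (m1 : 'I_n1 -> R) (m2 : 'I_n2 -> R) (k : R -> R).
Hypotheses (m10 : forall j, 0 < m1 j) (m20 : forall j, 0 < m2 j).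
Hypothesis hk : kappa_hyp k.
Variables (El Eh : R) (sq dsq g dg : R -> R) (Sn : R -> R -> R -> R) (CS : R).
Hypotheses (El0 : 0 < El) (Ehk : Eh < k 0).
Hypothesis WP : wall_phase k El Eh sq dsq g dg Sn CS.
Variables (r d0 : R) (iv div : R -> R).
Hypothesis r0 : 0 < r.
Hypothesis Hiv : c1 iv div.
Hypothesis ivE : forall y, r / 2 <= y <= 2 -> iv y = y^-1.
Hypothesis d0r : forall d E, 0 <= d <= d0 -> El <= E <= Eh ->
  `|2 * d * gam sq g E| <= r / 2.
Hypothesis d0_1 : d0 <= r / 4.
Variable W0 : R.

Local Notation J := ('I_n1 + 'I_n2)%type.
Local Notation dom := (in_domain El Eh r W0).
Local Notation ff := (side_flux sq g iv).

Lemma domain_side (h : 'rV[R]_(2 + n1 + n2)) (j : J) : dom h ->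
  El <= slE h j <= Eh /\ r <= (if j is inl _ then slX h else 1 - slX h) <= 1.
Proof.
move=> [/andP[x1 x2] _ /(_ j)/andP[e1 e2]]; split; first by rewrite !ltW.
by move: r0 => r00; case: j {e1 e2} => _; apply/andP; split; lra.
Qed.

Variables (d eps tau : R) (hb : R -> 'rV[R]_(2 + n1 + n2)).
Hypotheses (eps0 : 0 < eps) (tau0 : 0 < tau) (hd : 0 <= d <= d0).
Hypothesis sol : avg_sol m1 m2 k d hb tau.
Hypothesis domb : forall s, 0 <= s < tau -> dom (hb s).

Lemma slow_time t : 0 < t < tau / eps -> 0 < eps * t < tau.
Proof. by move=> /andP[t0 tt]; rewrite mulr_gt0//= mulrC -ltr_pdivlMr. Qed.

Lemma averaged_coord i t : 0 < t < tau / eps ->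
  is_derive t (1 : R) (fun x => slow_coord i (hb (eps * x)))
    (eps * slow_coord i (Hbar_ext sq g iv d (hb (eps * t)))).
Proof.
move=> /slow_time st; have [_ /(_ _ st) D] := sol.
have st' : 0 <= eps * t < tau by case/andP: st => /ltW -> ->.
have [/andP[x1 x2] _ eE] := domb st'.
rewrite (HbarE m10 m20 hk El0 Ehk WP r0 ivE d0r d0_1) // in D.
- have D' := is_derive_linear_coord (@coord_linear _ _ _ i) (@coord_cont _ _ _ i) D.
  apply: dv_eq (@dv_comp _ (fun s => slow_coord i (hb s)) (fun x => eps * x) t _ _ D'
    (dvMl eps (dv_id t))) _.
  by rewrite mulr1 mulrC.
- by rewrite !ltW.
- by move=> j; have /andP[e1 e2] := eE (inl j); rewrite !ltW.
- by move=> j; have /andP[e1 e2] := eE (inr j); rewrite !ltW.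
Qed.

Lemma averaged_right0 i : slow_coord i (hb (eps * x)) @[x --> 0^'+] --> slow_coord i (hb 0).
Proof.
apply: (@cvg_right_scale _ (fun s => slow_coord i (hb s))) => //.
have [c _] := sol.
have cc : {within [set s : R | 0 <= s <= tau], continuous (fun s => slow_coord i (hb s))}.
  move=> x; apply: (@continuous_comp _ _ _ (hb : subspace _ -> _)); first exact: c.
  exact: coord_cont.
by have [] := within_one_sided tau0 cc.
Qed.

(** Before the final time this is differentiability; at the final time it comes from continuity on
    the closed interval. *)
Lemma averaged_left i t : 0 < t <= tau / eps ->
  slow_coord i (hb (eps * x)) @[x --> t^'-] --> slow_coord i (hb (eps * t)).
Proof.
move=> /andP[t0]; rewrite le_eqVlt => /predU1P[->|tt]; last first.
  have D := @averaged_coord i t; apply: cvg_at_left_filter.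
  by apply: (dv_cont (D _)); rewrite t0.
apply: (@cvg_left_scale _ (fun s => slow_coord i (hb s))) => //.
have -> : eps * (tau / eps) = tau by rewrite mulrC divfK// gt_eqF.
have [c _] := sol.
have cc : {within [set s : R | 0 <= s <= tau], continuous (fun s => slow_coord i (hb s))}.
  move=> x; apply: (@continuous_comp _ _ _ (hb : subspace _ -> _)); first exact: c.
  exact: coord_cont.
by have [] := within_one_sided tau0 cc.
Qed.

Lemma averaged_derivatives t : 0 < t < tau / eps ->
  [/\ is_derive t (1 : R) (fun x => slX (hb (eps * x))) (eps * slW (hb (eps * t))),
    is_derive t (1 : R) (fun x => slW (hb (eps * x)))
      (eps * \sum_j side j * ff d j (slX (hb (eps * t))) (slE (hb (eps * t)) j)) &
    forall j, is_derive t (1 : R) (fun x => slE (hb (eps * x)) j)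
      (- (eps * side j * slW (hb (eps * t)) *
        ff d j (slX (hb (eps * t))) (slE (hb (eps * t)) j)))].
Proof.
move=> tt; split.
- by apply: dv_eq (@averaged_coord None t tt) _; rewrite /= slX_mkslow.
- by apply: dv_eq (@averaged_coord (Some None) t tt) _; rewrite /= slW_mkslow sum_side.
move=> [j|j].
  apply: dv_eq (@averaged_coord (Some (Some (inl j))) t tt) _.
  by rewrite /= slE1_mkslow /side_flux; ring.
apply: dv_eq (@averaged_coord (Some (Some (inr j))) t tt) _.
by rewrite /= slE2_mkslow /side_flux; ring.
Qed.

End AveragedSolution.

(** * Soft core trajectories *)

Section SidedState.
Context {R : realType} (n1 n2 : nat).
Variables (m1 : 'I_n1 -> R) (m2 : 'I_n2 -> R) (k : R -> R).
Local Notation J := ('I_n1 + 'I_n2)%type.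

(* The reflection x -> 1 - x turns a particle on the right of the piston into one on the left,
   with the piston at distance [sX] from its wall. *)
Definition mass (j : J) : R := match j with inl i => m1 i | inr i => m2 i end.
Definition sX (j : J) (z : pstate R n1 n2) : R := if j is inl _ then pX z else 1 - pX z.
Definition sx (j : J) (z : pstate R n1 n2) : R :=
  match j with inl i => px1 z i | inr i => 1 - px2 z i end.
Definition sv (j : J) (z : pstate R n1 n2) : R :=
  match j with inl i => pv1 z i | inr i => - pv2 z i end.

Lemma slX_slow d eps z : slX (slow m1 m2 k d eps z) = pX z.
Proof. exact: slX_mkslow. Qed.

Lemma slW_slow d eps z : slW (slow m1 m2 k d eps z) = pV z / eps.
Proof. exact: slW_mkslow. Qed.

Lemma slE_slow d eps z j : d != 0 ->
  slE (slow m1 m2 k d eps z) j = particle_energy k (mass j) d (sX j z) (sx j z) (sv j z).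
Proof.
move=> /negPf d0; case: j => j /=; rewrite ?slE1_mkslow ?slE2_mkslow d0 /particle_energy//.
by rewrite sqrrN addrC [RHS]addrC [X in X + _]addrC; congr (kd _ _ _ + kd _ _ _ + _); ring.
Qed.

Lemma slE_slow0 eps z j : slE (slow m1 m2 k 0 eps z) j = mass j * sv j z ^+ 2 / 2.
Proof. by case: j => j /=; rewrite ?slE1_mkslow ?slE2_mkslow eqxx addr0// sqrrN. Qed.

Lemma coord_slow_cvg (d eps : R) (z : R -> pstate R n1 n2) (w : pstate R n1 n2)
    (F : set_system R) {FF : Filter F} i : continuous k ->
  pX (z x) @[x --> F] --> pX w -> pV (z x) @[x --> F] --> pV w ->
  (forall j, px1 (z x) j @[x --> F] --> px1 w j) ->
  (forall j, pv1 (z x) j @[x --> F] --> pv1 w j) ->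
  (forall j, px2 (z x) j @[x --> F] --> px2 w j) ->
  (forall j, pv2 (z x) j @[x --> F] --> pv2 w j) ->
  slow_coord i (slow m1 m2 k d eps (z x)) @[x --> F] --> slow_coord i (slow m1 m2 k d eps w).
Proof.
move=> kc cX cV cx1 cv1 cx2 cv2.
have kdc (f : R -> R) (l : R) : f x @[x --> F] --> l -> kd k d (f x) @[x --> F] --> kd k d l.
  move=> fl; rewrite /kd; apply: (cvg_comp (fun x => f x / d) k); last exact: kc.
  by apply: cvgM => //; exact: cvg_cst.
have kin (m : R) (f : R -> R) (l : R) : f x @[x --> F] --> l ->
    m * f x ^+ 2 / 2 @[x --> F] --> m * l ^+ 2 / 2.
  move=> fl; apply: cvgM; last exact: cvg_cst.
  apply: cvgM; first exact: cvg_cst.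
  by rewrite (_ : (fun x => _) = (fun x => f x * f x)) ?expr2; [exact: cvgM|];
    apply/funext => x; rewrite expr2.
case: i => [[[j|j]|]|] /=; rewrite ?slX_slow ?slW_slow ?slE1_mkslow ?slE2_mkslow.
- rewrite (_ : (fun x => _) = (fun x => m1 j * pv1 (z x) j ^+ 2 / 2 + (if d == 0 then 0 else
      kd k d (px1 (z x) j) + kd k d (pX (z x) - px1 (z x) j)))); last first.
    by apply/funext => x; rewrite slE1_mkslow.
  apply: cvgD; first exact: kin.
  case: ifP => _; first exact: cvg_cst.
  by apply: cvgD; apply: kdc => //; exact: cvgB.
- rewrite (_ : (fun x => _) = (fun x => m2 j * pv2 (z x) j ^+ 2 / 2 + (if d == 0 then 0 else
      kd k d (px2 (z x) j - pX (z x)) + kd k d (1 - px2 (z x) j)))); last first.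
    by apply/funext => x; rewrite slE2_mkslow.
  apply: cvgD; first exact: kin.
  case: ifP => _; first exact: cvg_cst.
  by apply: cvgD; apply: kdc; apply: cvgB => //; exact: cvg_cst.
- rewrite (_ : (fun x => _) = (fun x => pV (z x) / eps)).
    by apply: cvgM => //; exact: cvg_cst.
  by apply/funext => x; rewrite slW_slow.
- by rewrite (_ : (fun x => _) = (fun x => pX (z x)))//; apply/funext => x; rewrite slX_slow.
Qed.

Lemma soft_traj_sided d eps z tm t : soft_traj m1 m2 k d eps z tm -> 0 < t < tm ->
  let F j := - derive1 (kd k d) (sX j (z t) - sx j (z t)) in
  [/\ is_derive t (1 : R) (fun s => pX (z s)) (pV (z t)),
    is_derive t (1 : R) (fun s => pV (z s)) (eps ^+ 2 * \sum_j side j * F j),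
    forall j, is_derive t (1 : R) (fun s => sX j (z s)) (side j * pV (z t)),
    forall j, is_derive t (1 : R) (fun s => sx j (z s)) (sv j (z t)) &
    forall j, is_derive t (1 : R) (fun s => sv j (z s))
      ((derive1 (kd k d) (sX j (z t) - sx j (z t)) - derive1 (kd k d) (sx j (z t))) / mass j)].
Proof.
move=> [_ [_ [_ [_ [_ [_ H]]]]]] /H[X' [V' [x1' [v1' [x2' v2']]]]] F.
have e j : 1 - pX (z t) - (1 - px2 (z t) j) = px2 (z t) j - pX (z t) by ring.
split=> //.
- apply: dv_eq V' _; congr (_ * _); rewrite sum_side /F /=.
  rewrite sumrN; congr (_ + _); rewrite sumrN opprK; apply: eq_bigr => j _.
  by rewrite e.
- case=> j; first by apply: dv_eq X' _; rewrite mul1r.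
  by apply: dv_eq (dvB (dv_cst 1 t) X') _ => /=; ring.
- case=> j; first exact: x1'.
  by apply: dv_eq (dvB (dv_cst 1 t) (x2' j)) _ => /=; ring.
case=> j; first exact: v1'.
apply: dv_eq (dvN (v2' j)) _; rewrite /= e.
by rewrite -mulNr opprB.
Qed.

End SidedState.

Section Soft.
Context {R : realType} (n1 n2 : nat).
Variables (m1 : 'I_n1 -> R) (m2 : 'I_n2 -> R) (k : R -> R).
Hypotheses (m10 : forall j, 0 < m1 j) (m20 : forall j, 0 < m2 j).
Hypothesis hk : kappa_hyp k.
Variables (El Eh : R) (sq dsq g dg : R -> R) (Sn : R -> R -> R -> R) (CS : R).
Hypotheses (El0 : 0 < El) (Ehk : Eh < k 0).
Hypothesis WP : wall_phase k El Eh sq dsq g dg Sn CS.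
Variables (r d0 : R) (iv div : R -> R).
Hypotheses (r0 : 0 < r) (r1 : r <= 1).
Hypothesis Hiv : c1 iv div.
Hypothesis ivE : forall y, r / 2 <= y <= 2 -> iv y = y^-1.
Hypothesis d0r : forall d E, 0 <= d <= d0 -> El <= E <= Eh ->
  `|2 * d * gam sq g E| <= r / 2.
Hypothesis d0_1 : d0 <= r / 4.
Variable W0 : R.
Hypothesis W00 : 0 <= W0.

Local Notation J := ('I_n1 + 'I_n2)%type.
Local Notation dom := (in_domain El Eh r W0).
Local Notation ff := (side_flux sq g iv).
Local Notation ms := (mass m1 m2).
Local Notation chiS := (chi k sq g Sn iv).

Let ms0 j : 0 < ms j. Proof. by case: j. Qed.

(** The constant of a single particle depends on its mass; a sum over the finitely many particles
    serves all of them. *)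
Lemma soft_corrector_uniform : exists2 C, 0 < C &
  forall (j : J) (d : R) (X x v : R -> R) (V t : R),
  0 < d <= d0 ->
  is_derive t (1 : R) X V -> is_derive t (1 : R) x (v t) ->
  is_derive t (1 : R) v ((derive1 (kd k d) (X t - x t) - derive1 (kd k d) (x t)) / ms j) ->
  r < X t < 1 -> El < particle_energy k (ms j) d (X t) (x t) (v t) < Eh ->
  let F := - derive1 (kd k d) (X t - x t) in
  [/\ 0 <= F,
    is_derive t (1 : R) (fun s => particle_energy k (ms j) d (X s) (x s) (v s)) (- V * F),
    `|chiS (ms j) d (X t) (x t) (v t)| <= C &
    exists2 rho, `|rho| <= C * `|V| * (1 + F) &
      is_derive t (1 : R) (fun s => chiS (ms j) d (X s) (x s) (v s))
        (F - flux sq g iv d (X t) (particle_energy k (ms j) d (X t) (x t) (v t)) + rho)].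
Proof.
have H j := corrector_derive hk El0 Ehk WP r0 r1 Hiv ivE d0r d0_1 (ms0 j).
pose c j := projT1 (cid2 (H j)).
have c0 j : 0 < c j by rewrite /c; case: (cid2 _).
have cle j : c j <= 1 + \sum_i c i.
  by rewrite (bigD1 j)//= addrCA lerDl addr_ge0// sumr_ge0// => i _; exact: ltW.
exists (1 + \sum_i c i); first by rewrite ltr_pwDl// sumr_ge0// => i _; exact: ltW.
move=> j d X x v V t hd X' x' v' hX hE F.
have : projT1 (cid2 (H j)) = c j by [].
case: (cid2 (H j)) => /= C _ CP cj.
have [F0 E' chi_le [rho rho_le chi']] := CP d X x v V t hd X' x' v' hX hE.
split=> //; first by apply: le_trans chi_le _; rewrite cj.
exists rho => //; apply: le_trans rho_le _.
rewrite -!mulrA; apply: ler_wpM2r; last by rewrite cj.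
by rewrite mulr_ge0// addr_ge0.
Qed.

Lemma flux_constants : exists fm Lf, [/\ 0 <= fm, 0 <= Lf &
  forall d (h h' : 'rV[R]_(2 + n1 + n2)) (j : J), 0 <= d <= d0 -> dom h -> dom h' ->
  `|ff d j (slX h) (slE h j)| <= fm /\
  `|ff d j (slX h) (slE h j) - ff d j (slX h') (slE h' j)| <=
    Lf * (`|slX h - slX h'| + `|slE h j - slE h' j|)].
Proof.
have [C1 C10 C1P] := flux_bounds (wp_sq WP) (wp_g WP) El0 r0 Hiv d0r.
have [C2 C20 C2P] := flux_lipschitz (wp_sq WP) (wp_g WP) El0 r0 Hiv d0r.
exists C1, C2; split; [exact: ltW|exact: ltW|] => d h h' j hd hh hh'.
have [e x] := domain_side r0 j hh; have [e' x'] := domain_side r0 j hh'.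
split; first exact: (C1P _ _ _ hd e x).1.
apply: le_trans (C2P _ _ _ _ _ hd e' x' e x) _.
rewrite ler_pM2l// lerD2r; case: (j) => // _.
by rewrite (_ : 1 - slX h - (1 - slX h') = - (slX h - slX h')) ?normrN//; ring.
Qed.

(** Averaging is applied on [[t0, t1]] strictly inside the time interval, with all impulses 0.
    Continuity of the trajectory and of the averaged solution then allows [t0] to tend to 0 and [t1]
    to the final time. *)
Lemma soft_estimate (T : R) : 0 < T -> exists K eps0, [/\ 0 < K, 0 < eps0 &
  forall (eps d : R) (z : R -> pstate R n1 n2) (hb : R -> 'rV[R]_(2 + n1 + n2)) (tau : R),
  0 < eps <= eps0 -> 0 < d <= d0 -> 0 < tau <= T ->
  soft_traj m1 m2 k d eps z (tau / eps) -> avg_sol m1 m2 k d hb tau ->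
  hb 0 = slow m1 m2 k d eps (z 0) ->
  (forall s, 0 <= s < tau -> dom (hb s) /\ dom (slow m1 m2 k d eps (z (s / eps)))) ->
  `|slow m1 m2 k d eps (z (tau / eps)) - hb tau| <= K * eps].
Proof.
move=> T0; have [C C0 CP] := soft_corrector_uniform.
have [fm [Lf [fm0 Lf0 fP]]] := flux_constants.
pose n : R := #|{: J}|%:R.
(* The factor [C * W0] arises because the corrector error is [C |V| (1 + F)] and [|V| <= eps * W0];
   the 0 is the bound on impulses. *)
pose K := averaging_K n W0 fm Lf C (C * W0) 0 T.
have CW0 : 0 <= C * W0 by rewrite mulr_ge0// ltW.
have K0 : 0 < K by rewrite averaging_K_gt0// ltW.
exists K, (averaging_eps (C * W0)); split => //; first exact: averaging_eps_gt0.
move=> eps d z hb tau heps hd /andP[tau0 tauT] tr sol init dm.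
have [eps0 epsle] := andP heps.
have [dp dd0] := andP hd; have hd' : 0 <= d <= d0 by rewrite (ltW dp).
have d_0 : d != 0 by rewrite gt_eqF.
pose tm := tau / eps.
have tm0 : 0 < tm by rewrite divr_gt0.
have domb s : 0 <= s < tau -> dom (hb s) by move=> /dm[].
have domz t : 0 <= t < tm -> dom (slow m1 m2 k d eps (z t)).
  move=> /andP[t0 tt]; have [|_] := dm (eps * t).
    by rewrite mulr_ge0 ?(ltW eps0)//= mulrC -ltr_pdivlMr.
  by rewrite mulrC mulKf ?gt_eqF// mulrC mulfK ?gt_eqF.
have domb' t : 0 <= t < tm -> dom (hb (eps * t)).
  move=> /andP[t0 tt]; apply: domb.
  by rewrite mulr_ge0 ?(ltW eps0)//= mulrC -ltr_pdivlMr.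
pose a (i : option (option J)) t := slow_coord i (slow m1 m2 k d eps (z t)) - slow_coord i (hb (eps * t)).
pose h t := slow m1 m2 k d eps (z t).
have soft_facts t (tt : 0 < t < tm) (j : J) :
  let F := - derive1 (kd k d) (sX j (z t) - sx j (z t)) in
  [/\ 0 <= F,
    is_derive t (1 : R) (fun s => slE (h s) j) (- (eps * side j * slW (h t) * F)),
    `|chiS (ms j) d (sX j (z t)) (sx j (z t)) (sv j (z t))| <= C &
    exists2 rho, `|rho| <= C * W0 * eps * (1 + F) &
      is_derive t (1 : R) (fun s => chiS (ms j) d (sX j (z s)) (sx j (z s)) (sv j (z s)))
        (F - ff d j (slX (h t)) (slE (h t) j) + rho)].
  have [X' V' sX' sx' sv'] := soft_traj_sided tr tt.
  have tt' : 0 <= t < tm by case/andP: tt => /ltW -> ->.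
  have [hX hW hE] := domz t tt'.
  have hXj : r < sX j (z t) < 1.
    move: hX; rewrite slX_slow => /andP[x1 x2]; rewrite /sX.
    by move: r0 => r00; case: (j) => _; apply/andP; split; lra.
  have hEj := hE j; rewrite slE_slow// in hEj.
  have [F0 E' chi_le [rho rho_le chi']] := CP j d (fun s => sX j (z s)) (fun s => sx j (z s))
     (fun s => sv j (z s)) _ t hd (sX' j) (sx' j) (sv' j) hXj hEj.
  have Ve : pV (z t) = eps * slW (h t) by rewrite slW_slow mulrC divfK ?gt_eqF.
  split=> //.
    rewrite (_ : (fun s => _) = fun s => particle_energy k (ms j) d (sX j (z s)) (sx j (z s)) (sv j (z s))).
      by apply: dv_eq E' _; rewrite Ve; ring.
    by apply/funext => s; rewrite slE_slow.
  exists rho.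
    apply: le_trans rho_le _; apply: ler_wpM2r; first by rewrite addr_ge0.
    rewrite -mulrA ler_pM2l// normrM Ve normrM (gtr0_norm eps0).
    apply: (@le_trans _ _ (1 * (eps * W0))); last by rewrite mul1r mulrC.
    by rewrite ler_pM ?side_le1// ?mulr_ge0// ?(ltW eps0)// ler_pM2l.
  by apply: dv_eq chi' _; rewrite slE_slow// slX_slow.
have step t0 t1 i : 0 < t0 -> t0 <= t1 -> t1 < tm ->
    `|a i t1| <= K * (\sum_l `|a l t0| + eps).
  move=> t00 t01 t1m.
  have tin t : t0 <= t <= t1 -> 0 < t < tm.
    by move=> /andP[h1 h2]; rewrite (lt_le_trans t00 h1) (le_lt_trans h2 t1m).
  have tin' t : t0 <= t < t1 -> 0 < t < tm.
    by move=> /andP[h1 h2]; apply: tin; rewrite h1 ltW.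
  have tin2 t : t0 < t <= t1 -> 0 < t < tm.
    by move=> /andP[h1 h2]; apply: tin; rewrite h2 ltW.
  have wk t : 0 < t < tm -> 0 <= t < tm by move=> /andP[/ltW -> ->].
  have avd := averaged_derivatives m10 m20 hk El0 Ehk WP r0 ivE d0r d0_1 eps0 hd' sol domb.
  have avl := averaged_left m10 m20 hk El0 Ehk WP r0 ivE d0r d0_1 eps0 tau0 hd' sol domb.
  pose del := \sum_l `|a l t0|.
  have AD : averaging_data (@side R n1 n2) (ff d) W0 fm Lf C (C * W0) 0 eps t0 t1
      (fun t => slX (h t)) (fun t => slW (h t)) (fun j t => slE (h t) j)
      (fun j t => chiS (ms j) d (sX j (z t)) (sx j (z t)) (sv j (z t)))
      (fun t => slX (hb (eps * t))) (fun t => slW (hb (eps * t)))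
      (fun j t => slE (hb (eps * t)) j).
    split.
    - by move=> t /tin/wk/domz[].
    - by move=> t j /tin tt; have [] := soft_facts t tt j.
    - by move=> t /tin'/wk/domb'[].
    - move=> t j /tin'/wk tt; exact: (fP _ _ _ j hd' (domz _ tt) (domb' _ tt)).1.
    - move=> t j /tin'/wk tt; exact: (fP _ _ _ j hd' (domz _ tt) (domb' _ tt)).2.
    - by move=> t /tin'/avd[].
    - by move=> t /tin'/avd[].
    - by move=> t j /tin'/avd[].
    - move=> t /tin' tt.
      have rex j : exists rho, `|rho| <= C * W0 * eps * (1 - derive1 (kd k d) (sX j (z t) - sx j (z t))) /\
        is_derive t (1 : R) (fun s => chiS (ms j) d (sX j (z s)) (sx j (z s)) (sv j (z s)))
        (- derive1 (kd k d) (sX j (z t) - sx j (z t)) - ff d j (slX (h t)) (slE (h t) j) + rho).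
        by have [_ _ _ [rho h1 h2]] := soft_facts t tt j; exists rho.
      have [rho rhoP] := choice rex.
      exists (fun t => slX (h t)), (fun t => slW (h t)), (fun j t => slE (h t) j),
        (fun j t => chiS (ms j) d (sX j (z t)) (sx j (z t)) (sv j (z t))),
        (fun j => - derive1 (kd k d) (sX j (z t) - sx j (z t))), rho; split; last by exists 1.
      have [X' V' _ _ _] := soft_traj_sided tr tt.
      split.
      + rewrite (_ : (fun t => _) = fun s => pX (z s)); last first.
          by apply/funext => s; rewrite slX_slow.
        by apply: dv_eq X' _; rewrite slW_slow mulrC divfK ?gt_eqF.
      + rewrite (_ : (fun t => _) = fun s => pV (z s) / eps); last first.
          by apply/funext => s; rewrite slW_slow.
        by apply: dv_eq (dvMr eps^-1 V') _; field; rewrite gt_eqF.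
      + by move=> j; have [] := soft_facts t tt j.
      + by move=> j; have [] := rhoP j.
      + by move=> j; have [] := soft_facts t tt j.
      + by move=> j; have [] := rhoP j.
    - move=> t /tin2 tt; have [X' V' _ _ _] := soft_traj_sided tr tt.
      exists (slX (h t)), (slW (h t)), (fun j => slE (h t) j),
        (fun j => chiS (ms j) d (sX j (z t)) (sx j (z t)) (sv j (z t))), (fun=> 0).
      split.
      + apply: cvg_at_left_filter; rewrite slX_slow.
        rewrite (_ : (fun t => _) = fun s => pX (z s)); first exact: (dv_cont X').
        by apply/funext => s; rewrite slX_slow.
      + apply: cvg_at_left_filter; rewrite slW_slow.
        rewrite (_ : (fun t => _) = fun s => pV (z s) / eps); last first.
          by apply/funext => s; rewrite slW_slow.
        by apply: cvgM; [exact: (dv_cont V')|exact: cvg_cst].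
      + move=> j; have [_ E' _ _] := soft_facts t tt j.
        by apply: cvg_at_left_filter; exact: (dv_cont E').
      + move=> j; have [_ _ _ [rho _ c']] := soft_facts t tt j.
        by apply: cvg_at_left_filter; exact: (dv_cont c').
      + by [].
      + by rewrite big1 ?mulr0 ?addr0// => j _; rewrite mulr0.
      + by move=> j; rewrite mulr0 !mul0r subr0.
      + by move=> j; rewrite addr0.
      + by move=> j; rewrite lexx.
      + by move=> j; have [] := soft_facts t tt j.
    - by move=> t /tin2/andP[h1 /ltW h2]; apply: (avl None); rewrite h1.
    - by move=> t /tin2/andP[h1 /ltW h2]; apply: (avl (Some None)); rewrite h1.
    - by move=> t j /tin2/andP[h1 /ltW h2]; apply: (avl (Some (Some j))); rewrite h1.
  have del0 : 0 <= del by exact: sumr_ge0.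
  have dle l : `|a l t0| <= del by rewrite /del (bigD1 l)//= lerDl sumr_ge0.
  have t1T : t1 <= T / eps.
    by rewrite (le_trans (ltW t1m))// ler_pM2r// invr_gt0.
  have [] := @averaging _ _ _ _ (@side_le1 R n1 n2) W0 fm Lf C (C * W0) 0 T W00 fm0 Lf0
    (ltW C0) CW0 (lexx 0) (ltW T0) eps t0 t1 _ _ _ _ _ _ _ del heps AD _ t1T del0
    (dle None) (dle (Some None)) (fun j => dle (Some (Some j))).
    by rewrite (ltW t00).
  by case: i => [[j|]|] h1 h2 h3; [exact: h3|exact: h2|exact: h1].
have [cX [cV [cx1 [cv1 [cx2 [cv2 _]]]]]] := tr.
have os f c := @within_one_sided R f _ tm0 c.
have kc := kappa_cont hk.
have inner i t1 : 0 < t1 < tm -> `|a i t1| <= K * eps.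
  move=> /andP[t10 t1m].
  apply: (vanishing_initial_error t10 (a := a)).
    move=> l; suff : a l x @[x --> 0^'+] -->
        slow_coord l (slow m1 m2 k d eps (z 0)) - slow_coord l (hb 0) by rewrite init subrr.
    apply: cvgB; last exact: (averaged_right0 eps0 tau0 sol).
    apply: coord_slow_cvg => //.
    - exact: (os _ cX).1.
    - exact: (os _ cV).1.
    - by move=> j; exact: (os _ (cx1 j)).1.
    - by move=> j; exact: (os _ (cv1 j)).1.
    - by move=> j; exact: (os _ (cx2 j)).1.
    - by move=> j; exact: (os _ (cv2 j)).1.
  by move=> t0 l /andP[t00 /ltW t01]; apply: step.
apply: coord_norm_le; first by rewrite mulr_ge0// ltW.
move=> i; have -> : slow_coord i (hb tau) = slow_coord i (hb (eps * tm)).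
  by rewrite /tm mulrC divfK ?gt_eqF.
have c : `|a i x| @[x --> tm^'-] --> `|a i tm|.
  apply: cvg_norm; apply: cvgB; last first.
    apply: (averaged_left m10 m20 hk El0 Ehk WP r0 ivE d0r d0_1 eps0 tau0 hd' sol domb).
    by rewrite tm0 lexx.
  apply: coord_slow_cvg => //.
  - exact: (os _ cX).2.
  - exact: (os _ cV).2.
  - by move=> j; exact: (os _ (cx1 j)).2.
  - by move=> j; exact: (os _ (cv1 j)).2.
  - by move=> j; exact: (os _ (cx2 j)).2.
  - by move=> j; exact: (os _ (cv2 j)).2.
apply: (cvgr_to_le c); near=> t; apply: inner; apply/andP; split.
  by near: t; exact: nbhs_left_gt.
by near: t; exact: nbhs_left_lt.
Unshelve. all: by end_near. Qed.

End Soft.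

(** * Hard core trajectories *)

Section HardCollision.
Context {R : realType} (n1 n2 : nat).
Variables (m1 : 'I_n1 -> R) (m2 : 'I_n2 -> R) (k : R -> R).
Hypotheses (m10 : forall j, 0 < m1 j) (m20 : forall j, 0 < m2 j).
Local Notation J := ('I_n1 + 'I_n2)%type.
Local Notation ms := (mass m1 m2).

Let ms0 j : 0 < ms j. Proof. by case: j. Qed.

(** For a fixed piston the flux is [m v^2 / X], and [x / v] is the time since the wall on the way
    out. On the way back the impulse [2 m |v|] minus flux times elapsed time gives the same formula.
    It vanishes at the wall, so a reflection there causes no jump. *)
Definition chi_hard (j : J) (z : pstate R n1 n2) := - (ms j * sv j z * sx j z / sX j z).

Lemma sX_drift j (w : pstate R n1 n2) s : sX j (drift w s) = sX j w + s * (side j * pV w).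
Proof. by case: j => j /=; ring. Qed.

Lemma sx_drift j (w : pstate R n1 n2) s : sx j (drift w s) = sx j w + s * sv j w.
Proof. by case: j => j /=; ring. Qed.

Lemma sv_drift j (w : pstate R n1 n2) s : sv j (drift w s) = sv j w.
Proof. by case: j. Qed.

(** Conservation of momentum, reversal of the relative velocity, and the impulse as twice the
    reduced mass times the relative velocity. *)
Lemma elastic_exchange (M m U u : R) : 0 < M -> 0 < m ->
  let Uo := elastic M m U u in let uo := elastic m M u U in
  [/\ (M * (Uo - U) = m * (u - uo)), (u + uo = U + Uo)
    & (m * (u - uo) = 2 * m * (M / (m + M)) * (u - U))].
Proof.
move=> M0 m0; have h : m + M != 0 by rewrite gt_eqF// addr_gt0.
have h' : M + m != 0 by rewrite addrC.
by split; rewrite /elastic; field; rewrite ?h ?h'.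
Qed.

Definition impulse (w w' : pstate R n1 n2) (j : J) :=
  if sx j w == sX j w then ms j * (sv j w - sv j w') else 0.

(** The energy identity is [v^2 - v'^2 = (v - v') (v + v')] with the last factor equal to the sum of
    the piston velocities, by reversal of the relative velocity. The last hypothesis says that a
    touching particle is not slower than the piston, which makes the impulse nonnegative. At most
    one particle touches, so the sum of impulses has at most one nonzero term. *)
Lemma collision_sided (eps : R) (w w' : pstate R n1 n2) : 0 < eps ->
  0 < pX w < 1 -> collision m1 m2 (eps ^- 2) w w' ->
  (forall j : J, sx j w = sX j w -> side j * pV w <= sv j w) ->
  [/\ pX w' = pX w, pV w' = pV w + eps ^+ 2 * \sum_j side j * impulse w w' j &
    forall j : J, [/\ 0 <= impulse w w' j <= 2 * ms j * (`|sv j w| + `|pV w|),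
      ms j * sv j w' ^+ 2 / 2 =
        ms j * sv j w ^+ 2 / 2 - impulse w w' j * side j * (pV w + pV w') / 2 &
      chi_hard j w' = chi_hard j w + impulse w w' j]].
Proof.
move=> eps0 /andP[X0 X1] [[eX [ex1 ex2]] u1 u2 u12 [v1 v2 V1 V2 V0]] inc.
pose M := eps ^- 2.
have M0 : 0 < M by rewrite invr_gt0 exprn_gt0.
have eM : eps ^+ 2 * M = 1 by rewrite divff// expf_neq0// gt_eqF.
have sXe j : sX j w' = sX j w by case: j => j /=; rewrite eX.
have sxe j : sx j w' = sx j w by case: j => j /=; rewrite ?ex1 ?ex2.
have sX0 j : 0 < sX j w by case: j => j /=; [|rewrite subr_gt0].
have inr_touch i : (1 - px2 w i == 1 - pX w) = (px2 w i == pX w).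
  by apply/eqP/eqP => [|->//]; lra.
have svE j : sv j w' = if sx j w == 0 then - sv j w
    else if sx j w == sX j w then elastic (ms j) M (sv j w) (side j * pV w) else sv j w.
  case: j => j /=; rewrite ?mul1r; first by rewrite v1.
  rewrite inr_touch v2 subr_eq0 (eq_sym 1).
  by case: (px2 w j == 1) => //; case: (px2 w j == pX w) => //; rewrite /elastic -/M; ring.
have VE j : sx j w = sX j w -> side j * pV w' = elastic M (ms j) (side j * pV w) (sv j w).
  case: j => j /= h; first by rewrite !mul1r (V1 _ h).
  by rewrite (V2 j) /elastic -/M; [ring|move: h; lra].
have uniq j j' : sx j w = sX j w -> sx j' w = sX j' w -> j = j'.
  case: j => j; case: j' => j' /= h h'.
  - by congr inl; apply: u1.
  - by case: (u12 j j'); split => //; move: h'; lra.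
  - by case: (u12 j' j); split => //; move: h; lra.
  - by congr inr; apply: u2; move: h h'; lra.
have touchF j : sx j w = sX j w -> sv j w' = elastic (ms j) M (sv j w) (side j * pV w).
  by move=> h; rewrite svE h eqxx gt_eqF.
have impE j : sx j w = sX j w -> impulse w w' j = ms j * (sv j w - sv j w').
  by move=> h; rewrite /impulse h eqxx.
have imp0 j : sx j w <> sX j w -> impulse w w' j = 0.
  by move=> /eqP/negPf h; rewrite /impulse h.
have side2 j : side j * side j = 1 :> R by case: j => j /=; ring.
have VW j : sx j w = sX j w -> pV w' = pV w + eps ^+ 2 * (side j * impulse w w' j).
  move=> h; have [e _ _] := elastic_exchange (side j * pV w) (sv j w) M0 (ms0 j).
  rewrite -(touchF _ h) -(VE _ h) -(impE _ h) in e.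
  have -> : pV w' = side j * (side j * pV w') by rewrite mulrA side2 mul1r.
  have -> : side j * pV w' = side j * pV w + eps ^+ 2 * impulse w w' j.
    by rewrite -e mulrA eM; ring.
  by rewrite mulrDr mulrA side2 mul1r mulrCA.
split => //.
  have [[j h]|none] := pselect (exists j, sx j w = sX j w).
    rewrite (VW j h) (bigD1 j)//= big1 ?addr0// => i /eqP ij.
    by rewrite imp0 ?mulr0// => hi; apply: ij; exact: uniq.
  rewrite big1 ?mulr0 ?addr0.
    apply: V0 => j h; apply: none; first by exists (inl j).
    by exists (inr j); rewrite /= h.
  by move=> j _; rewrite imp0 ?mulr0// => h; apply: none; exists j.
move=> j; have [h|h] := eqVneq (sx j w) (sX j w).
  have [e1 e2 e3] := elastic_exchange (side j * pV w) (sv j w) M0 (ms0 j).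
  rewrite -(touchF _ h) -(VE _ h) -(impE _ h) in e1 e2 e3.
  have q0 : 0 <= M / (ms j + M) by rewrite divr_ge0 ?addr_ge0// ltW.
  have q1 : M / (ms j + M) <= 1.
    by rewrite ler_pdivrMr ?addr_gt0// mul1r lerDr ltW.
  have vV : 0 <= sv j w - side j * pV w by rewrite subr_ge0 inc.
  have mm2 : 0 <= 2 * ms j by rewrite mulr_ge0// ltW.
  split.
  - rewrite e3; apply/andP; split; first by apply: mulr_ge0 => //; exact: mulr_ge0.
    rewrite -(mulrA (2 * ms j)); apply: ler_wpM2l => //.
    apply: (@le_trans _ _ (1 * (sv j w - side j * pV w))); first exact: ler_wpM2r.
    rewrite mul1r; apply: le_trans (ler_norm _) _; apply: le_trans (ler_normB _ _) _.
    by rewrite lerD2l normrM -[leRHS]mul1r ler_wpM2r ?side_le1.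
  - have -> : impulse w w' j * side j * (pV w + pV w') / 2 =
        impulse w w' j * (sv j w + sv j w') / 2 by rewrite e2; field.
    by rewrite impE//; field.
  - rewrite impE// /chi_hard sXe sxe h; field; exact: lt0r_neq0.
have {}h : sx j w <> sX j w by exact/eqP.
rewrite imp0// !mul0r subr0 addr0 lexx mulr_ge0 ?addr_ge0//; last first.
  by rewrite mulr_ge0// ltW.
have [x0|x0] := eqVneq (sx j w) 0.
  split=> //; first by rewrite svE x0 eqxx sqrrN.
  by rewrite /chi_hard sxe x0 !mulr0 !mul0r.
have vv : sv j w' = sv j w by rewrite svE (negPf x0); move/eqP/negPf: h => ->.
by split=> //; rewrite ?vv// /chi_hard sXe sxe vv.
Qed.

End HardCollision.

Section Germs.
Context {R : realType}.

Lemma left_germ (f g : R -> R) (t eta : R) : 0 < eta -> {for t, continuous g} ->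
  (forall s, t - eta < s < t -> f s = g s) -> f x @[x --> t^'-] --> g t.
Proof.
move=> eta0 gc fg; apply: cvg_trans (cvg_at_left_filter gc).
apply: near_eq_cvg; near=> s; apply/esym/fg/andP; split.
  by near: s; apply: nbhs_left_gt; rewrite ltrBlDr ltrDl.
by near: s; exact: nbhs_left_lt.
Unshelve. all: by end_near. Qed.

Lemma right_germ (f g : R -> R) (t eta : R) : 0 < eta -> {for t, continuous g} ->
  (forall s, t <= s < t + eta -> f s = g s) -> f x @[x --> t^'+] --> g t.
Proof.
move=> eta0 gc fg; apply: cvg_trans (cvg_at_right_filter gc).
apply: near_eq_cvg; near=> s; apply/esym/fg/andP; split.
  by apply: ltW; near: s; exact: nbhs_right_gt.
by near: s; apply: nbhs_right_lt; rewrite ltrDl.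
Unshelve. all: by end_near. Qed.

Lemma affine_cont (a b t : R) : continuous (fun s => a + (s - t) * b).
Proof.
move=> x; apply: cvgD; first exact: cvg_cst.
apply: cvgM; last exact: cvg_cst.
by apply: cvgB; [exact: cvg_id|exact: cvg_cst].
Qed.

End Germs.

Section Hard.
Context {R : realType} (n1 n2 : nat).
Variables (m1 : 'I_n1 -> R) (m2 : 'I_n2 -> R) (k : R -> R).
Hypotheses (m10 : forall j, 0 < m1 j) (m20 : forall j, 0 < m2 j).
Hypothesis hk : kappa_hyp k.
Variables (El Eh : R) (sq dsq g dg : R -> R) (Sn : R -> R -> R -> R) (CS : R).
Hypotheses (El0 : 0 < El) (Ehk : Eh < k 0).
Hypothesis WP : wall_phase k El Eh sq dsq g dg Sn CS.
Variables (r d0 : R) (iv div : R -> R).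
Hypothesis r0 : 0 < r.
Hypothesis Hiv : c1 iv div.
Hypothesis ivE : forall y, r / 2 <= y <= 2 -> iv y = y^-1.
Hypothesis d0r : forall d E, 0 <= d <= d0 -> El <= E <= Eh ->
  `|2 * d * gam sq g E| <= r / 2.
Hypotheses (d00 : 0 <= d0) (d0_1 : d0 <= r / 4).
Variable W0 : R.
Hypothesis W00 : 0 <= W0.

Local Notation J := ('I_n1 + 'I_n2)%type.
Local Notation dom := (in_domain El Eh r W0).
Local Notation ff := (side_flux sq g iv).
Local Notation ms := (mass m1 m2).
Local Notation chiH := (chi_hard m1 m2).

Let ms0 j : 0 < ms j. Proof. by case: j. Qed.

(** A priori bounds: [vm] for velocities of energy at most [Eh], [Im] for one impulse, [Wm] and [cm]
    for the piston velocity and the correctors after one more collision, [Cr] for the effect of the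
    moving piston on a corrector. *)
Let mm := \sum_j ms j.
Let vm := 1 + \sum_j (2 * `|Eh| / ms j).
Let n : R := #|{: J}|%:R.
Let Im := 2 * mm * (vm + W0).
Let cm := mm * vm + Im.
Let Wm := W0 + n * Im.
Let Cr := mm * vm * W0 / r.

Let mm0 : 0 <= mm. Proof. by apply: sumr_ge0 => j _; exact: ltW. Qed.
Let ms_le j : ms j <= mm.
Proof. by rewrite /mm (bigD1 j)//= lerDl sumr_ge0// => i _; exact: ltW. Qed.
Let vj0 j : 0 <= 2 * `|Eh| / ms j. Proof. by rewrite divr_ge0 ?mulr_ge0// ltW. Qed.
Let vm0 : 0 <= vm. Proof. by apply: addr_ge0 => //; apply: sumr_ge0 => j _. Qed.
Let Im0 : 0 <= Im. Proof. by apply: mulr_ge0; [apply: mulr_ge0|apply: addr_ge0]. Qed.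
Let cm0 : 0 <= cm. Proof. by apply: addr_ge0 => //; apply: mulr_ge0. Qed.
Let n0 : 0 <= n. Proof. exact: ler0n. Qed.
Let Wm0 : 0 <= Wm. Proof. by apply: addr_ge0 => //; apply: mulr_ge0. Qed.
Let Cr0 : 0 <= Cr. Proof. by apply: divr_ge0; [do 2! apply: mulr_ge0 => //|exact: ltW]. Qed.

Let v_le j v : ms j * v ^+ 2 / 2 <= Eh -> `|v| <= vm.
Proof.
move=> h; have h2 : v ^+ 2 <= 2 * `|Eh| / ms j.
  by rewrite ler_pdivlMr//; have := ler_norm Eh; move: h; lra.
have h3 : 2 * `|Eh| / ms j <= \sum_j (2 * `|Eh| / ms j).
  by rewrite (bigD1 j)//= lerDl sumr_ge0.
rewrite -(@ler_pXn2r _ 2%N) ?nnegrE// real_normK ?num_real//.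
by apply: le_trans h2 _; have := vj0 j; move: h3; rewrite /vm; nra.
Qed.

Let chi_le j (z : pstate R n1 n2) : 0 <= sx j z <= sX j z -> 0 < sX j z ->
  `|sv j z| <= vm -> `|chiH j z| <= mm * vm.
Proof.
move=> /andP[x0 xX] X0 vle; rewrite /chi_hard normrN -mulrA normrM.
rewrite -[leRHS]mulr1; apply: ler_pM => //.
  by rewrite normrM (gtr0_norm (ms0 j)) ler_pM// ltW.
by rewrite ger0_norm ?divr_ge0 ?(ltW X0)// ler_pdivrMr// mul1r.
Qed.

(** Averaging is run up to the final time itself, because a collision there would spoil a passage to
    the limit from the left. Only the initial time is reached by a limit, using the free flight just
    after 0. *)
Lemma hard_estimate (T : R) : 0 < T -> exists K eps0, [/\ 0 < K, 0 < eps0 &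
  forall (eps : R) (z : R -> pstate R n1 n2) (hb : R -> 'rV[R]_(2 + n1 + n2)) (tau : R),
  0 < eps <= eps0 -> 0 < tau <= T ->
  hard_traj m1 m2 eps z (tau / eps) -> avg_sol m1 m2 k 0 hb tau ->
  hb 0 = slow m1 m2 k 0 eps (z 0) ->
  (forall s, 0 <= s < tau -> dom (hb s) /\ dom (slow m1 m2 k 0 eps (z (s / eps)))) ->
  `|slow m1 m2 k 0 eps (z (tau / eps)) - hb tau| <= K * eps].
Proof.
move=> T0.
have [fm [Lf [fm0 Lf0 fP]]] := @flux_constants _ n1 n2 _ _ _ _ _ _ _ _ _ El0 WP _ _ _ _ r0 Hiv d0r W0.
pose K := averaging_K n Wm fm Lf cm Cr Im T.
have K0 : 0 < K by rewrite averaging_K_gt0// ltW.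
exists K, (averaging_eps Cr); split => //; first exact: averaging_eps_gt0.
move=> eps z hb tau heps /andP[tau0 tauT] [tr_pos tr_right tr_left] sol init dm.
have [eps0 epsle] := andP heps.
have eps1 : eps <= 1 by apply: le_trans epsle _; rewrite /averaging_eps ge_min lexx.
have hd : 0 <= (0 : R) <= d0 by rewrite lexx d00.
pose tm := tau / eps.
have tm0 : 0 < tm by rewrite divr_gt0.
have domb s : 0 <= s < tau -> dom (hb s) by move=> /dm[].
pose h t := slow m1 m2 k 0 eps (z t).
have domz t : 0 <= t < tm -> dom (h t).
  move=> /andP[t0 tt]; have [|_] := dm (eps * t).
    by rewrite mulr_ge0 ?(ltW eps0)//= mulrC -ltr_pdivlMr.
  by rewrite mulrC mulKf ?gt_eqF// mulrC mulfK ?gt_eqF.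
have domb' t : 0 <= t < tm -> dom (hb (eps * t)).
  move=> /andP[t0 tt]; apply: domb.
  by rewrite mulr_ge0 ?(ltW eps0)//= mulrC -ltr_pdivlMr.
have pos t j : 0 <= t <= tm -> 0 <= sx j (z t) <= sX j (z t).
  move=> /tr_pos[p1 p2]; case: j => j /=; first exact: p1.
  by have /andP[q1 q2] := p2 j; apply/andP; split; lra.
have eW u : dom u -> `|eps * slW u| <= W0.
  move=> [_ hW _]; rewrite normrM (gtr0_norm eps0) -[leRHS]mul1r ler_pM// ltW//.
have VW s : pV (z s) = eps * slW (h s) by rewrite slW_slow mulrC divfK ?gt_eqF.
have vz t j : 0 <= t < tm -> `|sv j (z t)| <= vm.
  move=> /domz[_ _ /(_ j)]; rewrite slE_slow0 => /andP[_ /ltW]; exact: v_le.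
have sXz t j : 0 <= t < tm -> r < sX j (z t) < 1.
  move=> /domz[]; rewrite slX_slow => /andP[x1 x2] _ _.
  by move: r0 => r00; case: j => j /=; apply/andP; split; lra.
(* The incoming state [w] inherits its bounds from times just before [t], which matters at the final
   time, where nothing is assumed about the outgoing state. *)
have left t : 0 < t <= tm -> exists (w : pstate R n1 n2) (eta : R),
  [/\ 0 < eta /\ (forall s, t - eta < s < t -> z s = drift w (s - t)),
    pX (z t) = pX w, r <= pX w <= 1 - r, `|pV w| <= eps * W0 &
    [/\ pV (z t) = pV w + eps ^+ 2 * \sum_j side j * impulse m1 m2 w (z t) j,
      forall j, `|sv j w| <= vm, forall j, `|chiH j w| <= mm * vm &
      forall j : J, [/\ 0 <= impulse m1 m2 w (z t) j <= Im,
      ms j * sv j (z t) ^+ 2 / 2 = ms j * sv j w ^+ 2 / 2 -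
        impulse m1 m2 w (z t) j * side j * (pV w + pV (z t)) / 2 &
      chiH j (z t) = chiH j w + impulse m1 m2 w (z t) j]]].
  move=> tt; have [eta eta0 [w [wz col]]] := tr_left t tt.
  have [t0 ttm] := andP tt.
  exists w, eta.
  have [[eX [ex1 ex2]] _ _ _ _] := col.
  have sXe j : sX j (z t) = sX j w by case: j => j /=; rewrite eX.
  have sxe j : sx j (z t) = sx j w by case: j => j /=; rewrite ?ex1 ?ex2.
  (* An earlier time inside the free flight that ends at [t], so the velocities of [z s] are those
     of [w]. *)
  pose s := t - Num.min t eta / 2.
  have m0 : 0 < Num.min t eta by rewrite lt_min t0.
  have m1' : Num.min t eta <= t by rewrite ge_min lexx.
  have m2' : Num.min t eta <= eta by rewrite ge_min lexx orbT.
  have s1 : t - eta < s < t by rewrite /s; apply/andP; split; lra.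
  have s2 : 0 <= s < tm by rewrite /s; apply/andP; split; lra.
  have hX : r <= pX w <= 1 - r.
    have cX : (fun x => pX (z x)) x @[x --> t^'-] --> pX w.
      have -> : pX w = (fun s => pX w + (s - t) * pV w) t by rewrite subrr mul0r addr0.
      by apply: (left_germ eta0 (@affine_cont _ (pX w) (pV w) t t)) => x /wz ->.
    have nr : \forall x \near t^'-, r < pX (z x) < 1 - r.
      near=> x; have /domz[] : 0 <= x < tm; last by rewrite slX_slow.
      apply/andP; split.
        by apply: ltW; near: x; exact: nbhs_left_gt.
      by apply: lt_le_trans ttm; near: x; exact: nbhs_left_lt.
    apply/andP; split.
      by apply: (cvgr_to_ge cX); apply: filterS nr => x /andP[/ltW].
    by apply: (cvgr_to_le cX); apply: filterS nr => x /andP[_ /ltW].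
  have Vw : pV w = pV (z s) by rewrite wz.
  have vw j : sv j w = sv j (z s) by rewrite wz// sv_drift.
  have X01 : 0 < pX w < 1 by move: hX r0 => /andP[? ?] ?; apply/andP; split; lra.
  (* A particle in contact and slower than the piston would have been beyond the piston at the
     earlier time [s]. *)
  have inc j : sx j w = sX j w -> side j * pV w <= sv j w.
    move=> e; have /andP[_] := pos s j (ltac:(by case/andP: s2 => -> /ltW ->)).
    rewrite (wz s s1) sx_drift sX_drift e lerD2l.
    by rewrite ler_nM2l// subr_lt0; case/andP: s1.
  have [_ colV colj] := collision_sided m10 m20 eps0 X01 col inc.
  have vwle j : `|sv j w| <= vm by rewrite vw vz.
  have Vwle : `|pV w| <= eps * W0.
    rewrite Vw VW normrM (gtr0_norm eps0) ler_pM2l//; by have [] := domz s s2.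
  have Vw1 : `|pV w| <= W0 by apply: le_trans Vwle _; rewrite ler_piMl.
  split => //; split => //.
    move=> j; apply: chi_le => //.
      by rewrite -sxe -sXe; apply: pos; rewrite (ltW t0).
    by case/andP: X01 => *; case: j => j /=; lra.
  move=> j; have [/andP[i0 i1] eE ec] := colj j; split => //.
  rewrite i0 (le_trans i1)// /Im; apply: ler_pM.
  - by rewrite mulr_ge0// ltW.
  - by rewrite addr_ge0.
  - by rewrite ler_pM2l.
  - exact: lerD.
pose a (i : option (option J)) t := slow_coord i (h t) - slow_coord i (hb (eps * t)).
have step t0 i : 0 < t0 < tm -> `|a i tm| <= K * (\sum_l `|a l t0| + eps).
  move=> /andP[t00 t0m].
  have tin t : t0 <= t < tm -> 0 < t < tm by move=> /andP[h1 ->]; rewrite (lt_le_trans t00).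
  have tin2 t : t0 < t <= tm -> 0 < t <= tm by move=> /andP[h1 ->]; rewrite (lt_trans t00).
  have wk t : 0 < t < tm -> 0 <= t < tm by move=> /andP[/ltW -> ->].
  have avd := averaged_derivatives m10 m20 hk El0 Ehk WP r0 ivE d0r d0_1 eps0 hd sol domb.
  have avl := averaged_left m10 m20 hk El0 Ehk WP r0 ivE d0r d0_1 eps0 tau0 hd sol domb.
  pose del := \sum_l `|a l t0|.
  have WmW t : t0 <= t <= tm -> `|slW (h t)| <= Wm.
    move=> tt; have [lt|ge] := ltP t tm.
      have [|_ hW _] := domz t; first by rewrite lt andbT (le_trans (ltW t00))//; case/andP: tt.
      by apply: le_trans hW _; rewrite lerDl mulr_ge0.
    have tt' : 0 < t <= tm by case/andP: tt => q1 ->; rewrite (lt_le_trans t00).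
    have [w [eta [_ _ _ Vw [Ve _ _ Hj]]]] := left t tt'.
    rewrite slW_slow Ve mulrDl; apply: le_trans (ler_normD _ _) _; apply: lerD.
      by rewrite normrM (gtr0_norm (ltac:(by rewrite invr_gt0) : 0 < eps^-1)) ler_pdivrMr// mulrC.
    have -> : eps ^+ 2 * (\sum_j side j * impulse m1 m2 w (z t) j) / eps =
       eps * \sum_j side j * impulse m1 m2 w (z t) j by field; rewrite gt_eqF.
    rewrite normrM (gtr0_norm eps0) -[leRHS]mul1r ler_pM// ?(ltW eps0)//.
    apply: le_trans (ler_norm_sum _ _ _) _.
    have -> : n * Im = \sum_(j : J) Im.
      by rewrite sumr_const -mulr_natl /n; congr (_%:R * _); exact/esym/eq_card.
    apply: ler_sum => j _; rewrite normrM -[leRHS]mul1r ler_pM ?side_le1//.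
    by have [/andP[i0 i1] _ _] := Hj j; rewrite ger0_norm.
  have chiw t j : t0 <= t <= tm -> `|chiH j (z t)| <= cm.
    move=> tt; have tt' : 0 < t <= tm by case/andP: tt => q1 ->; rewrite (lt_le_trans t00).
    have [w [eta [_ _ _ Vw [_ _ cw Hj]]]] := left t tt'.
    have [/andP[i0 i1] _ ->] := Hj j; apply: le_trans (ler_normD _ _) _.
    by apply: lerD => //; rewrite ger0_norm.
  have AD : averaging_data (@side R n1 n2) (ff 0) Wm fm Lf cm Cr Im eps t0 tm
      (fun t => slX (h t)) (fun t => slW (h t)) (fun j t => slE (h t) j)
      (fun j t => chiH j (z t))
      (fun t => slX (hb (eps * t))) (fun t => slW (hb (eps * t)))
      (fun j t => slE (hb (eps * t)) j).
    split.
    - exact: WmW.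
    - exact: chiw.
    - move=> t /tin/wk/domb'[_ hW _]; apply: le_trans hW _.
      by rewrite lerDl mulr_ge0.
    - move=> t j /tin/wk tt; exact: (fP _ _ _ j hd (domz _ tt) (domb' _ tt)).1.
    - move=> t j /tin/wk tt; exact: (fP _ _ _ j hd (domz _ tt) (domb' _ tt)).2.
    - by move=> t /tin/avd[].
    - by move=> t /tin/avd[].
    - by move=> t j /tin/avd[].
    - move=> t /tin/wk tt; have [eta eta0 germ] := tr_right t tt.
      have tt' : 0 <= t <= tm by case/andP: tt => -> /ltW.
      pose V := pV (z t).
      pose L j s := sX j (z t) + (s - t) * (side j * V).
      (* Free flight: the force is 0, and the error term comes from differentiating the distance
         [L j] of the moving piston in the denominator. *)
      exists (fun s => pX (z t) + (s - t) * V), (fun=> V / eps),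
        (fun j _ => ms j * sv j (z t) ^+ 2 / 2),
        (fun j s => - (ms j * sv j (z t) * (sx j (z t) + (s - t) * sv j (z t)) / L j s)),
        (fun=> 0), (fun j => ms j * sv j (z t) * sx j (z t) * (side j * V) / sX j (z t) ^+ 2).
      have aff (p q : R) : is_derive t (1 : R) (fun s => p + (s - t) * q) q.
        apply: dv_eq (dvD (dv_cst p t) (dvMr q (dvB (dv_id t) (dv_cst t t)))) _.
        by ring.
      have Lt j : L j t = sX j (z t) by rewrite /L subrr mul0r addr0.
      split; last first.
        exists eta => // s /germ zs; rewrite /h zs.
        split.
        + by rewrite slX_slow.
        + by rewrite slW_slow.
        + by move=> j; rewrite slE_slow0 sv_drift.
        + by move=> j; rewrite /chi_hard sv_drift sx_drift sX_drift.
      split.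
      + by apply: dv_eq (aff _ _) _; rewrite mulrC divfK ?gt_eqF.
      + by apply: dv_eq (dv_cst _ _) _; rewrite big1 ?mulr0// => j _; rewrite mulr0.
      + by move=> j; apply: dv_eq (dv_cst _ _) _; rewrite mulr0 oppr0.
      + move=> j; have /andP[X0 X1] := sXz t j tt.
        have X00 : 0 < sX j (z t) by exact: lt_trans X0.
        have L0 : L j t != 0 by rewrite Lt gt_eqF.
        apply: dv_eq (dvN (dvM (dvMl (ms j * sv j (z t)) (aff (sx j (z t)) (sv j (z t))))
          (dvV L0 (aff (sX j (z t)) (side j * V))))) _.
        rewrite Lt subrr !mul0r !addr0.
        have -> : ff 0 j (pX (z t)) (ms j * sv j (z t) ^+ 2 / 2) =
            2 * (ms j * sv j (z t) ^+ 2 / 2) / sX j (z t).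
          rewrite /side_flux.
          have -> : (if j is inl _ then pX (z t) else 1 - pX (z t)) = sX j (z t) by case: (j).
          apply: (flux0 ivE d0r d00); last by rewrite !ltW.
          by have [_ _ /(_ j)] := domz t tt; rewrite slE_slow0 => /andP[? ?]; rewrite !ltW.
        by field; rewrite gt_eqF.
      + by [].
      + move=> j; have /andP[X0 X1] := sXz t j tt.
        have X00 : 0 < sX j (z t) by exact: lt_trans X0.
        have := pos t j tt' => /andP[x0 xX].
        rewrite addr0 mulr1.
        have -> : ms j * sv j (z t) * sx j (z t) * (side j * V) / sX j (z t) ^+ 2 =
           - (chiH j (z t) * (side j * V / sX j (z t))).
          by rewrite /chi_hard; field; rewrite gt_eqF.
        rewrite normrN normrM /Cr.
        have -> : mm * vm * W0 / r * eps = (mm * vm) * ((eps * W0) / r) by field; rewrite gt_eqF.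
        apply: ler_pM => //; first by apply: chi_le; rewrite ?x0 ?vz.
        rewrite normrM normrM; apply: ler_pM => //.
          have [_ hW _] := domz t tt.
          rewrite -[leRHS]mul1r ler_pM ?side_le1// /V VW normrM (gtr0_norm eps0).
          by rewrite ler_pM2l.
        by rewrite ger0_norm ?invr_ge0 ?(ltW X00)// lef_pV2 ?posrE// ltW.
    - move=> t /tin2 tt; have [w [eta [[eta0 wz] eX hX Vw [Ve vw cw Hj]]]] := left t tt.
      have X0 j : 0 < sX j w.
        by move: hX r0 => /andP[? ?] ?; case: j => j /=; lra.
      exists (pX w), (pV w / eps), (fun j => ms j * sv j w ^+ 2 / 2), (fun j => chiH j w),
        (fun j => impulse m1 m2 w (z t) j).
      split.
      + have -> : pX w = (fun s => pX w + (s - t) * pV w) t by rewrite subrr mul0r addr0.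
        apply: (left_germ eta0 (@affine_cont _ (pX w) (pV w) t t)) => x /wz zx.
        by rewrite slX_slow zx.
      + apply: (@left_germ _ _ (fun=> pV w / eps) t eta eta0); first exact: cvg_cst.
        by move=> x /wz zx; rewrite slW_slow zx.
      + move=> j; apply: (@left_germ _ _ (fun=> ms j * sv j w ^+ 2 / 2) t eta eta0); first exact: cvg_cst.
        by move=> x /wz zx; rewrite slE_slow0 zx sv_drift.
      + move=> j.
        pose c s := - (ms j * sv j w * (sx j w + (s - t) * sv j w) /
            (sX j w + (s - t) * (side j * pV w))).
        have -> : chiH j w = c t by rewrite /c subrr !mul0r !addr0.
        apply: (@left_germ _ _ c t eta eta0).
          apply: cvgN; apply: cvgM.
            by apply: cvgM; [exact: cvg_cst|exact: affine_cont].
          apply: cvgV; last exact: affine_cont.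
          by rewrite subrr mul0r addr0 gt_eqF.
        by move=> x /wz zx; rewrite /chi_hard zx sv_drift sx_drift sX_drift.
      + by rewrite slX_slow eX.
      + by rewrite slW_slow Ve; field; rewrite gt_eqF.
      + move=> j; have [_ eE _] := Hj j; rewrite slE_slow0 eE slW_slow.
        by field; rewrite gt_eqF.
      + by move=> j; have [] := Hj j.
      + by move=> j; have [] := Hj j.
      + by move=> j; apply: le_trans (cw j) _; rewrite lerDl.
    - by move=> t /tin2 tt; exact: (avl None).
    - by move=> t /tin2 tt; exact: (avl (Some None)).
    - by move=> t j /tin2 tt; exact: (avl (Some (Some j))).
  have del0 : 0 <= del by exact: sumr_ge0.
  have dle l : `|a l t0| <= del by rewrite /del (bigD1 l)//= lerDl sumr_ge0.
  have t1T : tm <= T / eps by rewrite ler_pM2r// invr_gt0.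
  have [] := @averaging _ _ _ _ (@side_le1 R n1 n2) Wm fm Lf cm Cr Im T Wm0 fm0 Lf0
    cm0 Cr0 Im0 (ltW T0) eps t0 tm _ _ _ _ _ _ _ del heps AD _ t1T del0
    (dle None) (dle (Some None)) (fun j => dle (Some (Some j))).
    by rewrite (ltW t00) ltW.
  by case: i => [[j|]|] h1 h2 h3; [exact: h3|exact: h2|exact: h1].
apply: coord_norm_le; first by rewrite mulr_ge0// ltW.
move=> i; have -> : slow_coord i (hb tau) = slow_coord i (hb (eps * tm)).
  by rewrite /tm mulrC divfK ?gt_eqF.
apply: (vanishing_initial_error tm0 (a := a)) => // l.
suff : a l x @[x --> 0^'+] --> slow_coord l (h 0) - slow_coord l (hb 0).
  by rewrite init subrr.
apply: cvgB; last exact: (averaged_right0 eps0 tau0 sol).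
have [|eta eta0 germ] := tr_right 0; first by rewrite lexx.
have rg (f : R -> R) (p q : R) : (forall s, 0 <= s < 0 + eta -> f s = p + (s - 0) * q) ->
    f x @[x --> 0^'+] --> p.
  move=> fg; have -> : p = (fun s => p + (s - 0) * q) 0 by rewrite subrr mul0r addr0.
  exact: (right_germ eta0 (@affine_cont _ p q 0 0) fg).
have kc := kappa_cont hk.
apply: coord_slow_cvg => //.
- by apply: (rg _ _ (pV (z 0))) => s /germ ->.
- by apply: (rg _ _ 0) => s /germ ->; rewrite /= mulr0 addr0.
- by move=> j; apply: (rg _ _ (pv1 (z 0) j)) => s /germ ->.
- by move=> j; apply: (rg _ _ 0) => s /germ ->; rewrite /= mulr0 addr0.
- by move=> j; apply: (rg _ _ (pv2 (z 0) j)) => s /germ ->.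
- by move=> j; apply: (rg _ _ 0) => s /germ ->; rewrite /= mulr0 addr0.
Unshelve. all: by end_near. Qed.

End Hard.

(** * Margins from compactness and the choice of constants *)

Lemma compact_subset_oo {R : realType} (A : set R) (a b : R) : a < b -> compact A ->
  A `<=` `]a, b[ ->
  exists a' b', [/\ a < a', a' <= b', b' < b & forall x, A x -> a' < x < b'].
Proof.
move=> ab cA sA; have [A0|nA] := pselect (A !=set0); last first.
  exists ((a + b) / 2), ((a + b) / 2); split; [lra|exact: lexx|lra|].
  by move=> x Ax; case: nA; exists x.
have ic : {within A, continuous (fun x : R => x)}.
  by apply: continuous_subspaceT => x; exact: cvg_id.
have [M /[!inE] AM hM] := compact_EVT_max A0 cA ic.
have [m /[!inE] Am hm] := compact_EVT_min A0 cA ic.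
have := sA _ AM; have := sA _ Am; rewrite /= !in_itv/= => /andP[am mb] /andP[aM Mb].
have mM : m <= M by apply: hm; rewrite inE.
(* Halfway between the extreme points of the compact set and the ends of the interval, for strict
   inequalities on both sides. *)
exists ((a + m) / 2), ((M + b) / 2); split; [lra|lra|lra|] => x Ax.
have xM : x <= M by apply: hM; rewrite inE.
have xm : m <= x by apply: hm; rewrite inE.
by apply/andP; split; lra.
Qed.

Lemma inv_extension {R : realType} (a b : R) : 0 < a -> a <= b ->
  exists iv div : R -> R, c1 iv div /\ forall y, a <= y <= b -> iv y = y^-1.
Proof.
move=> a0 ab.
have y0 y : a <= y <= b -> y != 0.
  by move=> /andP[ay _]; rewrite gt_eqF// (lt_le_trans a0).
have [||iv [div [H e]]] := @c1_extension R (fun y => y^-1) (fun y => - 1 / y ^+ 2) a b ab.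
- by move=> y /y0 yn; exact: (@dvV _ (fun y => y) y 1 yn (dv_id y)).
- move=> y /y0 yn; apply: cvgM; first exact: cvg_cst.
  by apply: cvgV; [rewrite expf_neq0|exact: exprn_continuous].
by exists iv, div; split => // y /e[].
Qed.

Theorem theorem2 (R : realType) (n1 n2 : nat)
  (m1 : 'I_n1 -> R) (m2 : 'I_n2 -> R) (k : R -> R)
  (A B C : set R) (V : set 'rV[R]_(2 + n1 + n2)) :
  (0 < n1)%N -> (0 < n2)%N ->
  (forall j, 0 < m1 j) -> (forall j, 0 < m2 j) ->
  kappa_hyp k ->
  compact A -> A `<=` `]0, 1[ ->
  compact B ->
  compact C -> C `<=` `]0, k 0[ ->
  compact V ->
  (forall h, V h ->
     [/\ A (slX h), B (slW h), (forall j, C (slE1 h j)) & (forall j, C (slE2 h j))]) ->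
  exists2 d0 : R, 0 < d0 &
    C1_on (fun p : R * 'rV[R]_(2 + n1 + n2) => Hbar m1 m2 k p.1 p.2)
          [set p | 0 <= p.1 <= d0 /\ V p.2] /\
    forall T : R, 0 < T ->
      exists K : R, exists2 eps0 : R, 0 < K & 0 < eps0 /\
      forall (eps d : R), 0 < eps <= eps0 -> 0 <= d <= d0 ->
      forall (z : R -> pstate R n1 n2) (hb : R -> 'rV[R]_(2 + n1 + n2)) (tau : R),
        0 <= tau <= T ->
        traj m1 m2 k d eps z (tau / eps) ->
        avg_sol m1 m2 k d hb tau ->
        hb 0 = slow m1 m2 k d eps (z 0) ->
        V (hb 0) ->
        (forall s, 0 <= s < tau -> V (hb s) /\ V (slow m1 m2 k d eps (z (s / eps)))) ->
        `| slow m1 m2 k d eps (z (tau / eps)) - hb tau | <= K * eps.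
Proof.
move=> _ _ m10 m20 hk cA sA cB cC sC _ VP.
have k00 : 0 < k 0.
  by have := kappa_decr hk ltr01 (lexx 1); rewrite (kappa_ge1 hk (lexx 1)).
have [a [b [a0 ab b1 AP]]] := compact_subset_oo ltr01 cA sA.
have [El [Eh [El0 ElEh Ehk CP]]] := compact_subset_oo k00 cC sC.
have [W0 W00 BP] : exists2 W0, 0 <= W0 & forall x, B x -> `|x| <= W0.
  have [M [_ HM]] := compact_bounded cB; exists (`|M| + 1); first by rewrite addr_ge0.
  by move=> x Bx; apply: (HM (`|M| + 1)) => //; rewrite ltr_pwDr// ler_norm.
(* Lower bound for the distance of the piston to both walls. *)
pose r := Num.min a (1 - b).
have r0 : 0 < r by rewrite lt_min a0 subr_gt0.
have ra : r <= a by rewrite ge_min lexx.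
have rb : r <= 1 - b by rewrite ge_min lexx orbT.
have r1 : r <= 1 by lra.
have Vdom h : V h -> in_domain El Eh r W0 h.
  move=> /VP[/AP/andP[x1 x2] /BP hW h1 h2]; split => //.
    by apply/andP; split; lra.
  by case=> j; [exact: CP (h1 j)|exact: CP (h2 j)].
have [sq [dsq [g [dg [Sn [CS WP]]]]]] := ex_wall_phase hk El0 ElEh Ehk.
have [iv [div [Hiv ivE]]] := @inv_extension R (r / 2) 2 ltac:(lra) ltac:(lra).
have gamc : continuous (gam sq g).
  by move=> E; exact: dv_cont ((gam_c1 (wp_sq WP) (wp_g WP)).1 E).
have [G G0 GP] := cont_bounded Eh gamc.
(* Chosen to give both [d0 <= r / 4], so that the cores at the two ends of an interval never
   overlap, and [2 d0 G <= r / 2], so that the effective length stays in the range where [iv] is the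
   inverse. *)
pose d0 := r / (4 * (1 + G)).
have G1 : 0 < 4 * (1 + G) by lra.
have d00 : 0 < d0 by rewrite divr_gt0.
have d0G : 4 * (d0 + d0 * G) = r by rewrite /d0; field; rewrite gt_eqF//; lra.
have d0G0 : 0 < d0 * G by rewrite mulr_gt0.
have d0_1 : d0 <= r / 4 by lra.
have d0r d E : 0 <= d <= d0 -> El <= E <= Eh -> `|2 * d * gam sq g E| <= r / 2.
  move=> /andP[dp dd0] /andP[E1 E2].
  have gE : `|gam sq g E| <= G by apply: GP; rewrite ger0_norm//; lra.
  rewrite normrM (ger0_norm (mulr_ge0 (ler0n _ 2) dp)) -mulrA.
  have : d * `|gam sq g E| <= d0 * G by apply: ler_pM.
  by lra.
exists d0 => //; split.
  have [dG cG] := C1_Hbar_ext n1 n2 WP Hiv.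
  (* The extended field is C^1 everywhere, including negative [d], so the whole space serves as the
     open neighbourhood. *)
  exists setT, (fun p => Hbar_ext sq g iv p.1 p.2); split.
  - exact: openT.
  - by [].
  - by move=> p _; exact: dG.
  - by move=> v p _; exact: cG.
  move=> [d h] /= [hd /Vdom[/andP[x1 x2] _ hE]].
  rewrite (HbarE m10 m20 hk El0 Ehk WP r0 ivE d0r d0_1)//; first by rewrite !ltW.
  - by move=> j; have /andP[e1 e2] := hE (inl j); rewrite !ltW.
  - by move=> j; have /andP[e1 e2] := hE (inr j); rewrite !ltW.
move=> T T0.
have [K1 [e1 [K10 e10 soft]]] :=
  soft_estimate m10 m20 hk El0 Ehk WP r0 r1 Hiv ivE d0r d0_1 W00 T0.
have [K2 [e2 [K20 e20 hard]]] :=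
  hard_estimate m10 m20 hk El0 Ehk WP r0 Hiv ivE d0r (ltW d00) d0_1 W00 T0.
exists (K1 + K2), (Num.min e1 e2); first exact: addr_gt0.
split; first by rewrite lt_min e10.
move=> eps d /andP[eps0]; rewrite le_min => /andP[ee1 ee2] /andP[dp dd0] z hb tau.
move=> /andP[tau0 tauT] tr sol init _ VV.
have dm s : 0 <= s < tau -> in_domain El Eh r W0 (hb s) /\
    in_domain El Eh r W0 (slow m1 m2 k d eps (z (s / eps))).
  by move=> /VV[/Vdom ? /Vdom].
have KK K : K <= K1 + K2 -> K * eps <= (K1 + K2) * eps by move=> ?; rewrite ler_pM2r.
(* For [tau = 0] the two sides start from the same point; the estimates below require a time
   interval of positive length. *)
move: tau0; rewrite le_eqVlt => /predU1P[t0|tau0].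
  by rewrite -t0 mul0r init subrr normr0 mulr_ge0 ?addr_ge0// ltW.
move: tr; rewrite /traj; case: eqP => [d_0|/eqP d_0] tr; last first.
  apply: le_trans (KK K1 _); last by rewrite lerDl ltW.
  by apply: soft => //; rewrite ?eps0 ?tau0// lt_neqAle eq_sym d_0 dp.
subst d; apply: le_trans (KK K2 _); last by rewrite lerDr ltW.
by apply: hard => //; rewrite ?eps0 ?tau0.
Qed.
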